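(* Let $\varepsilon\in(0,1)$ be any constant. There is a constant $C=C(\varepsilon)>0$ such that the following holds for every $n\in\mathbb{N}$ and every $p\in(4n^{-1/2},1/2)$. Let $X$ be the number of triangles in $G(n,p)$, let $\mu=\mathbb{E}(X)$ and $\sigma^2=\mathrm{Var}(X)$. Then $$\sum_{x\in\mathbb{N}}\left|\frac{1}{\sqrt{2\pi\sigma^2}}e^{-\frac{(x-\mu)^2}{2\sigma^2}}-\mathbb{P}(X=x)\right|\le C\,\frac{p^{1/2}}{n^{1/2-\varepsilon}}.$$
   Context: $G(n,p)$ is the Erdős–Rényi random graph on the vertex set $[n]=\{1,\dots,n\}$, in which each edge of the complete graph $K_n$ is included independently with probability $p$. The number of triangles is the number of (unlabelled) copies of $K_3$ in the graph. In the sum, $\mathbb{N}$ is the set of non-negative integers. *)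

(* Defs.v *)
From HB Require Import structures.
From mathcomp Require Import all_boot all_order all_algebra.
From mathcomp Require Import all_classical all_reals all_analysis.
Set Implicit Arguments.
Unset Strict Implicit.
Unset Printing Implicit Defensive.
Import Order.TTheory GRing.Theory Num.Theory.
Import numFieldNormedType.Exports.
Local Open Scope classical_set_scope.
Local Open Scope ring_scope.

Definition edge (n : nat) := {e : {set 'I_n} | #|e| == 2%N}.

Definition graph (n : nat) := {set edge n}.

HB.instance Definition _ n := Finite.on (graph n).
HB.instance Definition _ n := isPointed.Build (graph n) finset.set0.
HB.instance Definition _ n := @isMeasurable.Build default_measure_display
  (graph n) discrete_measurable discrete_measurable0
  discrete_measurableC discrete_measurableU.

(* A copy of K_3 in G is determined by its vertex set: three vertices all of
   whose pairs are edges of G. *)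
Definition triangles (n : nat) (G : graph n) : nat :=
  #|[set T : {set 'I_n} |
      (#|T| == 3%N) && [forall e : edge n, (val e \subset T) ==> (e \in G)]]%SET|.

Definition gnp_pmf (R : realType) (n : nat) (p : R) (G : graph n) : R :=
  \prod_(e : edge n) bernoulli_pmf p (e \in G).

(* As for bernoulli_prob, a junk value (the Dirac mass at the empty graph) is
   used when p is not in [0, 1], so that this is always a probability. *)
Definition gnp (R : realType) (n : nat) (p : R) : set (graph n) -> \bar R :=
  fun A => if 0 <= p <= 1 then (\sum_(G \in A) (gnp_pmf p G)%:E)%E
           else \d_(finset.set0 : graph n) A.

Section gnp_probability.
Context (R : realType) (n : nat) (p : R).

Lemma gnp_pmf_ge0 (G : graph n) : 0 <= p <= 1 -> 0 <= gnp_pmf p G.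
Proof. by move=> p01; apply: prodr_ge0 => e _; exact: bernoulli_pmf_ge0. Qed.

Lemma gnp_pmf_sum1 : \sum_(G : graph n) gnp_pmf p G = 1.
Proof.
transitivity (\prod_(e : edge n) (p + (1 - p))); last first.
  by rewrite big1// => e _; rewrite subrKC.
by rewrite bigA_distr.
Qed.

Let gnp0 : gnp p (@set0 (graph n)) = 0%E.
Proof. by rewrite /gnp; case: ifPn => // p01; rewrite fsbig_set0. Qed.

Let gnp_ge0 (U : set (graph n)) : (0 <= gnp p U)%E.
Proof.
rewrite /gnp; case: ifPn => // p01; rewrite fsbig_finite//= sumEFin lee_fin.
by apply: sumr_ge0 => /= G _; exact: gnp_pmf_ge0.
Qed.

Let gnp_sigma_additive : semi_sigma_additive (@gnp R n p).
Proof.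
move=> F mF tF mUF; rewrite /gnp; case: ifPn => p01; last first.
  exact: measure_semi_sigma_additive.
apply: cvg_toP.
  apply: ereal_nondecreasing_is_cvgn => m k mk.
  apply: lee_sum_nneg_natr => // i _ _.
  rewrite fsbig_finite//= sumEFin lee_fin.
  by apply: sumr_ge0 => /= G _; exact: gnp_pmf_ge0.
transitivity (\sum_(0 <= i <oo) (\esum_(G in F i) (gnp_pmf p G)%:E))%E.
  apply: eq_eseriesr => k _; rewrite esum_fset//= => G _.
  by rewrite lee_fin gnp_pmf_ge0.
rewrite -nneseries_sum_bigcup//=; last first.
  by move=> G; rewrite lee_fin gnp_pmf_ge0.
by rewrite esum_fset//= => G _; rewrite lee_fin gnp_pmf_ge0.
Qed.

HB.instance Definition _ := isMeasure.Build _ _ _ (@gnp R n p)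
  gnp0 gnp_ge0 gnp_sigma_additive.

Let gnp_setT : gnp p [set: graph n] = 1%E.
Proof.
rewrite /gnp; case: ifPn => [_|_]; last by rewrite probability_setT.
rewrite (fsbig_fwiden (enum (graph n)))//=.
- by rewrite big_enum/= sumEFin gnp_pmf_sum1.
- by move=> G _ /=; rewrite mem_enum.
- exact: enum_uniq.
- by move=> G [_ /(_ I)].
Qed.

HB.instance Definition _ :=
  @Measure_isProbability.Build _ _ R (@gnp R n p) gnp_setT.

End gnp_probability.

(* Main.v *)
Require Import Defs.
From HB Require Import structures.
From mathcomp Require Import all_boot all_order all_algebra.
From mathcomp Require Import all_classical all_reals all_analysis.
From mathcomp Require Import ring lra.
Set Implicit Arguments.
Unset Strict Implicit.
Unset Printing Implicit Defensive.
Import Order.TTheory GRing.Theory Num.Theory.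
Import numFieldNormedType.Exports.
Local Open Scope ring_scope.

(** Write N(t) for the squared modulus of the characteristic function of t X. By Fourier
    inversion P(X = x) is the mean over [0, pi] of E cos (t (X - x)), so it suffices to
    compare E cos (th + t (X - mu)) with cos th * exp (- sigma^2 t^2 / 2) for
    t <= A / sigma, where A = n^(eps/8), and to show that N(t) is smaller than every power
    of 1/n for A / sigma <= t <= pi; the bulk |x - mu| <= A sigma is summed pointwise, and
    the mass of the tail of X is one minus the mass of its bulk.

    - Small t: Stein's method for the locally dependent sum of the centred triangle
      indicators gives F' = - t sigma^2 F up to O(t^2 n^5 p^7).
    - Large t, t^2 n^3 p^3 >= A^2: split the vertices in two classes and resample the edges inside each,
      keeping the crossing ones. The difference of the two triangle counts is linear in
      the crossing edges, with coefficients that are differences of codegrees; these are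
      typically of order (n p^2)^(1/2).
    - Intermediate t: reveal all edges except those inside disjoint blocks whose size is
      chosen so that t X restricted to one block has variance of constant order. The
      blocks are then independent; each is a linear form in its edges, with codegrees as
      coefficients, plus a small perturbation. *)

(** * Product measures on subsets of a finite set *)

(** Put v = n^(1/2) and r = p^(1/2), so that sigma is of order v^4 r^5. At t = A / sigma the Stein
    error is of order A^3 / (v^2 r). Integrating over [0, A / sigma] and summing over O(A sigma)
    integers turns it into A^5 / (v^2 r), and 1 / (v^2 r) <= (r / v) / 4 is precisely n^(1/2) p >=
    4. With A^5 <= n^eps this is the rate of the theorem.

    Beyond A / sigma one mechanism is not enough. Comparing two copies cancels the mean n p^2 of a
    codegree and leaves its fluctuation (n p^2)^(1/2), so decoupling is effective only from A / (v^3
    r^3) on, a factor of order n^(1/2) p above A / sigma. In the gap t times a codegree stays below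
    pi with overwhelming probability, the cosine does not wrap around, and the codegrees themselves
    can be used.

    Complex numbers are avoided: an arbitrary phase th inside the cosine plays the role of a factor
    exp(i th). The estimate needs A above a constant depending only on eps; below it n is bounded
    and a crude bound is absorbed in C. *)

Section product_space.
Import mathcomp.boot.fintype mathcomp.boot.finset.
Context (R : realType) (E : finType) (p : R).
Hypothesis p01 : 0 <= p <= 1.

Implicit Types (G H A B : {set E}) (f g : {set E} -> R).

(** The weight of [gnp_pmf] over an arbitrary finite set of coordinates. Expectations are finite
    sums until the last section, which identifies them with integrals against [gnp]. *)
Definition pmass G : R := \prod_(e : E) bernoulli_pmf p (e \in G).

Definition Ex f : R := \sum_G pmass G * f G.

(** Resampling: for independent G and H this has the law of a single sample ([Ex_mix]), so fixing H
    conditions on the coordinates outside A. *)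
Definition mix A G H : {set E} := (G :&: A) :|: (H :\: A).

(** Measurability with respect to the coordinates in A. *)
Definition depends_on A f := forall G H, G :&: A = H :&: A -> f G = f H.

Lemma pmass_ge0 G : 0 <= pmass G.
Proof. by apply: prodr_ge0 => e _; exact: bernoulli_pmf_ge0. Qed.

Lemma Ex_prod_coord (u : E -> bool -> R) :
  Ex (fun G => \prod_e u e (e \in G)) = \prod_e (p * u e true + (1 - p) * u e false).
Proof.
transitivity (\sum_(G : {set E})
    \prod_e (bernoulli_pmf p (e \in G) * u e (e \in G))).
  by apply: eq_bigr => G _; rewrite /pmass big_split.
rewrite bigA_distr; apply: eq_bigr => G _; apply: eq_bigr => e _.
by case: (e \in G).
Qed.

Lemma Ex_cst c : Ex (fun=> c) = c.
Proof.
rewrite /Ex -mulr_suml -[RHS]mul1r; congr (_ * _).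
transitivity (\prod_(e : E) (p * 1 + (1 - p) * 1)); last first.
  by rewrite big1// => e _; rewrite !mulr1 subrKC.
rewrite -(Ex_prod_coord (fun _ _ => 1)).
by apply: eq_bigr => G _; rewrite [X in _ = _ * X]big1 ?mulr1.
Qed.

Lemma eq_Ex f g : f =1 g -> Ex f = Ex g.
Proof. by move=> fg; apply: eq_bigr => G _; rewrite fg. Qed.

Lemma ExD f g : Ex (fun G => f G + g G) = Ex f + Ex g.
Proof. by rewrite /Ex -big_split; apply: eq_bigr => G _; rewrite mulrDr. Qed.

Lemma ExZ c f : Ex (fun G => c * f G) = c * Ex f.
Proof. by rewrite /Ex mulr_sumr; apply: eq_bigr => G _; rewrite mulrCA. Qed.

Lemma ExN f : Ex (fun G => - f G) = - Ex f.
Proof. by rewrite /Ex -sumrN; apply: eq_bigr => G _; rewrite mulrN. Qed.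

Lemma ExB f g : Ex (fun G => f G - g G) = Ex f - Ex g.
Proof. by rewrite ExD ExN. Qed.

Lemma Ex_sum (I : Type) (r : seq I) (P : pred I) (F : I -> {set E} -> R) :
  Ex (fun G => \sum_(i <- r | P i) F i G) = \sum_(i <- r | P i) Ex (F i).
Proof.
rewrite /Ex exchange_big/=; apply: eq_bigr => G _; exact: mulr_sumr.
Qed.

Lemma le_Ex f g : (forall G, f G <= g G) -> Ex f <= Ex g.
Proof. by move=> fg; apply: ler_sum => G _; rewrite ler_wpM2l ?pmass_ge0. Qed.

Lemma Ex_ge0 f : (forall G, 0 <= f G) -> 0 <= Ex f.
Proof. by move=> f0; rewrite -(Ex_cst 0); exact: le_Ex. Qed.

Lemma Ex_norm f : `|Ex f| <= Ex (fun G => `|f G|).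
Proof.
rewrite ler_norml -ExN; apply/andP; split; apply: le_Ex => G; last exact: ler_norm.
by rewrite lerNl -normrN ler_norm.
Qed.

Lemma Ex_exchange (F : {set E} -> {set E} -> R) :
  Ex (fun G => Ex (fun H => F G H)) = Ex (fun H => Ex (fun G => F G H)).
Proof.
rewrite /Ex; under eq_bigr do rewrite mulr_sumr.
rewrite exchange_big/=; apply: eq_bigr => G _; rewrite mulr_sumr.
by apply: eq_bigr => H _; rewrite mulrCA.
Qed.

Lemma Ex_sqr_le f : Ex f ^+ 2 <= Ex (fun G => f G ^+ 2).
Proof.
have : 0 <= Ex (fun G => (f G - Ex f) ^+ 2) by apply: Ex_ge0 => G; exact: sqr_ge0.
have -> : Ex (fun G => (f G - Ex f) ^+ 2) =
    Ex (fun G => f G ^+ 2 + (- (2 * Ex f) * f G + Ex f ^+ 2)).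
  by apply: eq_Ex => G; ring.
by rewrite ExD ExD ExZ Ex_cst; lra.
Qed.

Lemma in_mix A G H e : (e \in mix A G H) = if e \in A then e \in G else e \in H.
Proof. by rewrite !inE; case: (e \in A); rewrite ?andbT ?andbF ?orbF. Qed.

Lemma mixI A G H : mix A G H :&: A = G :&: A.
Proof. by apply/setP => e; rewrite !inE; case: (e \in A); rewrite ?andbF// !andbT orbF. Qed.

Lemma mixIC A G H : mix A G H :&: ~: A = H :&: ~: A.
Proof. by apply/setP => e; rewrite !inE; case: (e \in A); rewrite ?andbF// !andbT. Qed.

(* The map (G, H) |-> (mix A G H, mix A H G) is a mass-preserving involution. *)
Lemma Ex_mix A f : Ex (fun G => Ex (fun H => f (mix A G H))) = Ex f.
Proof.
transitivity (Ex (fun G => Ex (fun H => f G))); last by apply: eq_Ex => G; exact: Ex_cst.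
have pairE (F : {set E} -> {set E} -> R) : Ex (fun G => Ex (F G)) =
    \sum_(x : {set E} * {set E}) pmass x.1 * pmass x.2 * F x.1 x.2.
  rewrite -(pair_bigA _ (fun G H => pmass G * pmass H * F G H))/=.
  by apply: eq_bigr => G _; rewrite /Ex mulr_sumr; apply: eq_bigr => H _; rewrite mulrA.
rewrite !pairE/=.
pose s (x : {set E} * {set E}) := (mix A x.1 x.2, mix A x.2 x.1).
have sK : involutive s.
  have mixK G H : mix A (mix A G H) (mix A H G) = G.
    by apply/setP => e; rewrite !in_mix; case: (e \in A).
  by case=> G H; rewrite /s/= !mixK.
rewrite [RHS](reindex_inj (inv_inj sK))/=.
apply: eq_bigr => -[G H] _ /=; congr (_ * _).
rewrite /pmass -!big_split/=; apply: eq_bigr => e _; rewrite !in_mix.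
by case: (e \in A) => //; exact: mulrC.
Qed.

Lemma Ex_indep A f g : depends_on A f -> depends_on (~: A) g ->
  Ex (fun G => f G * g G) = Ex f * Ex g.
Proof.
move=> fA gA; rewrite -(Ex_mix A).
transitivity (Ex (fun G => f G * Ex g)).
  apply: eq_Ex => G; rewrite -ExZ; apply: eq_Ex => H.
  by rewrite (fA _ G) ?mixI// (gA _ H) ?mixIC.
rewrite [RHS]mulrC -ExZ; apply: eq_Ex => G; exact: mulrC.
Qed.

Lemma depends_onS A B f : A \subset B -> depends_on A f -> depends_on B f.
Proof.
move=> AB fA G H GH; apply: fA.
by rewrite -(setIidPr AB) !setIA GH.
Qed.

Lemma depends_on_comp (phi : R -> R) A f :
  depends_on A f -> depends_on A (fun G => phi (f G)).
Proof. by move=> fA G H GH; rewrite (fA _ _ GH). Qed.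

Lemma depends_on2 (phi : R -> R -> R) A f g :
  depends_on A f -> depends_on A g -> depends_on A (fun G => phi (f G) (g G)).
Proof. by move=> fA gA G H GH; rewrite (fA _ _ GH) (gA _ _ GH). Qed.

Lemma disjoint_subsetC A B : A :&: B = set0 -> B \subset ~: A.
Proof. by move=> AB; rewrite -disjoints_subset -setI_eq0 setIC AB. Qed.

Lemma Ex_prod (I : finType) (A : I -> {set E}) (F : I -> {set E} -> R) :
  (forall i j, i != j -> A i :&: A j = set0) ->
  (forall i, depends_on (A i) (F i)) ->
  Ex (fun G => \prod_i F i G) = \prod_i Ex (F i).
Proof.
move=> dA FA; rewrite -big_enum.
transitivity (Ex (fun G => \prod_(i <- enum I) F i G)).
  by apply: eq_Ex => G; rewrite big_enum.
have := enum_uniq I; elim: (enum I) => [_|i s IH /= /andP[si us]].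
  by rewrite big_nil -[RHS]Ex_cst; apply: eq_Ex => G; rewrite big_nil.
rewrite big_cons -IH// -(Ex_indep (FA i)); last first.
  move=> G H GH; rewrite !big_seq; apply: eq_bigr => j js.
  apply: depends_onS (FA j) _ _ GH; apply/disjoint_subsetC/dA.
  by apply: contraNneq si => ->.
by apply: eq_Ex => G; rewrite big_cons.
Qed.

Lemma Ex_coord (u : bool -> R) e :
  Ex (fun G => u (e \in G)) = p * u true + (1 - p) * u false.
Proof.
transitivity (Ex (fun G => \prod_e' (if e' == e then u (e' \in G) else 1))).
  by apply: eq_Ex => G; rewrite -big_mkcond/= big_pred1_eq.
rewrite (Ex_prod_coord (fun e' b => if e' == e then u b else 1)).
rewrite (bigD1 e)//= eqxx big1 ?mulr1// => e' /negPf ->.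
by rewrite !mulr1 subrKC.
Qed.

Lemma Ex_subset (S : {set E}) : Ex (fun G => (S \subset G)%:R) = p ^+ #|S|.
Proof.
transitivity (Ex (fun G => \prod_e' ((e' \in S) ==> (e' \in G))%:R)).
  apply: eq_Ex => G; case: (boolP (S \subset G)) => [/subsetP SG|/subsetPn[e eS eG]].
    by rewrite big1// => e _; case: (boolP (e \in S)) => // /SG ->.
  by rewrite (bigD1 e)//= eS (negPf eG) mul0r.
rewrite (Ex_prod_coord (fun e' b => ((e' \in S) ==> b)%:R)).
rewrite -prodr_const [RHS]big_mkcond; apply: eq_bigr => e _.
case: (e \in S) => /=; first by rewrite mulr1 mulr0 addr0.
by rewrite !mulr1 subrKC.
Qed.

Lemma depends_on_subset (S A : {set E}) : S \subset A ->
  depends_on A (fun G => (S \subset G)%:R).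
Proof.
move=> SA G H GH; congr (nat_of_bool _)%:R.
have eqI (K : {set E}) : (S \subset K) = (S \subset K :&: A) by rewrite subsetI SA andbT.
by rewrite eqI GH -eqI.
Qed.

(* |E exp(i Z)|^2 *)
Definition cfsq f : R := Ex (fun G => cos (f G)) ^+ 2 + Ex (fun G => sin (f G)) ^+ 2.

Lemma cfsq_ge0 f : 0 <= cfsq f.
Proof. by rewrite addr_ge0 ?sqr_ge0. Qed.

Lemma Ex_cosD th f : Ex (fun G => cos (th + f G)) =
  cos th * Ex (fun G => cos (f G)) - sin th * Ex (fun G => sin (f G)).
Proof. by rewrite -!ExZ -ExB; apply: eq_Ex => G; exact: cosD. Qed.

Lemma Ex_sinD th f : Ex (fun G => sin (th + f G)) =
  sin th * Ex (fun G => cos (f G)) + cos th * Ex (fun G => sin (f G)).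
Proof. by rewrite -!ExZ -ExD; apply: eq_Ex => G; exact: sinD. Qed.

Lemma cfsq_shift th f : cfsq (fun G => th + f G) = cfsq f.
Proof.
rewrite /cfsq Ex_cosD Ex_sinD; have := cos2Dsin2 th.
set a := Ex _; set b := Ex _ => h.
transitivity ((cos th ^+ 2 + sin th ^+ 2) * (a ^+ 2 + b ^+ 2)); first by ring.
by rewrite h mul1r.
Qed.

(** The shift th only rotates the characteristic function, so dropping the sine part bounds the
    cosine mean for all phases at once. *)
Lemma Ex_cos_le_cfsq th f : Ex (fun G => cos (th + f G)) ^+ 2 <= cfsq f.
Proof. by rewrite -(cfsq_shift th) lerDl sqr_ge0. Qed.

Lemma eq_cfsq f g : f =1 g -> cfsq f = cfsq g.
Proof. by move=> fg; rewrite /cfsq; congr (_ ^+ 2 + _ ^+ 2); apply: eq_Ex => G; rewrite fg. Qed.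

Lemma cfsq_indep A f g : depends_on A f -> depends_on (~: A) g ->
  cfsq (fun G => f G + g G) = cfsq f * cfsq g.
Proof.
move=> fA gA; rewrite /cfsq.
rewrite (_ : Ex (fun G => cos (f G + g G)) = Ex (fun G => cos (f G)) * Ex (fun G => cos (g G))
   - Ex (fun G => sin (f G)) * Ex (fun G => sin (g G))); last first.
  by rewrite -!(@Ex_indep A) -?ExB; [apply: eq_Ex => G; exact: cosD|exact: depends_on_comp..].
rewrite (_ : Ex (fun G => sin (f G + g G)) = Ex (fun G => sin (f G)) * Ex (fun G => cos (g G))
   + Ex (fun G => cos (f G)) * Ex (fun G => sin (g G))); last first.
  by rewrite -!(@Ex_indep A) -?ExD; [apply: eq_Ex => G; exact: sinD|exact: depends_on_comp..].
ring.
Qed.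

Lemma cfsq_sum (I : finType) (A : I -> {set E}) (F : I -> {set E} -> R) :
  (forall i j, i != j -> A i :&: A j = set0) ->
  (forall i, depends_on (A i) (F i)) ->
  cfsq (fun G => \sum_i F i G) = \prod_i cfsq (F i).
Proof.
move=> dA FA; rewrite -big_enum.
transitivity (cfsq (fun G => \sum_(i <- enum I) F i G)).
  by apply: eq_cfsq => G; rewrite big_enum.
have := enum_uniq I; elim: (enum I) => [_|i s IH /= /andP[si us]].
  rewrite big_nil /cfsq; under eq_Ex do rewrite big_nil.
  under [X in _ + X ^+ 2]eq_Ex do rewrite big_nil.
  by rewrite cos0 sin0 !Ex_cst expr1n expr0n addr0.
rewrite big_cons -IH// -(cfsq_indep (FA i)); last first.
  move=> G H GH; rewrite !big_seq; apply: eq_bigr => j js.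
  apply: depends_onS (FA j) _ _ GH; apply/disjoint_subsetC/dA.
  by apply: contraNneq si => ->.
by apply: eq_cfsq => G; rewrite big_cons.
Qed.

Lemma cfsq_bernoulli q x f :
  Ex (fun G => f G) = q -> (forall G, f G = 0 \/ f G = 1) ->
  cfsq (fun G => x * f G) = 1 - 2 * q * (1 - q) * (1 - cos x).
Proof.
move=> fq f01.
have cE : Ex (fun G => cos (x * f G)) = 1 + (cos x - 1) * q.
  rewrite -fq -ExZ -[X in X + _]Ex_cst -ExD; apply: eq_Ex => G.
  by case: (f01 G) => ->; rewrite ?mulr0 ?mulr1 ?cos0; ring.
have sE : Ex (fun G => sin (x * f G)) = sin x * q.
  rewrite -fq -ExZ; apply: eq_Ex => G.
  by case: (f01 G) => ->; rewrite ?mulr0 ?sin0 ?mulr1.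
rewrite /cfsq cE sE; have := cos2Dsin2 x => h.
rewrite exprMn (_ : sin x ^+ 2 = 1 - cos x ^+ 2); last by rewrite -h; ring.
ring.
Qed.

(** The squared modulus is the characteristic function of the symmetrised variable f(G) - f(H),
    which is real. *)
Lemma Ex_cos_copies f : Ex (fun G => Ex (fun H => cos (f G - f H))) = cfsq f.
Proof.
rewrite /cfsq !expr2 -!ExZ -ExD; apply: eq_Ex => G.
rewrite (mulrC _ (cos _)) (mulrC _ (sin _)) -!ExZ -ExD; apply: eq_Ex => H.
exact: cosB.
Qed.

(** Jensen for the squared modulus of a conditional expectation, given the coordinates outside A
    (carried by H). Both the bipartition and the block argument start here. *)
Lemma cfsq_le_mix A f :
  cfsq f <= Ex (fun H => cfsq (fun G => f (mix A G H))).
Proof.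
rewrite /cfsq -(Ex_mix A (fun G => cos _)) -(Ex_mix A (fun G => sin _)).
rewrite ExD; apply: lerD; rewrite Ex_exchange; exact: Ex_sqr_le.
Qed.

End product_space.

(** * Elementary real inequalities *)

Section real_inequalities.
Context {R : realType}.
Implicit Types x y a b : R.

(** The mean value theorem for g - f. Comparing derivatives on an interval takes the place of
    integration in most estimates below. *)
Lemma le_increment (f g df dg : R -> R) a b : a <= b ->
  (forall x, a <= x <= b -> is_derive x 1 f (df x)) ->
  (forall x, a <= x <= b -> is_derive x 1 g (dg x)) ->
  (forall x, a <= x <= b -> df x <= dg x) -> f b - f a <= g b - g a.
Proof.
move=> ab fd gd fg.
have hd x : a <= x <= b -> is_derive x 1 (g - f) (dg x - df x).
  by move=> xab; have := fd x xab; have := gd x xab => *; exact: is_deriveB.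
have [||c cab] := @MVT_segment R (g - f) (fun x => dg x - df x) a b ab.
- by move=> x xab; apply: hd; move: xab; rewrite in_itv/= => /andP[/ltW-> /ltW->].
- apply: derivable_within_continuous => x; rewrite in_itv/= => /hd xd.
  exact: ex_derive.
rewrite !fctE => e; rewrite -subr_ge0.
have -> : g b - g a - (f b - f a) = g b - f b - (g a - f a) by ring.
rewrite e mulr_ge0 ?subr_ge0 ?fg//.
Qed.

Lemma eq_increment (f g df : R -> R) a b : a <= b ->
  (forall x, a <= x <= b -> is_derive x 1 f (df x)) ->
  (forall x, a <= x <= b -> is_derive x 1 g (df x)) -> f b - f a = g b - g a.
Proof.
by move=> ab fd gd; apply/eqP; rewrite eq_le !(@le_increment _ _ df df).
Qed.

Lemma norm_increment (f g df dg : R -> R) a b : a <= b ->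
  (forall x, a <= x <= b -> is_derive x 1 f (df x)) ->
  (forall x, a <= x <= b -> is_derive x 1 g (dg x)) ->
  (forall x, a <= x <= b -> `|df x| <= dg x) -> `|f b - f a| <= g b - g a.
Proof.
move=> ab fd gd fg; rewrite ler_norml; apply/andP; split.
  rewrite lerNl.
  have -> : - (f b - f a) = (- f b) - (- f a) by ring.
  apply: (@le_increment (- f) g (- df) dg) => // x xab.
    by have := fd x xab => *; exact: is_deriveN.
  by rewrite fctE (le_trans (ler_norm _))// normrN fg.
by apply: (@le_increment _ _ df dg) => // x xab; rewrite (le_trans (ler_norm _))// fg.
Qed.

Lemma norm_sin_le x : `|sin x| <= `|x|.
Proof.
have h (y : R) : 0 <= y -> `|sin y| <= y.
  move=> y0; have := @norm_increment sin id cos (fun=> 1) 0 y y0.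
  by rewrite sin0 !subr0; apply => // z _; exact: cos_max.
have [x0|x0] := leP 0 x; first by rewrite (le_trans (h _ _))// ler_norm.
by rewrite -normrN -sinN (le_trans (h _ _))// ?oppr_ge0 ?(ltW x0)// ltr0_norm.
Qed.

Lemma one_sub_cosE x : 1 - cos x = 2 * sin (x / 2) ^+ 2.
Proof.
have -> : cos x = cos ((x / 2) *+ 2) by congr cos; rewrite -mulr_natr; field.
by rewrite cos_mulr2n sin2cos2; ring.
Qed.

Lemma one_sub_cos_ge0 x : 0 <= 1 - cos x.
Proof. by rewrite subr_ge0 cos_le1. Qed.

Lemma one_sub_cos_le x : 1 - cos x <= x ^+ 2 / 2.
Proof.
rewrite one_sub_cosE.
have : sin (x / 2) ^+ 2 <= (x / 2) ^+ 2.
  by rewrite -(@real_normK _ (sin _)) ?num_real// -(@real_normK _ (x / 2)) ?num_real//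
    ler_sqr ?nnegrE// norm_sin_le.
by move=> h; lra.
Qed.

Lemma norm_cosD_sub a x : `|cos (a + x) - cos a| <= `|x|.
Proof.
have -> : cos (a + x) - cos a = - (2 * sin (a + x / 2) * sin (x / 2)).
  have -> : a + x = (a + x / 2) + x / 2 by field.
  rewrite -{2}[a](addrK (x / 2)) cosD cosB; ring.
rewrite normrN !normrM ger0_norm//.
have h1 : `|sin (a + x / 2)| <= 1 by exact: sin_max.
have h2 := norm_sin_le (x / 2); rewrite normrM [X in _ <= _ * X]ger0_norm// in h2.
have := normr_ge0 (sin (a + x / 2)); have := normr_ge0 (sin (x / 2)).
nra.
Qed.

Lemma norm_sinD_sub2 a x : `|sin (a + x) - sin a - x * cos a| <= x ^+ 2 / 2.
Proof.
have pos (b y : R) : 0 <= y -> `|sin (b + y) - sin b - y * cos b| <= y ^+ 2 / 2.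
  move=> y0.
  have := @norm_increment (fun z => sin (b + z) - z * cos b) (fun z => z ^+ 2 / 2)
    (fun z => cos (b + z) - cos b) (fun z => z) 0 y y0.
  rewrite addr0 mul0r expr0n/= mul0r !subr0.
  have -> : sin (b + y) - y * cos b - sin b = sin (b + y) - sin b - y * cos b by ring.
  apply => z /andP[z0 zy].
  - by apply: is_derive_eq; rewrite /GRing.scale/=; ring.
  - by apply: is_derive_eq; rewrite /GRing.scale/=; field.
  - by rewrite -[leRHS]ger0_norm// norm_cosD_sub.
have [x0|x0] := leP 0 x; first exact: pos.
have := pos (- a) (- x); rewrite oppr_ge0 ltW// => /(_ isT).
rewrite -opprD !sinN cosN sqrrN.
by rewrite -[in leLHS]normrN; congr (`|_| <= _); ring.
Qed.

(* x/2 >= sin(x/2) >= (x/2)(1 - x^2/24) only covers x <= 2; on [2, pi] use cos <= cos 2 < 0. *)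
Lemma one_sub_cos_ge x : `|x| <= pi -> x ^+ 2 / 16 <= 1 - cos x.
Proof.
move=> xpi; rewrite -(real_normK (num_real x)) -(cos_norm x).
move: (normr_ge0 x) xpi; move: (`|x| : R) => y y0 ypi.
have pi4 : (pi : R) < 4 by have := pihalf_lt2 R; lra.
have [y2|y2] := leP y 2; last first.
  have : cos y < 0.
    rewrite (lt_trans _ (cos2_lt0 R))// ltr_cos ?in_itv/= ?y0 ?ypi ?ler0n ?pi_ge2//.
  by move=> c; nra.
have s (z : R) : 0 <= z -> z - z ^+ 3 / 6 <= sin z.
  move=> z0.
  have := @le_increment (fun z => z - z ^+ 3 / 6) sin (fun z => 1 - z ^+ 2 / 2) cos 0 z z0.
  rewrite sin0 expr0n/= mul0r !subr0; apply => t /andP[t0 _].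
  - by apply: is_derive_eq; rewrite /GRing.scale/=; field.
  - by have := one_sub_cos_le t; lra.
rewrite one_sub_cosE.
have := s (y / 2) ltac:(lra).
set S := sin _ => h.
have h1 : y / 2 * (5 / 6) <= S by apply: le_trans h; nra.
have : (y / 2 * (5 / 6)) ^+ 2 <= S ^+ 2 by rewrite ler_sqr ?nnegrE; lra.
nra.
Qed.

Lemma expRN_le y : 0 <= y -> expR (- y) <= 1 - y + y ^+ 2 / 2.
Proof.
move=> y0.
have h (z : R) : 0 <= z -> 1 - z <= expR (- z) by move=> _; have := expR_ge1Dx (- z); lra.
have := @le_increment (fun z => expR (- z)) (fun z => 1 - z + z ^+ 2 / 2)
  (fun z => - expR (- z)) (fun z => - 1 + z) 0 y y0.
move=> /= H; suff : expR (- y) - expR (- 0) <= 1 - y + y ^+ 2 / 2 - (1 - 0 + 0 ^+ 2 / 2).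
  by rewrite [in expR (- 0)]oppr0 expR0; lra.
apply: H => z /andP[z0 _].
- by apply: is_derive_eq; rewrite /GRing.scale/=; ring.
- by apply: is_derive_eq; rewrite /GRing.scale/=; field.
- by have := h z z0; lra.
Qed.

Lemma one_sub_expRN_ge y : 0 <= y <= 1 -> y / 2 <= 1 - expR (- y).
Proof. by move=> /andP[y0 y1]; have := expRN_le y0; nra. Qed.

Lemma expR_le_quad x : `|x| <= 1 -> expR x <= 1 + x + x ^+ 2.
Proof.
move=> /ler_normlP[x1 x2].
have [x0|x0] := leP 0 x; last first.
  by have := @expRN_le (- x); rewrite opprK; nra.
have p : 0 < 1 - x + x ^+ 2 / 2 by nra.
have e0 := expR_gt0 x; have em := expRxMexpNx_1 x.
have em0 := expR_gt0 (- x).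
have e1 : expR (- x) >= 1 - x + x ^+ 2 / 2 - x ^+ 3 / 6.
  have := @le_increment (fun z => 1 - z + z ^+ 2 / 2 - z ^+ 3 / 6) (fun z => expR (- z))
   (fun z => - 1 + z - z ^+ 2 / 2)  (fun z => - expR (- z)) 0 x x0.
  move=> /= H.
  suff : 1 - x + x ^+ 2 / 2 - x ^+ 3 / 6 - (1 - 0 + 0 ^+ 2 / 2 - 0 ^+ 3 / 6) <= expR (- x) - expR (- 0).
    by rewrite [in expR (- 0)]oppr0 expR0; lra.
  apply: H => z /andP[z0 _].
  - by apply: is_derive_eq; rewrite /GRing.scale/=; field.
  - by apply: is_derive_eq; rewrite /GRing.scale/=; ring.
  - by have := expRN_le z0; lra.
(* [e1] bounds exp(-x) below by its cubic Taylor polynomial, so it is enough that the product of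
   that polynomial with 1 + x + x^2 is at least 1. *)
have q : 1 <= (1 + x + x ^+ 2) * (1 - x + x ^+ 2 / 2 - x ^+ 3 / 6).
  rewrite -subr_ge0.
  have -> : (1 + x + x ^+ 2) * (1 - x + x ^+ 2 / 2 - x ^+ 3 / 6) - 1 =
    x ^+ 2 * (1 / 2 - 2 / 3 * x + x ^+ 2 / 3 - x ^+ 3 / 6) by field.
  by apply: mulr_ge0; [exact: sqr_ge0|nra].
rewrite -(ler_pM2r em0) em; apply: (le_trans q).
by rewrite ler_wpM2l//; nra.
Qed.

Lemma pow4_le_cosh x : x ^+ 4 <= 24 * (expR x + expR (- x)).
Proof.
have h (y : R) : 0 <= y -> y ^+ 4 <= 24 * expR y.
  by move=> y0; have := @expR_ge1Dxn _ y 3 y0; rewrite /factorial/=; lra.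
have [x0|x0] := leP 0 x; first by have := h x x0; have := expR_gt0 (- x); lra.
have := h (- x) ltac:(lra); have := expR_gt0 x.
have -> : (- x) ^+ 4 = x ^+ 4 by ring.
by lra.
Qed.

End real_inequalities.

(** * Stein's method under local dependence *)

Section local_dependence.
Import mathcomp.boot.fintype mathcomp.boot.finset.
Context (R : realType) (E : finType) (p : R).
Hypothesis p01 : 0 <= p <= 1.
Context (I : finType) (s : I -> {set E}) (Y : I -> {set E} -> R).
Hypothesis Ydep : forall i, depends_on (s i) (Y i).
Hypothesis Y0 : forall i, Ex p (Y i) = 0.

Local Notation Ex := (Ex p).
Definition overlap i j := s i :&: s j != set0.

Let W G := \sum_i Y i G.

(** The two kinds of error in the expansion: E|Yi Yj Yk| comes from perturbing the argument of a
    sine or cosine inside a joint expectation, E|Yi Yj| E|Yk| from restoring W in the factor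
    decoupled from Yi Yj. *)
Definition triple_moment := \sum_i \sum_(j | overlap i j) \sum_(k | overlap i k || overlap j k)
  (Ex (fun G => `|Y i G * Y j G * Y k G|) +
   Ex (fun G => `|Y i G * Y j G|) * Ex (fun G => `|Y k G|)).

Let far_dep (A : {set E}) (P : pred I) (th t : R) :
  (forall k, P k -> s k :&: A = set0) ->
  depends_on (~: A) (fun G => th + t * \sum_(k | P k) Y k G).
Proof.
move=> PA G H GH; congr (_ + _ * _); apply: eq_bigr => k Pk; apply: Ydep.
have kA : s k \subset ~: A by apply: disjoint_subsetC; rewrite setIC PA.
by rewrite -(setIidPr kA) !setIA GH.
Qed.

Let sum_split_meets i G : W G = \sum_(j | ~~ overlap i j) Y j G + \sum_(j | overlap i j) Y j G.
Proof. by rewrite /W (bigID (overlap i)) addrC. Qed.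

Let far_split i j G : \sum_(k | ~~ overlap i k) Y k G =
  \sum_(k | ~~ (overlap i k || overlap j k)) Y k G + \sum_(k | overlap j k && ~~ overlap i k) Y k G.
Proof.
rewrite (bigID (overlap j))/= addrC; congr (_ + _); apply: eq_bigl => k.
  by rewrite negb_or.
by rewrite andbC.
Qed.

Let W_split i j G : W G =
  \sum_(k | ~~ (overlap i k || overlap j k)) Y k G + \sum_(k | overlap i k || overlap j k) Y k G.
Proof. by rewrite /W (bigID (fun k => overlap i k || overlap j k)) addrC. Qed.

Lemma variance_local_dependence :
  Ex (fun G => W G ^+ 2) = \sum_i \sum_(j | overlap i j) Ex (fun G => Y i G * Y j G).
Proof.
transitivity (\sum_i \sum_j Ex (fun G => Y i G * Y j G)).
  under eq_bigr do rewrite -Ex_sum.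
  rewrite -Ex_sum; apply: eq_Ex => G; rewrite expr2 mulr_suml; apply: eq_bigr => i _.
  by rewrite mulr_sumr.
apply: eq_bigr => i _; rewrite (bigID (overlap i))/= [X in _ + X]big1 ?addr0// => j.
rewrite negbK => /eqP ij; rewrite (Ex_indep _ (@Ydep i)) ?Y0 ?mul0r//.
apply: depends_onS (@Ydep j); exact: disjoint_subsetC.
Qed.

(** Dropping the neighbours of j as well makes the cosine independent of Yi Yj. The terms dropped
    are paid for inside the joint expectation, and all terms missing from W are paid for in the
    product. *)
Let pair_step (t th : R) i j : 0 <= t -> overlap i j ->
  `|Ex (fun G => Y i G * Y j G * cos (th + t * \sum_(k | ~~ overlap i k) Y k G))
    - Ex (fun G => Y i G * Y j G) * Ex (fun G => cos (th + t * W G))| <=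
  t * \sum_(k | overlap j k && ~~ overlap i k) Ex (fun G => `|Y i G * Y j G * Y k G|) +
  t * \sum_(k | overlap i k || overlap j k)
    Ex (fun G => `|Y i G * Y j G|) * Ex (fun G => `|Y k G|).
Proof.
move=> t0 ij; set V := fun G => \sum_(k | ~~ (overlap i k || overlap j k)) Y k G.
have indep : Ex (fun G => Y i G * Y j G * cos (th + t * V G)) =
    Ex (fun G => Y i G * Y j G) * Ex (fun G => cos (th + t * V G)).
  apply: (@Ex_indep _ _ _ (s i :|: s j)).
    apply: depends_on2; first exact: depends_onS (subsetUl _ _) (@Ydep i).
    exact: depends_onS (subsetUr _ _) (@Ydep j).
  apply: depends_on_comp; apply: far_dep => k; rewrite negb_or !negbK => /andP[/eqP ki /eqP kj].
  by rewrite setIUr [s k :&: s i]setIC ki [s k :&: s j]setIC kj setU0.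
apply: le_trans (ler_distD (Ex (fun G => Y i G * Y j G * cos (th + t * V G))) _ _) _.
apply: lerD.
  rewrite -ExB (le_trans (Ex_norm p01 _))// -Ex_sum -ExZ; apply: le_Ex => // G.
  rewrite -mulrBr normrM (far_split i j) mulrDr addrA.
  apply: (@le_trans _ _ (`|Y i G * Y j G| * (t * `|\sum_(k | overlap j k && ~~ overlap i k) Y k G|))).
    by rewrite ler_wpM2l// (le_trans (norm_cosD_sub _ _))// normrM ger0_norm.
  rewrite mulrCA ler_wpM2l// (le_trans (ler_wpM2l _ (ler_norm_sum _ _ _)))//.
  by rewrite mulr_sumr; apply: ler_sum => k _; rewrite -normrM.
rewrite indep -mulrBr normrM -mulr_sumr mulrCA; apply: ler_pM => //; first exact: Ex_norm.
rewrite distrC -ExB (le_trans (Ex_norm p01 _))// -Ex_sum -ExZ; apply: le_Ex => // G.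
rewrite (W_split i j) mulrDr addrA (le_trans (norm_cosD_sub _ _))// normrM ger0_norm//.
by rewrite ler_wpM2l// ler_norm_sum.
Qed.

(** Yi is centred and independent of the sum V over its non-neighbours, so E(Yi sin(th + t V)) = 0
    can be subtracted; expanding the sine about V leaves the main term and a quadratic error. *)
Let single_step (t th : R) i : 0 <= t ->
  `|Ex (fun G => Y i G * sin (th + t * W G))
    - t * \sum_(j | overlap i j) Ex (fun G => Y i G * Y j G * cos (th + t * \sum_(k | ~~ overlap i k) Y k G))|
  <= t ^+ 2 * \sum_(j | overlap i j) \sum_(k | overlap i k) Ex (fun G => `|Y i G * Y j G * Y k G|).
Proof.
move=> t0; set V := fun G => \sum_(k | ~~ overlap i k) Y k G.
set Z := fun G => \sum_(k | overlap i k) Y k G.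
have indep : Ex (fun G => Y i G * sin (th + t * V G)) = 0.
  rewrite (Ex_indep _ (@Ydep i)) ?Y0 ?mul0r//.
  by apply: depends_on_comp; apply: far_dep => k; rewrite negbK setIC => /eqP.
rewrite -[X in `|X - _|]subr0 -{1}indep -ExB -Ex_sum -ExZ -ExB.
rewrite (le_trans (Ex_norm p01 _))//; under eq_bigr do rewrite -Ex_sum.
rewrite -Ex_sum -ExZ; apply: le_Ex => // G.
rewrite -mulr_suml -mulr_sumr (sum_split_meets i) -/(V G) -/(Z G).
apply: (@le_trans _ _ (`|Y i G| * ((t * Z G) ^+ 2))).
  have -> : Y i G * sin (th + t * (V G + Z G)) - Y i G * sin (th + t * V G) -
    t * (Y i G * Z G * cos (th + t * V G)) =
    Y i G * (sin ((th + t * V G) + t * Z G) - sin (th + t * V G) - t * Z G * cos (th + t * V G)).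
    by rewrite mulrDr addrA; ring.
  rewrite normrM ler_wpM2l// (le_trans (norm_sinD_sub2 _ _))//.
  by have := sqr_ge0 (t * Z G); lra.
rewrite exprMn mulrCA ler_wpM2l ?sqr_ge0//.
rewrite -(real_normK (num_real (Z G))).
have zz : `|Z G| ^+ 2 <= (\sum_(k | overlap i k) `|Y k G|) ^+ 2.
  by rewrite ler_sqr ?nnegrE ?sumr_ge0// ler_norm_sum.
apply: le_trans (ler_wpM2l (normr_ge0 _) zz) _.
rewrite expr2 mulr_suml mulr_sumr; apply: ler_sum => j _.
rewrite !mulr_sumr; apply: ler_sum => k _.
by rewrite !normrM mulrA.
Qed.

(** An approximate differential equation for u -> E cos(th + u W). The factor 2 adds the errors of
    [single_step] and [pair_step], each at most t^2 times [triple_moment]. *)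
Lemma stein_local_dependence (t th : R) : 0 <= t ->
  `|Ex (fun G => W G * sin (th + t * W G))
    - t * Ex (fun G => W G ^+ 2) * Ex (fun G => cos (th + t * W G))| <=
  2 * t ^+ 2 * triple_moment.
Proof.
move=> t0; rewrite variance_local_dependence.
have -> : Ex (fun G => W G * sin (th + t * W G)) =
    \sum_i Ex (fun G => Y i G * sin (th + t * W G)).
  by rewrite -Ex_sum; apply: eq_Ex => G; rewrite mulr_suml.
rewrite [X in _ - X * _]mulr_sumr [X in _ - X]mulr_suml -sumrB (le_trans (ler_norm_sum _ _ _))//.
rewrite /triple_moment mulr_sumr; apply: ler_sum => i _.
set c := Ex (fun G => cos _).
set M := \sum_(j | overlap i j) Ex (fun G => Y i G * Y j G * cos (th + t * \sum_(k | ~~ overlap i k) Y k G)).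
apply: le_trans (ler_distD (t * M) _ _) _.
have h1 := single_step th i t0; rewrite -/M in h1.
have h2 : `|t * M - t * (\sum_(j | overlap i j) Ex (fun G => Y i G * Y j G)) * c| <=
   t ^+ 2 * \sum_(j | overlap i j) \sum_(k | overlap i k || overlap j k)
  (Ex (fun G => `|Y i G * Y j G * Y k G|) +
   Ex (fun G => `|Y i G * Y j G|) * Ex (fun G => `|Y k G|)).
  rewrite -mulrA -mulrBr normrM ger0_norm// expr2 -mulrA ler_wpM2l//.
  rewrite /M mulr_suml -sumrB (le_trans (ler_norm_sum _ _ _))// mulr_sumr.
  apply: ler_sum => j ij; rewrite (le_trans (pair_step th t0 ij))// -mulrDr ler_wpM2l//.
  rewrite big_split/= lerD2r.
  rewrite big_mkcond [leRHS]big_mkcond; apply: ler_sum => k _.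
  have e0 : 0 <= Ex (fun G => `|Y i G * Y j G * Y k G|) by apply: Ex_ge0.
  by case: (overlap i k); case: (overlap j k).
apply: le_trans (lerD h1 h2) _.
rewrite -mulrDr -mulrA mulrCA ler_wpM2l ?sqr_ge0//.
rewrite [leRHS]mulr_natl mulr2n lerD2r.
apply: ler_sum => j ij; rewrite big_mkcond [leRHS]big_mkcond; apply: ler_sum => k _.
have e0 : 0 <= Ex (fun G => `|Y i G * Y j G * Y k G|) by apply: Ex_ge0.
have e1 : 0 <= Ex (fun G => `|Y i G * Y j G|) by apply: Ex_ge0.
have e2 : 0 <= Ex (fun G => `|Y k G|) by apply: Ex_ge0.
by case: (overlap i k); case: (overlap j k) => //=; rewrite ?lerDl ?addr_ge0 ?mulr_ge0.
Qed.

(* Integrating F' = - t sigma^2 F + O(t^2), F t = E cos (th + t W), against exp(sigma^2 t^2 / 2). *)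
Lemma gaussian_cf_local_dependence (t th : R) : 0 <= t ->
  `|Ex (fun G => cos (th + t * W G)) - cos th * expR (- (Ex (fun G => W G ^+ 2) * t ^+ 2 / 2))| <=
  2 * t ^+ 3 * triple_moment.
Proof.
set v := Ex (fun G => W G ^+ 2) => t0.
have T0 : 0 <= triple_moment.
  do 3! apply: sumr_ge0 => ? _.
  by rewrite addr_ge0 ?mulr_ge0//; apply: Ex_ge0.
have v0 : 0 <= v by apply: Ex_ge0 => // G; exact: sqr_ge0.
pose F (u : R) := Ex (fun G => cos (th + u * W G)).
pose dF (u : R) := - Ex (fun G => W G * sin (th + u * W G)).
have Fd (u : R) : is_derive u 1 F (dF u).
  rewrite /F /Ex.
  (* Reindexing by ordinals puts the finite sum in the form that [is_derive_sum] differentiates. *)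
  have -> : (fun u => \sum_G pmass p G * cos (th + u * W G)) =
      \sum_(i < #|{set E}|) (fun u => pmass p (enum_val i) * cos (th + u * W (enum_val i))).
    apply/funext => x; rewrite fct_sumE (reindex (@enum_val _ {set E}))//=.
    exact: (onW_bij _ (@enum_val_bij _)).
  have -> : dF u = \sum_(i < #|{set E}|)
      - (pmass p (enum_val i) * (W (enum_val i) * sin (th + u * W (enum_val i)))).
    rewrite /dF /Ex -sumrN (reindex (@enum_val _ {set E}))//=.
    exact: (onW_bij _ (@enum_val_bij _)).
  apply: is_derive_sum => i.
  by apply: is_derive_eq; rewrite /GRing.scale/=; ring.
pose H (u : R) := F u * expR (v * u ^+ 2 / 2).
pose dH (u : R) := (dF u + u * v * F u) * expR (v * u ^+ 2 / 2).
have Hd (u : R) : is_derive u 1 H (dH u).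
  have := Fd u => ?; rewrite /H /dH.
  by apply: is_derive_eq; rewrite /GRing.scale/=; field.
have dHle (u : R) : 0 <= u <= t -> `|dH u| <= 2 * t ^+ 2 * triple_moment * expR (v * t ^+ 2 / 2).
  move=> /andP[u0 ut]; rewrite /dH normrM [X in _ * X]ger0_norm ?expR_ge0//.
  have ut2 : u ^+ 2 <= t ^+ 2 by rewrite ler_sqr ?nnegrE.
  apply: ler_pM => //.
    rewrite -normrN.
    have -> : - (dF u + u * v * F u) = Ex (fun G => W G * sin (th + u * W G)) - u * v * F u.
      by rewrite /dF; ring.
    apply: (le_trans (stein_local_dependence th u0)).
    by rewrite ler_wpM2r// ler_wpM2l.
  by rewrite ler_expR ler_wpM2r// ler_wpM2l.
have := @norm_increment _ H (fun u : R => 2 * t ^+ 2 * triple_moment * expR (v * t ^+ 2 / 2) * u)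
   dH (fun=> 2 * t ^+ 2 * triple_moment * expR (v * t ^+ 2 / 2)) 0 t t0.
move=> /= h.
have {h} : `|H t - H 0| <= 2 * t ^+ 2 * triple_moment * expR (v * t ^+ 2 / 2) * t -
    2 * t ^+ 2 * triple_moment * expR (v * t ^+ 2 / 2) * 0.
  apply: h => // u _.
  by apply: is_derive_eq; rewrite /GRing.scale/=; ring.
rewrite mulr0 subr0 {1}/H /H expr0n/= mulr0 mul0r expR0 mulr1.
have -> : F 0 = cos th.
  by rewrite /F -[RHS](Ex_cst E p); apply: eq_Ex => G; rewrite mul0r addr0.
rewrite -/(F t); set e := expR _ => h.
have e0 : 0 < e by exact: expR_gt0.
have eN : expR (- (v * t ^+ 2 / 2)) = e^-1 by rewrite expRN.
rewrite eN.
have -> : F t - cos th * e^-1 = (F t * e - cos th) * e^-1 by field; rewrite gt_eqF.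
rewrite normrM (ger0_norm (_ : 0 <= e^-1)) ?invr_ge0 ?(ltW e0)// ler_pdivrMr//.
by apply: le_trans h _; rewrite le_eqVlt; apply/orP; left; apply/eqP; ring.
Qed.

End local_dependence.

(** * Counting triangles *)

Section arithmetic.
Context {R : realType}.
Implicit Types u q x y z : R.

(** Here q = p^3, while x, y, z and u are p to the sizes of the pairwise unions and of the triple
    union of three triangles. The left side is the expansion of E (1_T + q)(1_T' + q)(1_T'' + q):
    eight terms, each at most u. *)
Lemma triple_arith u q x y z : x * q <= u -> y * q <= u -> z * q <= u -> q * q * q <= u ->
  u + q * x + q * y + q * z + (q * q * (q + q + q) + q * q * q) <= 8 * u.
Proof. by lra. Qed.

Lemma pair_arith q x : q * q <= x -> x + (q * (q + q) + q * q) <= 4 * x.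
Proof. by lra. Qed.

Lemma combine_arith u q x : x * q <= u -> 8 * u + 4 * x * (2 * q) <= 16 * u.
Proof. by lra. Qed.

End arithmetic.

Section triangle_counting.
Import mathcomp.boot.fintype mathcomp.boot.finset.
Context (n : nat).
Implicit Types (T A : {set 'I_n}) (e : edge n) (S : {set edge n}).

Definition edges_in A : {set edge n} := [set e : edge n | val e \subset A].

Lemma edges_inS A (B : {set 'I_n}) : A \subset B -> edges_in A \subset edges_in B.
Proof. by move=> AB; apply/subsetP => e; rewrite !inE => /subset_trans ->. Qed.

Lemma card_setU_setD (I : finType) (A B : {set I}) : #|A :|: B| = (#|A| + #|B :\: A|)%N.
Proof.
rewrite -(cardsID A (A :|: B)); congr (_ + _)%N.
  by rewrite setIC; congr #|pred_of_set _|; apply/setIidPl; exact: subsetUl.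
by rewrite setDUl setDv set0U.
Qed.

Lemma card_edge e : #|val e| = 2%N.
Proof. by apply/eqP; case: e. Qed.

Lemma card_edges_in A : #|edges_in A| = 'C(#|A|, 2).
Proof.
rewrite -cards_draws -(card_imset _ (@val_inj _ _ _ : injective (val : edge n -> _))).
apply: eq_card => B; rewrite !inE; apply/imsetP/andP => [[e]|[BA B2]].
  by rewrite inE => eA ->; rewrite eA card_edge.
by exists (exist _ B B2 : edge n); rewrite ?inE.
Qed.

Lemma card_triangle_edges T : #|T| == 3%N -> #|edges_in T| = 3%N.
Proof. by move=> /eqP T3; rewrite card_edges_in T3. Qed.

Lemma triangles_sum (G : graph n) :
  triangles G = (\sum_(T : {set 'I_n} | #|T| == 3%N) (edges_in T \subset G))%N.
Proof.
rewrite /triangles -sum1_card big_mkcond [RHS]big_mkcond; apply: eq_bigr => T _.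
rewrite inE; case: (#|T| == 3%N) => //=.
have -> : [forall e : edge n, (val e \subset T) ==> (e \in G)] = (edges_in T \subset G).
  apply/forallP/subsetP => [h e|h e]; first by rewrite inE => eT; exact: (implyP (h e)).
  by apply/implyP => eT; apply: h; rewrite inE.
by case: (_ \subset _).
Qed.

(** A triangle through e is e together with an apex w off e. *)
Lemma sum_triangles_edge (V : nmodType) (P : pred {set 'I_n}) (F : {set 'I_n} -> V) e :
  \sum_(T : {set 'I_n} | [&& #|T| == 3%N, val e \subset T & P T]) F T =
  \sum_(w : 'I_n | (w \notin val e) && P (w |: val e)) F (w |: val e).
Proof.
pose D := [set w : 'I_n | (w \notin val e) && P (w |: val e)].
have inj : {in D &, injective (fun w : 'I_n => w |: val e)}.
  move=> w w'; rewrite !inE => /andP[we _] /andP[w'e _] /setP/(_ w).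
  by rewrite !inE eqxx (negPf we) !orbF => /esym/eqP.
transitivity (\sum_(T in (fun w : 'I_n => w |: val e) @: D) F T).
  apply: eq_bigl => T; apply/and3P/imsetP => [[T3 eT PT]|[w]].
    have : #|T :\: val e| == 1%N.
      by rewrite cardsD (setIidPr eT) card_edge (eqP T3).
    move=> /cards1P[w wE]; have wT : w \in T :\: val e by rewrite wE set11.
    have TE : T = w |: val e.
      apply/setP => x; have := congr1 (fun B : {set 'I_n} => x \in B) wE.
      rewrite !inE; case: (boolP (x \in val e)) => [/(subsetP eT) ->|_ /= ->].
        by rewrite orbT.
      by rewrite orbF.
    exists w => //; rewrite inE -TE PT andbT.
    by move: wT; rewrite !inE => /andP[].
  by rewrite inE => /andP[we Pw] ->; rewrite cardsU1 we card_edge subsetUr Pw.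
by rewrite big_imset//=; apply: eq_bigl => w; rewrite inE.
Qed.

Lemma edge_through (w : 'I_n) e e' : e' \in edges_in (w |: val e) -> e' != e -> w \in val e'.
Proof.
rewrite inE => e'w; apply: contraNT => we'; apply/eqP/val_inj/eqP.
rewrite eqEcard !card_edge leqnn andbT; apply/subsetP => x xe'.
by have := subsetP e'w x xe'; rewrite !inE => /orP[/eqP xw|//]; rewrite -xw xe' in we'.
Qed.

Context (R : realType) (p : R).
Hypothesis p01 : 0 <= p <= 1.

Let p0 : 0 <= p. Proof. by case/andP: p01. Qed.
Let p1 : p <= 1. Proof. by case/andP: p01. Qed.

Lemma expr_le_card (k l : nat) : (k <= l)%N -> p ^+ l <= p ^+ k.
Proof. by move=> kl; apply: ler_wiXn2l. Qed.

(** Union bound over an edge e of S in the triangle, then over the apex w. If no edge of S contains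
    w, both remaining edges are new and contribute p^2; at most 2|S| apexes lie on edges of S, and
    these are counted with weight 1. *)
Lemma sum_triangles_meeting (A : {set 'I_n}) S :
  \sum_(T : {set 'I_n} | [&& #|T| == 3%N, T \subset A & edges_in T :&: S != set0])
    p ^+ #|edges_in T :\: S| <= #|S|%:R * (#|A|%:R * p ^+ 2 + 2 * #|S|%:R).
Proof.
apply: (@le_trans _ _ (\sum_(e in S) \sum_(T : {set 'I_n} | [&& #|T| == 3%N, val e \subset T & T \subset A])
    p ^+ #|edges_in T :\: S|)).
  rewrite (exchange_big_dep (fun T : {set 'I_n} => (#|T| == 3%N) && (T \subset A)))/=; last first.
    by move=> e T _ /and3P[-> _ ->].
  rewrite big_mkcond [leRHS]big_mkcond; apply: ler_sum => T _.
  case: (#|T| == 3%N) => //=; case: (T \subset A) => //=.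
  case: ifP => [/set0Pn[e]|_]; last by apply: sumr_ge0 => e _; exact: exprn_ge0.
  rewrite !inE => /andP[eT eS]; rewrite (bigD1 e) ?eS ?eT//= lerDl.
  by apply: sumr_ge0 => *; exact: exprn_ge0.
have -> : #|S|%:R * (#|A|%:R * p ^+ 2 + 2 * #|S|%:R) =
    \sum_(e in S) (#|A|%:R * p ^+ 2 + \sum_(e' in S) 2) :> R.
  by rewrite !sumr_const -[RHS]mulr_natl -[2 *+ _]mulr_natl; ring.
apply: ler_sum => e eS; rewrite sum_triangles_edge.
have -> : #|A|%:R * p ^+ 2 + \sum_(e' in S) 2 =
    \sum_(w : 'I_n) ((w \in A)%:R * p ^+ 2 + \sum_(e' in S) (w \in val e')%:R).
  rewrite [RHS]big_split/= -mulr_suml [X in _ = _ + X]exchange_big/=; congr (_ * _ + _).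
    by rewrite -sum1_card natr_sum big_mkcond; apply: eq_bigr => w _; case: (_ \in _).
  apply: eq_bigr => e' _; transitivity (#|val e'|%:R : R); first by rewrite card_edge.
  rewrite -sum1_card natr_sum big_mkcond.
  by apply: eq_bigr => w _; case: (_ \in _).
rewrite big_mkcond; apply: ler_sum => w _.
have s0 : 0 <= \sum_(e' in S) (w \in val e')%:R :> R by apply: sumr_ge0.
case: ifP => [/andP[we wA]|_]; last by rewrite addr_ge0// mulr_ge0// exprn_ge0.
have -> : w \in A by apply: (subsetP wA); rewrite !inE eqxx.
rewrite mul1r.
have [/existsP[e' /andP[e'S we']]|] := boolP [exists e', (e' \in S) && (w \in val e')].
  rewrite (bigD1 e')//= we' addrCA; apply: (@le_trans _ _ 1); first exact: exprn_ile1.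
  by rewrite lerDl addr_ge0 ?exprn_ge0// sumr_ge0.
rewrite negb_exists => /forallP h; rewrite -[leLHS]addr0 lerD//; apply: expr_le_card.
have c3 : #|edges_in (w |: val e)| = 3 by apply: card_triangle_edges; rewrite cardsU1 we card_edge.
have : edges_in (w |: val e) :\ e \subset edges_in (w |: val e) :\: S.
  apply/subsetP => e'; rewrite in_setD1 in_setD => /andP[e'e e'w]; rewrite e'w andbT.
  by have := h e'; rewrite (edge_through e'w e'e) andbT.
move/subset_leq_card; apply: leq_trans.
have ee : e \in edges_in (w |: val e) by rewrite inE subsetUr.
by move: c3; rewrite (cardsD1 e) ee add1n => -[->].
Qed.

(** Defined on every vertex set, with value 0 and empty support off the triangles inside A, so that
    the index set is a finite type and the dependence hypotheses hold without side conditions. *)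
Definition tri_ind (A : {set 'I_n}) T (G : {set edge n}) : R :=
  if (#|T| == 3%N) && (T \subset A) then (edges_in T \subset G)%:R - p ^+ 3 else 0.

Definition tri_supp (A : {set 'I_n}) T : {set edge n} :=
  if (#|T| == 3%N) && (T \subset A) then edges_in T else set0.

Lemma tri_ind_dep A T : depends_on (tri_supp A T) (tri_ind A T).
Proof.
rewrite /tri_ind /tri_supp; case: ifP => [TA|_] G H GH //.
by have := @depends_on_subset R _ _ _ (subxx (edges_in T)) G H GH => /= ->.
Qed.

Lemma Ex_tri_ind A T : Ex p (tri_ind A T) = 0.
Proof.
rewrite /tri_ind; case: (boolP (_ && _)) => [/andP[T3 _]|_]; last exact: Ex_cst.
by rewrite ExB Ex_cst Ex_subset (card_triangle_edges T3) subrr.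
Qed.

Lemma overlap_tri A T T' : overlap (tri_supp A) T T' =
  [&& (#|T| == 3%N), (T \subset A), (#|T'| == 3%N), (T' \subset A) & edges_in T' :&: edges_in T != set0].
Proof.
rewrite /overlap /tri_supp; case: ifP => [/andP[-> ->]|]/=; last first.
  by rewrite set0I eqxx; case: (_ == _) => //= ->.
case: ifP => [/andP[-> ->]|]/=; first by rewrite setIC.
by rewrite setI0 eqxx; case: (_ == _) => //= ->.
Qed.

Lemma Ex_subset2 (S S' : {set edge n}) :
  Ex p (fun G => (S \subset G)%:R * (S' \subset G)%:R) = p ^+ #|S :|: S'|.
Proof.
rewrite -Ex_subset; apply: eq_Ex => G; rewrite subUset.
by case: (S \subset G); rewrite ?mul1r ?mul0r.
Qed.

Lemma Ex_tri_ind2_le A T T' : (#|T| == 3%N) && (T \subset A) -> (#|T'| == 3%N) && (T' \subset A) ->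
  Ex p (fun G => tri_ind A T G * tri_ind A T' G) <= p ^+ 3 * p ^+ #|edges_in T' :\: edges_in T|.
Proof.
rewrite /tri_ind => TA T'A; rewrite TA T'A.
rewrite (eq_Ex p (g := fun G => (edges_in T \subset G)%:R * (edges_in T' \subset G)%:R
   - p ^+ 3 * ((edges_in T \subset G)%:R + (edges_in T' \subset G)%:R) + p ^+ 3 * p ^+ 3));
  last by move=> G; ring.
case/andP: TA => T3 _; case/andP: T'A => T'3 _.
rewrite ExD ExB ExZ ExD Ex_cst Ex_subset2 !Ex_subset !card_triangle_edges//.
have -> : p ^+ 3 * p ^+ #|edges_in T' :\: edges_in T| = p ^+ #|edges_in T :|: edges_in T'|.
  by rewrite card_setU_setD card_triangle_edges// exprD.
have : 0 <= p ^+ 3 * p ^+ 3 by rewrite mulr_ge0 ?exprn_ge0.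
by move: (p ^+ 3) (p ^+ #|_|) => q u q0; lra.
Qed.


Lemma sum_triangles_const (A : {set 'I_n}) (c : R) :
  \sum_(T : {set 'I_n} | (#|T| == 3%N) && (T \subset A)) c = 'C(#|A|, 3)%:R * c.
Proof.
rewrite (eq_bigl (mem [set B : {set 'I_n} | B \subset A & #|B| == 3%N])).
  by rewrite sumr_const cards_draws mulr_natl.
by move=> T; rewrite !inE andbC.
Qed.

(** Covariances are at most joint probabilities, and [sum_triangles_meeting] with S the three edges
    of T gives 3 (|A| p^2 + 6). *)
Lemma var_triangles_le (A : {set 'I_n}) :
  Ex p (fun G => (\sum_T tri_ind A T G) ^+ 2) <=
  'C(#|A|, 3)%:R * (p ^+ 3 * (3 * (#|A|%:R * p ^+ 2 + 6))).
Proof.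
rewrite (variance_local_dependence (@tri_ind_dep A) (Ex_tri_ind A)).
rewrite -sum_triangles_const [leRHS]big_mkcond; apply: ler_sum => T _.
case: (boolP (_ && _)) => [TA|TA]; last first.
  rewrite big1// => T'; rewrite overlap_tri; case/and5P => T3 TA'.
  by rewrite T3 TA' in TA.
case/andP: (TA) => T3 TsA.
apply: (@le_trans _ _ (p ^+ 3 * \sum_(T' : {set 'I_n} | [&& #|T'| == 3%N, T' \subset A &
    edges_in T' :&: edges_in T != set0]) p ^+ #|edges_in T' :\: edges_in T|)).
  rewrite mulr_sumr (eq_bigl (fun T' : {set 'I_n} => [&& #|T'| == 3%N, T' \subset A &
    edges_in T' :&: edges_in T != set0])); last by move=> T'; rewrite overlap_tri T3 TsA.
  by apply: ler_sum => T' /and3P[T'3 T'A _]; rewrite Ex_tri_ind2_le// T'3 T'A.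
rewrite ler_wpM2l ?exprn_ge0//; apply: (le_trans (sum_triangles_meeting _ _)).
by rewrite card_triangle_edges//; lra.
Qed.

Lemma sum_tri_indE (A : {set 'I_n}) (G : {set edge n}) : \sum_T tri_ind A T G =
  \sum_(T : {set 'I_n} | (#|T| == 3%N) && (T \subset A)) (edges_in T \subset G)%:R
  - 'C(#|A|, 3)%:R * p ^+ 3.
Proof.
rewrite -sum_triangles_const -sumrB [RHS]big_mkcond; apply: eq_bigr => T _.
by rewrite /tri_ind; case: ifP.
Qed.

Lemma triangles_centered (G : graph n) :
  (triangles G)%:R = 'C(n, 3)%:R * p ^+ 3 + \sum_T tri_ind [set: 'I_n] T G.
Proof.
rewrite sum_tri_indE cardsT card_ord addrC subrK triangles_sum natr_sum.
by apply: eq_bigl => T; rewrite subsetT andbT.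
Qed.

Lemma expr_union_le (S S' : {set edge n}) : p ^+ #|S| * p ^+ #|S'| <= p ^+ #|S :|: S'|.
Proof. by rewrite -exprD; apply: expr_le_card; rewrite cardsU leq_subr. Qed.

(** A centred indicator is at most the indicator plus p^3 in absolute value. Every term of the
    expanded product is at most p to the size of the union, since splitting a union into independent
    pieces only decreases the probability ([expr_union_le]). *)
Lemma Ex_tri_ind3_le A T T' T'' :
  (#|T| == 3%N) && (T \subset A) -> (#|T'| == 3%N) && (T' \subset A) ->
  (#|T''| == 3%N) && (T'' \subset A) ->
  Ex p (fun G => `|tri_ind A T G * tri_ind A T' G * tri_ind A T'' G|) +
  Ex p (fun G => `|tri_ind A T G * tri_ind A T' G|) * Ex p (fun G => `|tri_ind A T'' G|)
  <= 16 * p ^+ #|edges_in T :|: edges_in T' :|: edges_in T''|.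
Proof.
move=> TA T'A T''A; rewrite /tri_ind TA T'A T''A.
case/andP: TA => T3 _; case/andP: T'A => T'3 _; case/andP: T''A => T''3 _.
set a := edges_in T; set b := edges_in T'; set c := edges_in T''.
pose x S (G : {set edge n}) : R := (S \subset G)%:R.
have x0 S G : 0 <= x S G by exact: ler0n.
have q0 : 0 <= p ^+ 3 by exact: exprn_ge0.
have xn S G : `|x S G - p ^+ 3| <= x S G + p ^+ 3.
  by rewrite (le_trans (ler_normB _ _))// !ger0_norm.
have Ex2 S S' : Ex p (fun G => x S G * x S' G) = p ^+ #|S :|: S'| by exact: Ex_subset2.
have Ex3 : Ex p (fun G => x a G * x b G * x c G) = p ^+ #|a :|: b :|: c|.
  rewrite -Ex_subset2; apply: eq_Ex => G; rewrite /x !subUset.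
  by case: (a \subset G); rewrite /= ?mul1r ?mul0r.
have qE S : #|S| = 3%N -> p ^+ 3 = p ^+ #|S| by move=> ->.
have ca : #|a| = 3%N by exact: card_triangle_edges.
have cb : #|b| = 3%N by exact: card_triangle_edges.
have cc : #|c| = 3%N by exact: card_triangle_edges.
set q := p ^+ 3; set u := p ^+ #|a :|: b :|: c|.
have u1 S S' : #|S'| = 3%N -> S :|: S' = a :|: b :|: c -> p ^+ #|S| * q <= u.
  by move=> S3 SE; rewrite /q (qE _ S3) /u -SE expr_union_le.
have qab := u1 (a :|: b) c cc erefl.
have qac : p ^+ #|a :|: c| * q <= u by apply: (u1 _ b) => //; rewrite setUAC.
have qbc : p ^+ #|b :|: c| * q <= u by apply: (u1 _ a) => //; rewrite setUC setUA.
have qq : q * q <= p ^+ #|a :|: b| by rewrite {1}/q /q {1}(qE a ca) (qE b cb) expr_union_le.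
have qqq : q * q * q <= u by apply: le_trans qab; rewrite ler_wpM2r.
have u0 : 0 <= u by exact: exprn_ge0.
have e1 : Ex p (fun G => `|(x a G - q) * (x b G - q) * (x c G - q)|) <= 8 * u.
  apply: (@le_trans _ _ (Ex p (fun G => (x a G * x b G * x c G + q * (x a G * x b G) +
      q * (x a G * x c G) + q * (x b G * x c G)) + (q * q * (x a G + x b G + x c G) + q * q * q)))).
    apply: le_Ex => // G; rewrite !normrM.
    apply: (@le_trans _ _ ((x a G + q) * (x b G + q) * (x c G + q))).
      by apply: ler_pM => //; apply: ler_pM.
    by rewrite le_eqVlt; apply/orP; left; apply/eqP; ring.
  rewrite !ExD !ExZ !ExD Ex3 !Ex2 Ex_cst /x !Ex_subset ca cb cc -/q -/u.
  rewrite -?[p * (p * p)]/q.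
  exact: triple_arith.
have e2 : Ex p (fun G => `|(x a G - q) * (x b G - q)|) <= 4 * p ^+ #|a :|: b|.
  apply: (@le_trans _ _ (Ex p (fun G => x a G * x b G + (q * (x a G + x b G) + q * q)))).
    apply: le_Ex => // G; rewrite normrM.
    apply: (@le_trans _ _ ((x a G + q) * (x b G + q))); first exact: ler_pM.
    by rewrite le_eqVlt; apply/orP; left; apply/eqP; ring.
  rewrite !ExD ExZ !ExD Ex2 Ex_cst /x !Ex_subset ca cb -/q.
  exact: pair_arith.
have e3 : Ex p (fun G => `|x c G - q|) <= 2 * q.
  apply: (@le_trans _ _ (Ex p (fun G => x c G + q))); first exact: le_Ex.
  by rewrite ExD Ex_cst /x Ex_subset cc -/q mulr_natl.
have e4 : Ex p (fun G => `|(x a G - q) * (x b G - q)|) * Ex p (fun G => `|x c G - q|) <=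
    (4 * p ^+ #|a :|: b|) * (2 * q).
  by apply: ler_pM => //; apply: Ex_ge0.
by apply: le_trans (lerD e1 e4) _; exact: combine_arith.
Qed.

(** [sum_triangles_meeting] twice: for T' with the three edges of T, then for T'' with the at most
    six edges of T and T', whence 6 (|A| p^2 + 12). *)
Lemma triple_moment_triangles_le (A : {set 'I_n}) :
  triple_moment p (tri_supp A) (tri_ind A) <=
  'C(#|A|, 3)%:R * (16 * p ^+ 3 * (3 * (#|A|%:R * p ^+ 2 + 6)) * (6 * (#|A|%:R * p ^+ 2 + 12))).
Proof.
rewrite /triple_moment -sum_triangles_const [leRHS]big_mkcond; apply: ler_sum => T _.
case: (boolP (_ && _)) => [TA|TA]; last first.
  rewrite big1// => T'; rewrite overlap_tri; case/and5P => T3 TA'.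
  by rewrite T3 TA' in TA.
case/andP: (TA) => T3 TsA; set a := #|A|%:R * p ^+ 2.
have a0 : 0 <= a by rewrite mulr_ge0 ?exprn_ge0.
apply: (@le_trans _ _ (16 * p ^+ 3 * (\sum_(T' : {set 'I_n} | [&& #|T'| == 3%N, T' \subset A &
    edges_in T' :&: edges_in T != set0]) p ^+ #|edges_in T' :\: edges_in T|) *
      (6 * (a + 12)))); last first.
  rewrite ler_wpM2r ?mulr_ge0 ?addr_ge0// ler_wpM2l ?mulr_ge0 ?exprn_ge0//.
  apply: (le_trans (sum_triangles_meeting _ _)).
  by rewrite card_triangle_edges// -/a; lra.
rewrite mulr_sumr mulr_suml (eq_bigl (fun T' : {set 'I_n} => [&& #|T'| == 3%N, T' \subset A &
    edges_in T' :&: edges_in T != set0])); last by move=> T'; rewrite overlap_tri T3 TsA.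
apply: ler_sum => T' /and3P[T'3 T'A _].
set S := edges_in T :|: edges_in T'.
have S6 : (#|S| <= 6)%N.
  by rewrite (leq_trans (leq_card_setU _ _))// !card_triangle_edges.
have pS : 16 * p ^+ 3 * p ^+ #|edges_in T' :\: edges_in T| = 16 * p ^+ #|S|.
  by rewrite /S card_setU_setD (card_triangle_edges T3) exprD mulrA.
rewrite pS.
apply: (@le_trans _ _ (16 * p ^+ #|S| * \sum_(T'' : {set 'I_n} | [&& #|T''| == 3%N, T'' \subset A &
    edges_in T'' :&: S != set0]) p ^+ #|edges_in T'' :\: S|)); last first.
  rewrite ler_wpM2l ?mulr_ge0 ?exprn_ge0//; apply: (le_trans (sum_triangles_meeting _ _)).
  have S6' : #|S|%:R <= 6 :> R by rewrite (ler_nat _ _ 6).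
  have S0 : 0 <= #|S|%:R :> R by [].
  rewrite -/a; apply: ler_pM => //; first by rewrite addr_ge0// mulr_ge0.
  have -> : 12 = 2 * 6 :> R by rewrite -natrM.
  by rewrite lerD2l ler_wpM2l.
rewrite mulr_sumr (eq_bigl (fun T'' : {set 'I_n} => [&& #|T''| == 3%N, T'' \subset A &
    edges_in T'' :&: S != set0])); last first.
  move=> T''; rewrite !overlap_tri T3 TsA T'3 T'A/= setIUr setU_eq0 negb_and.
  by case: (_ == _) => //=; case: (_ \subset _).
apply: ler_sum => T'' /and3P[T''3 T''A _].
rewrite -mulrA -exprD -card_setU_setD; apply: Ex_tri_ind3_le; apply/andP; split=> //.
Qed.

(** Projection on the centred edge count L: E (X - c L)^2 >= 0 gives Var X >= 2 c Cov(X, L) - c^2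
    Var L for every c. *)
Lemma var_triangles_ge (c : R) :
  2 * c * ('C(n, 3)%:R * (3 * (p ^+ 3 * (1 - p)))) - c ^+ 2 * ('C(n, 2)%:R * (p * (1 - p))) <=
  Ex p (fun G => (\sum_T tri_ind [set: 'I_n] T G) ^+ 2).
Proof.
pose xi (e : edge n) (G : {set edge n}) : R := (e \in G)%:R - p.
have xid e : depends_on [set e] (xi e).
  move=> G H /setP/(_ e); rewrite !inE eqxx !andbT /xi => ->//.
have xi0 e : Ex p (xi e) = 0.
  by rewrite (Ex_coord p (fun b => b%:R - p))/= mulr1n mulr0n; ring.
have xi2 e : Ex p (fun G => xi e G * xi e G) = p * (1 - p).
  by rewrite (Ex_coord p (fun b => (b%:R - p) * (b%:R - p)))/= mulr1n mulr0n; ring.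
have L2 : Ex p (fun G => (\sum_e xi e G) ^+ 2) = 'C(n, 2)%:R * (p * (1 - p)).
  rewrite (variance_local_dependence xid xi0).
  transitivity (\sum_(e : edge n) p * (1 - p)).
    apply: eq_bigr => e _; rewrite (big_pred1 e) ?xi2// => e'.
    rewrite /overlap; apply/idP/eqP => [/set0Pn[x]|->]; last by rewrite setIid -card_gt0 cards1.
    by rewrite !inE => /andP[/eqP -> /eqP].
  rewrite sumr_const -[LHS]mulr_natl; congr (_%:R * _).
  transitivity #|edges_in [set: 'I_n]|; first by apply: eq_card => e; rewrite !inE subsetT.
  by rewrite card_edges_in cardsT card_ord.
have XL : Ex p (fun G => (\sum_T tri_ind [set: 'I_n] T G) * (\sum_e xi e G)) =
    'C(n, 3)%:R * (3 * (p ^+ 3 * (1 - p))).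
  transitivity (\sum_T \sum_e Ex p (fun G => tri_ind [set: 'I_n] T G * xi e G)).
    under eq_bigr do rewrite -Ex_sum.
    rewrite -Ex_sum; apply: eq_Ex => G; rewrite mulr_suml; apply: eq_bigr => T _.
    by rewrite mulr_sumr.
  have := sum_triangles_const [set: 'I_n] (3 * (p ^+ 3 * (1 - p))).
  rewrite cardsT card_ord => <-; rewrite [RHS]big_mkcond; apply: eq_bigr => T _.
  case: ifPn => [TA|TA]; last first.
    rewrite big1// => e _; rewrite -[RHS](Ex_cst (edge n) p); apply: eq_Ex => G.
    by rewrite /tri_ind (negPf TA) mul0r.
  case/andP: (TA) => T3 _.
  rewrite (bigID (mem (edges_in T)))/= [X in _ + X]big1 ?addr0; last first.
    move=> e eT; rewrite (Ex_indep p (@tri_ind_dep [set: 'I_n] T)) ?Ex_tri_ind ?mul0r//.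
    apply: depends_onS (@xid e); rewrite /tri_supp TA.
    by rewrite sub1set inE.
  rewrite (eq_bigr (fun=> p ^+ 3 * (1 - p))).
    by rewrite sumr_const card_triangle_edges// [RHS]mulr_natl.
  move=> e eT; rewrite /tri_ind TA.
  have -> : Ex p (fun G => ((edges_in T \subset G)%:R - p ^+ 3) * xi e G) =
      Ex p (fun G => (1 - p) * (edges_in T \subset G)%:R - p ^+ 3 * xi e G).
    apply: eq_Ex => G; rewrite /xi; case: (boolP (_ \subset _)) => [/subsetP/(_ e eT) ->|_] /=; rewrite ?mulr1n ?mulr0n; ring.
  by rewrite ExB !ExZ xi0 Ex_subset card_triangle_edges//; ring.
have : 0 <= Ex p (fun G => (\sum_T tri_ind [set: 'I_n] T G - c * \sum_e xi e G) ^+ 2).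
  by apply: Ex_ge0 => // G; exact: sqr_ge0.
rewrite (eq_Ex p (g := fun G => (\sum_T tri_ind [set: 'I_n] T G) ^+ 2 + (c ^+ 2 * (\sum_e xi e G) ^+ 2 -
   2 * c * ((\sum_T tri_ind [set: 'I_n] T G) * (\sum_e xi e G))))); last by move=> G; ring.
by rewrite ExD ExB !ExZ L2 XL; lra.
Qed.

End triangle_counting.

(** * Codegrees *)

Section codegree.
Import mathcomp.boot.fintype mathcomp.boot.finset.
Context (R : realType) (n : nat) (p : R).
Hypothesis p01 : 0 <= p <= 1.
Implicit Types (G H B : {set edge n}) (e : edge n) (W A : {set 'I_n}) (w : 'I_n).

Let p0 : 0 <= p. Proof. by case/andP: p01. Qed.

(** The path of length two between the ends of e through w. For w on e it is empty, hence contained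
    in every graph; this is why vertices of e are kept out of W below. *)
Definition cherry e w : {set edge n} := edges_in (w |: val e) :\ e.

Lemma cherryP e w e' : e' \in cherry e w ->
  [/\ w \in val e', val e' \subset w |: val e & val e' :&: val e != set0].
Proof.
rewrite in_setD1 => /andP[e'e e'w]; have we' := edge_through e'w e'e.
move: e'w; rewrite inE => e'w; split=> //.
have [x] : exists x, x \in val e' :\ w.
  apply/set0Pn; rewrite -card_gt0; have := cardsD1 w (val e').
  by rewrite card_edge we' add1n => -[<-].
rewrite !inE => /andP[xw xe']; apply/set0Pn; exists x; rewrite inE xe'/=.
by have := subsetP e'w x xe'; rewrite !inE (negPf xw).
Qed.

Lemma card_cherry e w : w \notin val e -> #|cherry e w| = 2%N.
Proof.
move=> we; have c3 : #|edges_in (w |: val e)| = 3%N.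
  by apply: card_triangle_edges; rewrite cardsU1 we card_edge.
have ee : e \in edges_in (w |: val e) by rewrite inE subsetUr.
by move: c3; rewrite (cardsD1 e) ee add1n => -[].
Qed.

Lemma cherry_disjoint e w w' : w \notin val e -> w' \notin val e -> w != w' ->
  cherry e w :&: cherry e w' = set0.
Proof.
move=> we w'e ww'; apply/eqP; apply: contraT => /set0Pn[e'].
rewrite inE => /andP[/cherryP[_ h _] /cherryP[h' _ _]].
by have := subsetP h _ h'; rewrite !inE eq_sym (negPf ww') (negPf w'e).
Qed.

(** The codegree: the number of common neighbours of the ends of e that lie in W, for W disjoint
    from e. *)
Definition codeg W e G : R := \sum_(w in W) (cherry e w \subset G)%:R.

Lemma codeg_ge0 W e G : 0 <= codeg W e G.
Proof. exact: sumr_ge0. Qed.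

Let wdisj W e : (forall w, w \in W -> w \notin val e) ->
  forall w w', w != w' -> (if w \in W then cherry e w else set0) :&:
    (if w' \in W then cherry e w' else set0) = set0.
Proof.
move=> We w w' ww'; case: ifP => wW; last by rewrite set0I.
by case: ifP => w'W; rewrite ?setI0// cherry_disjoint ?We.
Qed.

(** Cherries with distinct apexes are disjoint, so the codegree is binomial with parameters |W| and
    p^2. *)
Lemma Ex_expR_codeg W e s : (forall w, w \in W -> w \notin val e) ->
  Ex p (fun G => expR (s * codeg W e G)) = (1 + p ^+ 2 * (expR s - 1)) ^+ #|W|.
Proof.
move=> We.
pose F w G : R := if w \in W then expR (s * (cherry e w \subset G)%:R) else 1.
rewrite (eq_Ex p (g := fun G => \prod_w F w G)); last first.
  move=> G; rewrite /codeg mulr_sumr expR_sum /F big_mkcond.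
  by apply: eq_bigr => w _; case: ifP.
rewrite (Ex_prod p (wdisj We)); last first.
  move=> w G H; rewrite /F; case: ifP => // wW GH.
  by have /= -> := @depends_on_subset R _ _ _ (subxx _) G H GH.
rewrite -prodr_const [RHS]big_mkcond; apply: eq_bigr => w _.
rewrite /F; case: ifP => wW; last exact: Ex_cst.
rewrite (eq_Ex p (g := fun G => 1 + (expR s - 1) * (cherry e w \subset G)%:R)).
  by rewrite ExD Ex_cst ExZ Ex_subset card_cherry ?We// [p ^+ 2 * _]mulrC.
by move=> G; case: (_ \subset _); rewrite /= ?mulr1 ?mulr0 ?expR0 ?addr0// addrC subrK.
Qed.

Lemma cfsq_codeg W e t : (forall w, w \in W -> w \notin val e) ->
  cfsq p (fun G => t * codeg W e G) = (1 - 2 * p ^+ 2 * (1 - p ^+ 2) * (1 - cos t)) ^+ #|W|.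
Proof.
move=> We.
pose F w G : R := if w \in W then t * (cherry e w \subset G)%:R else 0.
rewrite (eq_cfsq p (g := fun G => \sum_w F w G)); last first.
  move=> G; rewrite /codeg mulr_sumr /F big_mkcond.
  by apply: eq_bigr => w _; case: ifP.
rewrite (cfsq_sum p (wdisj We)); last first.
  move=> w G H; rewrite /F; case: ifP => // wW GH.
  by have /= -> := @depends_on_subset R _ _ _ (subxx _) G H GH.
rewrite -prodr_const [RHS]big_mkcond; apply: eq_bigr => w _.
rewrite /F; case: ifP => wW; last first.
  by rewrite /cfsq cos0 sin0 !Ex_cst expr1n expr0n addr0.
rewrite (@cfsq_bernoulli _ _ _ (p ^+ 2))//.
  by rewrite Ex_subset card_cherry ?We.
by move=> G; case: (_ \subset _); [right|left].
Qed.

Lemma Ex_expR_codeg_le W e s : (forall w, w \in W -> w \notin val e) ->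
  Ex p (fun G => expR (s * codeg W e G)) <= expR (#|W|%:R * p ^+ 2 * (expR s - 1)).
Proof.
move=> We; rewrite Ex_expR_codeg// -mulrA expRM_natl.
apply: lerXn2r; rewrite ?nnegrE ?expR_ge0//; last exact: expR_ge1Dx.
have : p ^+ 2 <= 1 by rewrite expr_le1//; case/andP: p01.
have := expR_ge0 s; have := sqr_ge0 p; nra.
Qed.

Lemma Ex_codeg2_ge W e : (forall w, w \in W -> w \notin val e) ->
  (#|W|%:R * p ^+ 2) ^+ 2 <= Ex p (fun G => codeg W e G ^+ 2).
Proof.
move=> We; have <- : Ex p (codeg W e) = #|W|%:R * p ^+ 2.
  rewrite /codeg Ex_sum (eq_bigr (fun=> p ^+ 2)) ?sumr_const ?mulr_natl// => w wW.
  by rewrite Ex_subset card_cherry ?We.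
exact: Ex_sqr_le.
Qed.

Lemma expR2_le9 : expR (2 : R) <= 9.
Proof.
have e1 : expR (1 : R) <= 3 by have := @expR_le_quad R 1; rewrite normr1 => /(_ (lexx _)); lra.
have -> : expR (2 : R) = expR 1 ^+ 2 by rewrite -expRM_natl mulr1.
by have := expR_ge0 (1 : R); nra.
Qed.

(** An exponential moment at scale 1 / m, where m = |W| p^2: x^4 <= 24 m^4 exp(x / m), and E
    exp(codeg / m) <= exp 2 <= 9, so that 216 = 24 * 9. *)
Lemma Ex_codeg4_le W e : (forall w, w \in W -> w \notin val e) ->
  1 <= #|W|%:R * p ^+ 2 ->
  Ex p (fun G => codeg W e G ^+ 4) <= 216 * (#|W|%:R * p ^+ 2) ^+ 4.
Proof.
move=> We; set m := #|W|%:R * p ^+ 2 => m1.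
have m0 : 0 < m by lra.
have mV : 0 <= m^-1 <= 1 by rewrite invr_ge0 ltW//= invf_le1.
apply: (@le_trans _ _ (Ex p (fun G => (24 * m ^+ 4) * expR (m^-1 * codeg W e G)))).
  apply: le_Ex => // G.
  have c0 : 0 <= m^-1 * codeg W e G by rewrite mulr_ge0 ?codeg_ge0 ?invr_ge0 ?ltW.
  have := @expR_ge1Dxn R _ 3 c0; rewrite exprMn exprVn (_ : 4`!%:R = 24) => [|//] h.
  have m4 : 0 < m ^+ 4 by exact: exprn_gt0.
  have -> : codeg W e G ^+ 4 = (24 * m ^+ 4) * ((m ^+ 4)^-1 * codeg W e G ^+ 4 / 24).
    by field; rewrite gt_eqF.
  by rewrite ler_wpM2l ?mulr_ge0 ?(ltW m4)//; lra.
rewrite ExZ [216 * _](_ : _ = 24 * m ^+ 4 * 9); last by ring.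
rewrite ler_wpM2l ?mulr_ge0 ?exprn_ge0 ?(ltW m0)//.
apply: (le_trans (Ex_expR_codeg_le _ We)); rewrite -/m.
apply: (le_trans _ expR2_le9); rewrite ler_expR.
have := @expR_le_quad R m^-1; rewrite ger0_norm; last by case/andP: mV.
case/andP: mV => mV0 mV1 /(_ mV1) h.
apply: (@le_trans _ _ (m * (m^-1 + m^-1 ^+ 2))); first by rewrite ler_wpM2l ?(ltW m0)//; lra.
by rewrite mulrDr expr2 mulrA divff ?gt_eqF// mul1r; lra.
Qed.

(* Symmetrised moment generating function at the scale s = m^{-1/2}, m = |W| p^2. *)
Lemma Ex_codeg_diff4_le W e : (forall w, w \in W -> w \notin val e) ->
  1 <= #|W|%:R * p ^+ 2 ->
  Ex p (fun G => Ex p (fun H => (codeg W e G - codeg W e H) ^+ 4))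
    <= 432 * (#|W|%:R * p ^+ 2) ^+ 2.
Proof.
move=> We; set m := #|W|%:R * p ^+ 2 => m1.
have m0 : 0 < m by lra.
pose s := (Num.sqrt m)^-1.
have sm1 : 1 <= Num.sqrt m by rewrite -sqrtr1 ler_wsqrtr.
have s01 : 0 <= s <= 1 by rewrite invr_ge0 (le_trans _ sm1)//= invf_le1// (lt_le_trans _ sm1).
have s2 : s ^+ 2 = m^-1 by rewrite exprVn sqr_sqrtr// ltW.
have s4 : s ^+ 4 = (m ^+ 2)^-1 by rewrite -(exprVn m) -s2 -exprM.
have key G H : (codeg W e G - codeg W e H) ^+ 4 <= 24 * m ^+ 2 *
    (expR (s * codeg W e G) * expR (- s * codeg W e H)
     + expR (- s * codeg W e G) * expR (s * codeg W e H)).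
  have := pow4_le_cosh (s * (codeg W e G - codeg W e H)).
  have -> : expR (s * (codeg W e G - codeg W e H)) = expR (s * codeg W e G) * expR (- s * codeg W e H).
    by rewrite -expRD; congr expR; ring.
  have -> : expR (- (s * (codeg W e G - codeg W e H))) = expR (- s * codeg W e G) * expR (s * codeg W e H).
    by rewrite -expRD; congr expR; ring.
  rewrite exprMn s4 => h.
  have m2 : 0 < m ^+ 2 by exact: exprn_gt0.
  rewrite ler_pdivrMl// in h; apply: (le_trans h).
  by rewrite le_eqVlt; apply/orP; left; apply/eqP; ring.
set a := Ex p (fun G => expR (s * codeg W e G)).
set b := Ex p (fun G => expR (- s * codeg W e G)).
apply: (@le_trans _ _ (24 * m ^+ 2 * (a * b + b * a))).
  apply: (@le_trans _ _ (Ex p (fun G => 24 * m ^+ 2 * (b * expR (s * codeg W e G) + a * expR (- s * codeg W e G))))).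
    apply: le_Ex => // G.
    apply: (le_trans (le_Ex p01 (key G))).
    by rewrite ExZ ExD !ExZ -/a -/b [b * _]mulrC [a * _]mulrC.
  by rewrite ExZ ExD !ExZ -/a -/b [a * b]mulrC.
have ab : a * b <= 9.
  apply: (@le_trans _ _ (expR (m * (expR s - 1)) * expR (m * (expR (- s) - 1)))).
    by apply: ler_pM; [exact: Ex_ge0|exact: Ex_ge0|exact: Ex_expR_codeg_le..].
  rewrite -expRD; apply: (le_trans _ expR2_le9); rewrite ler_expR.
  case/andP: s01 => s0 s1.
  have := @expR_le_quad R s; rewrite ger0_norm// => /(_ s1) h1.
  have := @expR_le_quad R (- s); rewrite normrN ger0_norm// sqrrN => /(_ s1) h2.
  rewrite -mulrDr; apply: (@le_trans _ _ (m * (2 * s ^+ 2))).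
    by rewrite ler_wpM2l ?(ltW m0)//; lra.
  by rewrite s2 mulrCA divff ?gt_eqF// mulr1.
have m2 : 0 < m ^+ 2 by exact: exprn_gt0.
by rewrite [b * a]mulrC; nra.
Qed.

(** Let c = 1 - cos(t D), D the codegree difference, and z = m t^2. The function exp(-l c) is
    expanded to second order for some l <= L, which only increases the left side. E c = 1 - [psi] is
    at least of order min(z, 1) by the binomial characteristic function, and E c^2 <= 108 z^2 by the
    fourth moment of D. *)
Lemma expRN_codeg_diff_le W e (t L : R) : (forall w, w \in W -> w \notin val e) ->
  p <= 1 / 2 -> 1 <= #|W|%:R * p ^+ 2 -> `|t| <= pi -> 1 / 2304 <= L ->
  Ex p (fun G => Ex p (fun H => expR (- (L * (1 - cos (t * (codeg W e G - codeg W e H)))))))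
   <= 1 - 3 / 128 * Num.min (L * (#|W|%:R * p ^+ 2 * t ^+ 2)) (1 / 2304).
Proof.
move=> We p2; set m := #|W|%:R * p ^+ 2 => m1 tpi L1.
(* The threshold at which the quadratic term is half the linear one: 54 x^2 <= 3/128 x for 0 <= x <=
   1/2304. *)
have [tau tauE] : exists tau : R, tau = 1 / 2304 by exists (1 / 2304).
rewrite -tauE in L1 *.
set z := m * t ^+ 2.
have z0 : 0 <= z by rewrite mulr_ge0 ?sqr_ge0//; lra.
pose c G H : R := 1 - cos (t * (codeg W e G - codeg W e H)).
have c0 G H : 0 <= c G H by exact: one_sub_cos_ge0.
pose psi := cfsq p (fun G => t * codeg W e G).
pose E2 (F : {set edge n} -> {set edge n} -> R) := Ex p (fun G => Ex p (F G)).
have E2_le (F F' : {set edge n} -> {set edge n} -> R) : (forall G H, F G H <= F' G H) -> E2 F <= E2 F'.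
  by move=> FF'; do 2 apply: le_Ex => // ?.
have E2Z (a : R) (F : {set edge n} -> {set edge n} -> R) : E2 (fun G H => a * F G H) = a * E2 F.
  by rewrite /E2 -ExZ; apply: eq_Ex => G; rewrite ExZ.
have E2D (F F' : {set edge n} -> {set edge n} -> R) : E2 (fun G H => F G H + F' G H) = E2 F + E2 F'.
  by rewrite /E2 -ExD; apply: eq_Ex => G; rewrite ExD.
have E2c (a : R) : E2 (fun _ _ => a) = a.
  by rewrite /E2 -[RHS](Ex_cst (edge n) p); apply: eq_Ex => G; rewrite Ex_cst.
have E2cos : E2 c = 1 - psi.
  rewrite /psi -Ex_cos_copies -[X in X - _](E2c 1) /E2 -ExB; apply: eq_Ex => G.
  by rewrite -ExB; apply: eq_Ex => H; rewrite /c mulrBr.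
(* 2 p^2 (1 - p^2)(1 - cos t) is at least 2 p^2 (3/4) t^2 / 16, whence 3/32. *)
have psi_le : psi <= expR (- (3 / 32 * z)).
  rewrite /psi cfsq_codeg//.
  have tc := one_sub_cos_ge tpi.
  have pp : p ^+ 2 <= 1 / 4 by have := p0; nra.
  have p20 : 0 <= p ^+ 2 by exact: sqr_ge0.
  have cc0 := one_sub_cos_ge0 t.
  have cc2 : 1 - cos t <= 2 by have := cos_geN1 t; lra.
  have -> : - (3 / 32 * z) = #|W|%:R * (- (3 / 32 * p ^+ 2 * t ^+ 2)).
    by rewrite /z /m; ring.
  rewrite expRM_natl; apply: lerXn2r; rewrite ?nnegrE ?expR_ge0//.
    have : 2 * p ^+ 2 * (1 - p ^+ 2) * (1 - cos t) <= 1; last by lra.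
    apply: (@le_trans _ _ (1 / 2 * (1 - cos t))); last by lra.
    by rewrite ler_wpM2r//; nra.
  apply: le_trans (expR_ge1Dx _).
  rewrite lerD2l lerN2.
  have : p ^+ 2 * (t ^+ 2 / 16) <= p ^+ 2 * (1 - cos t) by rewrite ler_wpM2l.
  have : p ^+ 2 * p ^+ 2 * (1 - cos t) <= 1 / 4 * p ^+ 2 * (1 - cos t).
    by rewrite ler_wpM2r// ler_wpM2r.
  by move: (p ^+ 2) (t ^+ 2) (cos t) => *; lra.
have mono (l : R) : 0 <= l <= L ->
    E2 (fun G H => expR (- (L * c G H))) <= E2 (fun G H => expR (- (l * c G H))).
  by move=> /andP[l0 lL]; apply: E2_le => G H; rewrite ler_expR lerN2 ler_wpM2r.
have step (l : R) : 0 <= l -> E2 (fun G H => expR (- (l * c G H))) <=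
    1 - l * (1 - psi) + l ^+ 2 / 2 * E2 (fun G H => c G H ^+ 2).
  move=> l0; rewrite -E2cos -!E2Z -[X in X - _](E2c 1).
  have -> : E2 (fun _ _ => 1) - E2 (fun G H => l * c G H) =
      E2 (fun G H => 1 - l * c G H).
    by rewrite -[X in _ + X]mulN1r -E2Z -E2D; congr E2; apply/funext => G; apply/funext => H; ring.
  rewrite -E2D; apply: E2_le => G H.
  by apply: (le_trans (expRN_le _)); rewrite ?mulr_ge0//; lra.
(* For z > 1 the first moment is bounded below by a constant, c <= 2 replaces the fourth moment, and
   l = tau is taken. *)
have [z1|z1] := leP z 1; last first.
  have q1 : 3 / 64 <= 1 - psi.
    have := @one_sub_expRN_ge R (3 / 32) ltac:(lra).
    have : psi <= expR (- (3 / 32)) by apply: (le_trans psi_le); rewrite ler_expR; lra.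
    by lra.
  have Lz : tau <= L * z by nra.
  rewrite (min_idPr Lz); apply: (le_trans (mono (tau) _)); first by lra.
  apply: (le_trans (step _ _)); first by lra.
  have : E2 (fun G H => c G H ^+ 2) <= 2 * E2 c.
    rewrite -E2Z; apply: E2_le => G H; have := c0 G H.
    have : c G H <= 2 by rewrite /c; have := cos_geN1 (t * (codeg W e G - codeg W e H)); lra.
    by move: (c G H) => x *; nra.
  by rewrite E2cos tauE; move: (E2 _) q1; clear; move: psi => *; lra.
have q1 : 3 / 64 * z <= 1 - psi.
  by have := @one_sub_expRN_ge R (3 / 32 * z) ltac:(lra); lra.
have q2 : E2 (fun G H => c G H ^+ 2) <= 108 * z ^+ 2.
  apply: (@le_trans _ _ (E2 (fun G H => t ^+ 4 / 4 * (codeg W e G - codeg W e H) ^+ 4))).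
    apply: E2_le => G H; set d := _ - _.
    have := one_sub_cos_le (t * (codeg W e G - codeg W e H)); rewrite -/(c G H) -/d => h.
    have -> : t ^+ 4 / 4 * d ^+ 4 = ((t * d) ^+ 2 / 2) ^+ 2 by field.
    by rewrite ler_sqr ?nnegrE//; apply: le_trans h.
  rewrite E2Z; have := Ex_codeg_diff4_le We m1; rewrite -/m -/(E2 _) => h.
  have t4 : 0 <= t ^+ 4 / 4 by rewrite divr_ge0// exprn_even_ge0.
  apply: (le_trans (ler_wpM2l t4 h)).
  by rewrite /z le_eqVlt; apply/orP; left; apply/eqP; field.
(* The largest l <= L for which l z does not exceed tau. *)
have [l [l0L lz]] : exists l, 0 <= l <= L /\ l * z = Num.min (L * z) (tau).
  have [Lz|Lz] := leP (L * z) (tau); first by exists L; split=> //; lra.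
  have zp : 0 < z by nra.
  exists (tau / z); split; last by rewrite divfK ?gt_eqF.
  by rewrite divr_ge0 ?ler_pdivrMr ?(ltW Lz)//; lra.
have l2304 : l * z <= tau by rewrite lz ge_min lexx orbT.
case/andP: (l0L) => l0 lL.
rewrite -lz; apply: (le_trans (mono l l0L)); apply: (le_trans (step l l0)).
have h1 : l * (3 / 64 * z) <= l * (1 - psi) by rewrite ler_wpM2l.
have h2 : l ^+ 2 / 2 * E2 (fun G H => c G H ^+ 2) <= l ^+ 2 / 2 * (108 * z ^+ 2).
  by rewrite ler_wpM2l// divr_ge0// sqr_ge0.
have e2 : l ^+ 2 / 2 * (108 * z ^+ 2) = 54 * (l * z) ^+ 2 by field.
rewrite e2 in h2.
have lz0 : 0 <= l * z by rewrite mulr_ge0.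
have : 54 * (l * z) ^+ 2 <= 3 / 128 * (l * z).
  by move: (l * z) lz0 l2304 => x x0 x1; nra.
by move: h1 h2; rewrite (mulrCA l); move: (l * z) (l * _) (l ^+ 2 / 2 * _) => *; lra.
Qed.

End codegree.

(** * Decoupling for large frequencies *)

Section linear_forms.
Import mathcomp.boot.fintype mathcomp.boot.finset.
Context (R : realType) (E : finType) (p : R).
Hypothesis p01 : 0 <= p <= 1.
Implicit Types (G H B : {set E}).

Let p0 : 0 <= p. Proof. by case/andP: p01. Qed.
Let p1 : p <= 1. Proof. by case/andP: p01. Qed.

Lemma cfsq_linear_le (Q : pred E) (x : E -> R) :
  cfsq p (fun H => \sum_(e | Q e) (e \in H)%:R * x e) <=
  expR (- (2 * (p * (1 - p)) * \sum_(e | Q e) (1 - cos (x e)))).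
Proof.
pose F e H : R := if Q e then x e * (e \in H)%:R else 0.
rewrite (eq_cfsq p (g := fun H => \sum_e F e H)); last first.
  by move=> H; rewrite big_mkcond; apply: eq_bigr => e _; rewrite /F mulrC.
rewrite (@cfsq_sum _ _ _ _ (fun e => [set e])); last 2 first.
- move=> e e' ee'; apply/setP => y; rewrite !inE; apply/negP => /andP[/eqP -> /eqP h].
  by rewrite h eqxx in ee'.
- move=> e G H /setP/(_ e); rewrite !inE eqxx !andbT /F => ->//.
rewrite mulr_sumr -sumrN expR_sum [leRHS]big_mkcond; apply: ler_prod => e _.
rewrite cfsq_ge0/= /F; case: ifP => _; last first.
  by rewrite /cfsq cos0 sin0 !Ex_cst expr1n expr0n addr0.
rewrite (@cfsq_bernoulli _ _ _ p)//.
- by apply: le_trans (expR_ge1Dx _); rewrite mulrA.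
- by rewrite (Ex_coord p (fun b => b%:R))/= mulr1 mulr0 addr0.
- by move=> G; case: (_ \in _); [right|left].
Qed.

Lemma Ex_cos_linear_le (x : E -> R) :
  Ex p (fun H => cos (\sum_e (e \in H)%:R * x e)) <=
  expR (- (p * (1 - p) * \sum_e (1 - cos (x e)))).
Proof.
set a := Ex p _; have [a0|a0] := ltP a 0; first by rewrite ltW// (lt_le_trans a0)// expR_ge0.
rewrite -ler_sqr ?nnegrE ?expR_ge0// -expRM_natl.
apply: le_trans (_ : cfsq p (fun H => \sum_e (e \in H)%:R * x e) <= _).
  by rewrite lerDl sqr_ge0.
apply: (le_trans (cfsq_linear_le _ _)); rewrite le_eqVlt; apply/orP; left; apply/eqP.
by congr expR; ring.
Qed.

Lemma subset_mix (S B G H : {set E}) :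
  (S \subset mix B G H)%:R = (S :&: B \subset G)%:R * (S :\: B \subset H)%:R :> R.
Proof.
rewrite -[RHS]natrM mulnb; congr (nat_of_bool _)%:R.
apply/subsetP/andP => [h|[/subsetP h1 /subsetP h2] e eS].
  split; apply/subsetP => e; rewrite !inE.
    by move=> /andP[/h]; rewrite in_mix => + eB; rewrite eB.
  by move=> /andP[eB /h]; rewrite in_mix (negPf eB).
rewrite in_mix; case: (boolP (e \in B)) => eB; first by apply: h1; rewrite inE eS.
by apply: h2; rewrite inE eB.
Qed.

(* If every S i either avoids B or has exactly one element outside B, then the
   dependence on G of the number of S i inside mix B G H is linear in H. *)
Lemma sum_subset_mix_sub (I : finType) (P : pred I) (S : I -> {set E}) (B G G' H : {set E}) :
  (forall i, P i -> S i :&: B = set0 \/ #|S i :\: B| = 1%N) ->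
  \sum_(i | P i) (S i \subset mix B G H)%:R - \sum_(i | P i) (S i \subset mix B G' H)%:R =
  \sum_e (e \in H)%:R * \sum_(i | P i && (S i :\: B == [set e]))
     ((S i :&: B \subset G)%:R - (S i :&: B \subset G')%:R) :> R.
Proof.
move=> SP; rewrite -sumrB.
transitivity (\sum_(i | P i) \sum_e (S i :\: B == [set e])%:R *
   ((e \in H)%:R * ((S i :&: B \subset G)%:R - (S i :&: B \subset G')%:R)) : R).
  apply: eq_bigr => i Pi; rewrite !subset_mix -mulrBl.
  have [->|] := SP i Pi.
    by rewrite !sub0set subrr mul0r big1// => e _; rewrite !mulr0.
  move/eqP/cards1P => [e ->]; rewrite (bigD1 e)//= eqxx mul1r big1 ?addr0.
    by rewrite sub1set mulrC.
  move=> e' e'e; rewrite (_ : (_ == _) = false) ?mul0r//.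
  by apply/eqP => /setP/(_ e'); rewrite !inE eqxx (negPf e'e).
rewrite exchange_big/=; apply: eq_bigr => e _; rewrite mulr_sumr.
rewrite big_mkcondr/=; apply: eq_bigr => i _.
by case: (_ == _); rewrite ?mul1r ?mul0r.
Qed.

End linear_forms.

Section jensen.
Context {R : realType}.

(** The tangent of exp at the mean of the u j, summed over j. *)
Lemma expR_mean_le (k : nat) (u : 'I_k.+1 -> R) :
  k.+1%:R * expR (k.+1%:R^-1 * \sum_j u j) <= \sum_j expR (u j).
Proof.
set v := _ * \sum_j _; set e := expR v.
have e0 : 0 < e by exact: expR_gt0.
apply: (@le_trans _ _ (\sum_j (e * (1 + (u j - v))))).
  rewrite -mulr_sumr big_split/= sumrB !sumr_const card_ord -[v *+ _]mulr_natl /v mulrA.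
  by rewrite divff ?pnatr_eq0// mul1r subrr addr0 mulrC.
apply: ler_sum => j _; rewrite (_ : u j = v + (u j - v)); last by rewrite addrC subrK.
rewrite expRD -/e (addrC v) addrK ler_wpM2l ?(ltW e0)//; exact: expR_ge1Dx.
Qed.

End jensen.

(** * Triangle counts across a bipartition of the vertices *)

Section decoupling.
Import mathcomp.boot.fintype mathcomp.boot.finset.
Context (R : realType) (n : nat) (p : R).
Hypothesis p01 : 0 <= p <= 1.
Implicit Types (G H B : {set edge n}) (e : edge n) (W A T : {set 'I_n}) (w : 'I_n).

Let p0 : 0 <= p. Proof. by case/andP: p01. Qed.

Definition cross A : {set edge n} := [set e : edge n | ~~ (val e \subset A) && ~~ (val e \subset ~: A)].

Lemma edges_in_inside A T : T \subset A -> edges_in T :&: cross A = set0.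
Proof.
move=> TA; apply/setP => e; rewrite !inE; apply/negP => /and3P[eT eA _].
by rewrite (subset_trans eT TA) in eA.
Qed.

Lemma crossC A : cross (~: A) = cross A.
Proof. by apply/setP => e; rewrite !inE setCK andbC. Qed.

Lemma edges_in_tri_cross A e w : val e \subset A -> w \notin A ->
  edges_in (w |: val e) :\: cross A = [set e] /\ edges_in (w |: val e) :&: cross A = cherry e w.
Proof.
move=> eA wA; have we : w \notin val e by apply: contra wA => /(subsetP eA).
have eB : e \notin cross A by rewrite inE eA.
have ch e' : e' \in cherry e w -> e' \in cross A.
  case/cherryP => we' e'w /set0Pn[x]; rewrite !inE => /andP[xe' xe].
  apply/andP; split; first by apply: contra wA => /subsetP; exact.
  by apply/subsetPn; exists x => //; rewrite !inE negbK (subsetP eA).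
split; apply/setP => e'.
  rewrite in_setD in_set1; apply/andP/eqP => [[e'B e'w]|->]; last by rewrite eB inE subsetUr.
  by apply/eqP; apply: contraNT e'B => e'e; apply: ch; rewrite in_setD1 e'e.
rewrite in_setI in_setD1 andbC; case: (boolP (e' \in edges_in _)) => e'w; rewrite ?andbF//= !andbT.
apply/idP/idP => [e'B|e'e]; first by apply: contraNneq eB => <-.
by apply: ch; rewrite in_setD1 e'e.
Qed.

(** A triangle inside one class has no crossing edge; any other has two vertices in one class and so
    exactly one non-crossing edge. This is the hypothesis of [sum_subset_mix_sub], which makes the
    difference of counts linear in the non-crossing edges. *)
Lemma tri_cross_dichotomy A T : #|T| == 3%N ->
  edges_in T :&: cross A = set0 \/ #|edges_in T :\: cross A| = 1%N.
Proof.
have half C : (#|T :&: C| == 2)%N -> #|T| == 3%N -> #|edges_in T :\: cross C| = 1%N.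
  move=> TC T3; pose e : edge n := exist _ (T :&: C) TC.
  have [w] : exists w, w \in T :\: C.
    apply/set0Pn; rewrite -card_gt0.
    by have := cardsID C T; rewrite (eqP TC) (eqP T3) => h; rewrite -(ltn_add2l 2) h.
  rewrite inE => /andP[wC wT].
  have TE : T = w |: val e.
    apply/esym/eqP; rewrite eqEcard (eqP T3) cardsU1 card_edge/=.
    have -> : w \notin T :&: C by rewrite inE (negPf wC) andbF.
    by rewrite andbT subUset sub1set wT subsetIl.
  by rewrite TE (edges_in_tri_cross (A := C) _ wC).1 ?cards1//= subsetIr.
move=> T3; have TIC := cardsID A T; rewrite (eqP T3) setDE in TIC.
case c : #|T :&: A| TIC => [|[|[|[|m]]]] // h.
- left; rewrite -crossC; apply: edges_in_inside.
  by apply/subsetP => x xT; rewrite inE; apply: contraT; rewrite negbK => xA;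
    move/eqP: c; rewrite cards_eq0 => /eqP/setP/(_ x); rewrite !inE xT xA.
- by right; rewrite -crossC; apply: half => //; move/eqP: h; rewrite add1n eqSS.
- by right; apply: half => //; rewrite c.
- left; apply: edges_in_inside; apply/setIidPl/eqP; rewrite eqEcard subsetIl/= c (eqP T3)//.
Qed.

Lemma sum_tri_linear_codeg A e G : val e \subset A ->
  \sum_(T : {set 'I_n} | (#|T| == 3%N) && (edges_in T :\: cross A == [set e]))
    (edges_in T :&: cross A \subset G)%:R = codeg R (~: A) e G.
Proof.
move=> eA; rewrite /codeg.
transitivity (\sum_(T : {set 'I_n} | [&& #|T| == 3%N, val e \subset T &
    edges_in T :\: cross A == [set e]]) (edges_in T :&: cross A \subset G)%:R : R).
  apply: eq_bigl => T; case: (#|T| == 3%N) => //=; apply/eqP/andP => [Te|[_ /eqP//]].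
  by rewrite Te eqxx; have /setP/(_ e) := Te; rewrite !inE eqxx => /andP[_ ->].
have PE w : (w \notin val e) && (edges_in (w |: val e) :\: cross A == [set e]) = (w \notin A).
  case: (boolP (w \in A)) => wA; last first.
    by rewrite (edges_in_tri_cross eA wA).1 eqxx andbT; apply: contra wA => /(subsetP eA).
  apply/negP => /andP[we /eqP h].
  have := cardsID (cross A) (edges_in (w |: val e)).
  rewrite h cards1 edges_in_inside ?subUset ?sub1set ?wA// cards0.
  by rewrite card_triangle_edges// cardsU1 we card_edge.
rewrite sum_triangles_edge; apply: eq_big => w; first by rewrite PE inE.
by rewrite PE => wA; rewrite (edges_in_tri_cross eA wA).2.
Qed.

(** The edges that the codegree of e into the complement of A reads. *)
Definition star A e : {set edge n} := \bigcup_(w in ~: A) cherry e w.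

Lemma codeg_dep A e : depends_on (star A e) (codeg R (~: A) e).
Proof.
move=> G H GH; apply: eq_bigr => w wA.
by have := @depends_on_subset R _ _ _ (bigcup_sup w wA) G H GH.
Qed.

Lemma star_disjoint A e e' : val e \subset A -> val e' \subset A ->
  val e :&: val e' = set0 -> star A e :&: star A e' = set0.
Proof.
move=> eA e'A ee'; apply/eqP; apply: contraT => /set0Pn[x].
rewrite in_setI /star => /andP[/bigcupP[w wA /cherryP[_ _ /set0Pn[y yxe]]] /bigcupP[w' w'A /cherryP[_ xw' _]]].
move: yxe; rewrite inE => /andP[yx ye]; have := subsetP xw' y yx; rewrite !inE => /orP[/eqP yw'|ye'].
  by move: w'A; rewrite inE -yw' (subsetP eA).
by have /setP/(_ y) := ee'; rewrite !inE ye ye'.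
Qed.

Lemma card_initial m : (m <= n)%N -> #|[set x : 'I_n | (x < m)%N]| = m.
Proof.
move=> mn; have inj : injective (widen_ord mn) by move=> x y /(congr1 val)/= /val_inj.
rewrite -[RHS]card_ord -(card_imset _ inj); apply: eq_card => x; rewrite inE.
apply/idP/imsetP => [xm|[y _ ->]]; last exact: (ltn_ord y).
by exists (Ordinal xm) => //; exact: val_inj.
Qed.

(** The non-crossing edges H are shared, and the crossing edges come in two independent copies G and
    G'. The difference of the two counts is a linear form in H, whose coefficient at an edge e
    inside A is the difference of the codegrees of e into the complement. Edges inside the
    complement are discarded, since 1 - cos >= 0. *)
Lemma cfsq_triangles_decoupled_aux A (t : R) :
  cfsq p (fun G => t * (triangles G)%:R) <=
  Ex p (fun G => Ex p (fun H => expR (- (p * (1 - p) *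
    \sum_(e : edge n | val e \subset A) (1 - cos (t * (codeg R (~: A) e G - codeg R (~: A) e H))))))).
Proof.
apply: (le_trans (cfsq_le_mix p01 (cross A) _)).
under eq_Ex do rewrite -Ex_cos_copies.
rewrite Ex_exchange; apply: le_Ex => // G; rewrite Ex_exchange; apply: le_Ex => // G'.
pose D e : R := \sum_(T : {set 'I_n} | (#|T| == 3%N) && (edges_in T :\: cross A == [set e]))
   ((edges_in T :&: cross A \subset G)%:R - (edges_in T :&: cross A \subset G')%:R).
rewrite (eq_Ex p (g := fun H => cos (\sum_e (e \in H)%:R * (t * D e)))); last first.
  move=> H; congr cos; rewrite -mulrBr.
  have tE K : (triangles K)%:R =
      \sum_(T : {set 'I_n} | #|T| == 3%N) (edges_in T \subset K)%:R :> R.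
    by rewrite triangles_sum natr_sum.
  rewrite !tE sum_subset_mix_sub; last by move=> T; exact: tri_cross_dichotomy.
  by rewrite mulr_sumr; apply: eq_bigr => e _; rewrite mulrCA.
apply: (le_trans (Ex_cos_linear_le p (fun e => t * D e))); rewrite ler_expR lerN2.
have pp0 : 0 <= p * (1 - p) by case/andP: p01 => _ p1; rewrite mulr_ge0 ?subr_ge0.
apply: ler_wpM2l => //.
rewrite big_mkcond; apply: ler_sum => e _; case: ifPn => [eA|_]; last exact: one_sub_cos_ge0.
by rewrite /D sumrB !(sum_tri_linear_codeg _ eA).
Qed.

(** Codegrees of edges with a common vertex are dependent. Inside A only the edges between two
    halves of k.+1 vertices are kept, and this complete bipartite graph is split into k.+1 perfect
    matchings. Jensen over the matchings reduces to a single one with weight L = (k+1) p / 2; within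
    a matching the stars are disjoint and the expectation factorises. *)
Lemma cfsq_triangles_decoupled k (t : R) : (k.+1 + k.+1 <= n)%N -> p <= 1 / 2 ->
  1 <= (n - (k.+1 + k.+1))%:R * p ^+ 2 -> `|t| <= pi -> 1 / 2304 <= k.+1%:R * p / 2 ->
  cfsq p (fun G => t * (triangles G)%:R) <= expR (- (k.+1%:R * (3 / 128 *
    Num.min (k.+1%:R * p / 2 * ((n - (k.+1 + k.+1))%:R * p ^+ 2 * t ^+ 2)) (1 / 2304)))).
Proof.
move=> kn p2; pose A := [set x : 'I_n | (x < k.+1 + k.+1)%N].
have cA : #|~: A| = (n - (k.+1 + k.+1))%N by rewrite cardsCs setCK card_ord card_initial.
rewrite -cA; set q := Num.min _ _ => m1 tpi L1.
apply: (le_trans (cfsq_triangles_decoupled_aux A t)).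
have an (i : 'I_k.+1) : (i < n)%N by apply: leq_trans kn; rewrite ltn_addr.
have bn (i : 'I_k.+1) : (k.+1 + i < n)%N by apply: leq_trans kn; rewrite ltn_add2l.
have abP (i j : 'I_k.+1) : #|[set Ordinal (an i); Ordinal (bn j)]| == 2%N.
  by rewrite cards2 -val_eqE/= neq_ltn ltn_addr.
pose e i j : edge n := exist (fun S : {set 'I_n} => #|S| == 2%N) _ (abP i j).
have eA i j : val (e i j) \subset A.
  by apply/subsetP => x; rewrite !inE => /orP[]/eqP->/=; rewrite ?ltn_add2l// ltn_addr.
have eI i j i' j' : val (e i j) :&: val (e i' j') != set0 -> i = i' \/ j = j'.
  case/set0Pn => x; rewrite !inE => /andP[/orP[]/eqP-> /orP[]].
  - by move=> /eqP[/val_inj ->]; left.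
  - by move=> /eqP[h]; have := ltn_ord i; rewrite h ltnNge leq_addr.
  - by move=> /eqP[h]; have := ltn_ord i'; rewrite -h ltnNge leq_addr.
  - by move=> /eqP[/addnI/val_inj ->]; right.
have eW i j w : w \in ~: A -> w \notin val (e i j).
  by rewrite inE; apply: contra => /(subsetP (eA i j)).
have e_inj : injective (fun x : 'I_k.+1 * 'I_k.+1 => e x.1 x.2).
  move=> [i j] [i' j'] /= /(congr1 val) /= h.
  have : Ordinal (an i) \in [set Ordinal (an i'); Ordinal (bn j')] by rewrite -h !inE eqxx.
  have : Ordinal (bn j) \in [set Ordinal (an i'); Ordinal (bn j')] by rewrite -h !inE eqxx orbT.
  rewrite !inE -!val_eqE/= eqn_add2l => /orP[/eqP h1|/eqP/val_inj ->].
    by have := ltn_ord i'; rewrite -h1 ltnNge leq_addr.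
  move=> /orP[/eqP/val_inj -> //|/eqP h1].
  by have := ltn_ord i; rewrite h1 ltnNge leq_addr.
pose c x G H : R := 1 - cos (t * (codeg R (~: A) x G - codeg R (~: A) x H)).
have c0 x G H : 0 <= c x G H by exact: one_sub_cos_ge0.
set L := k.+1%:R * p / 2 in L1 q *.
(* Matching j pairs i with i + j, addition modulo k.+1, so each edge between the halves lies in
   exactly one matching. *)
pose u (j : 'I_k.+1) G H : R := - (L * \sum_i c (e i (i + j)) G H).
have kp : 0 < k.+1%:R :> R by rewrite ltr0n.
have shift G H : \sum_j \sum_i c (e i (i + j)) G H = \sum_i \sum_j c (e i j) G H.
  by rewrite exchange_big; apply: eq_bigr => i _; rewrite [RHS](reindex_inj (addrI i)).
have sub G H : \sum_i \sum_j c (e i j) G H <= \sum_(x : edge n | val x \subset A) c x G H.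
  rewrite (pair_bigA _ (fun i j => c (e i j) G H))/=.
  have -> : \sum_(x : 'I_k.+1 * 'I_k.+1) c (e x.1 x.2) G H =
      \sum_(x in [set e y.1 y.2 | y in [set: 'I_k.+1 * 'I_k.+1]]) c x G H.
    rewrite big_imset/=; last by move=> x y _ _; exact: e_inj.
    by apply: eq_bigl => x; rewrite inE.
  rewrite big_mkcond [leRHS]big_mkcond; apply: ler_sum => x _.
  case: imsetP => [[[i j] _ ->]|_]; first by rewrite eA.
  by case: ifP.
have u1 j G H : expR (u j G H) = \prod_i expR (- (L * c (e i (i + j)) G H)).
  by rewrite /u mulr_sumr -sumrN expR_sum.
apply: (@le_trans _ _ (Ex p (fun G => Ex p (fun H => k.+1%:R^-1 * \sum_j expR (u j G H))))).
  apply: le_Ex => // G; apply: le_Ex => // H.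
  rewrite ler_pdivlMl//; apply: le_trans (expR_mean_le _); rewrite ler_wpM2l ?(ltW kp)// ler_expR.
  have -> : k.+1%:R^-1 * \sum_j u j G H = - (p / 2 * \sum_i \sum_j c (e i j) G H).
    by rewrite -shift /u sumrN -mulr_sumr /L; field; rewrite gt_eqF.
  rewrite lerN2; apply: ler_pM => //.
  - by rewrite divr_ge0.
  - by do 2 apply: sumr_ge0 => ? _.
  - by have := p0; nra.
have uB j : Ex p (fun G => Ex p (fun H => expR (u j G H))) <= expR (- (k.+1%:R * (3 / 128 * q))).
  pose F i G H := expR (- (L * c (e i (i + j)) G H)).
  have dF i : forall G, depends_on (star A (e i (i + j))) (F i G).
    move=> G H H' HH'; rewrite /F /c.
    by rewrite (@codeg_dep A _ _ _ HH').
  have ds i i' : i != i' -> star A (e i (i + j)) :&: star A (e i' (i' + j)) = set0.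
    move=> ii'; apply: star_disjoint => //; apply/eqP; apply: contraNT ii' => /eI[->//|/eqP].
    by rewrite (inj_eq (addIr j)).
  rewrite (eq_Ex p (g := fun G => \prod_i Ex p (F i G))); last first.
    move=> G; rewrite -(Ex_prod p ds); last by move=> i; exact: dF.
    by apply: eq_Ex => H; rewrite u1.
  rewrite (Ex_prod p ds); last first.
    move=> i G G' GG'; apply: eq_Ex => H; rewrite /F /c.
    by rewrite (@codeg_dep A _ _ _ GG').
  rewrite -mulrN expRM_natl -[X in _ ^+ X]card_ord -prodr_const; apply: ler_prod => i _.
  rewrite Ex_ge0//=; last by move=> G; apply: Ex_ge0 => // H; exact: expR_ge0.
  apply: (le_trans (expRN_codeg_diff_le p01 (eW i (i + j)) p2 m1 tpi L1)).
  exact: expR_ge1Dx.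
have -> : Ex p (fun G => Ex p (fun H => k.+1%:R^-1 * \sum_j expR (u j G H))) =
    k.+1%:R^-1 * \sum_j Ex p (fun G => Ex p (fun H => expR (u j G H))).
  rewrite -Ex_sum -ExZ; apply: eq_Ex => G; rewrite ExZ; congr (_ * _).
  by rewrite -Ex_sum.
rewrite ler_pdivrMl//; apply: (le_trans (ler_sum _ (fun j _ => uB j))).
by rewrite sumr_const card_ord [leRHS]mulr_natl.
Qed.

End decoupling.

(** * Vertex blocks for intermediate frequencies *)

Section perturbation.
Import mathcomp.boot.fintype mathcomp.boot.finset.
Context (R : realType) (E : finType) (p : R).
Hypothesis p01 : 0 <= p <= 1.

Lemma norm_sinD_sub (a x : R) : `|sin (a + x) - sin a| <= `|x|.
Proof. by rewrite -!cosBpihalf addrAC; exact: norm_cosD_sub. Qed.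

Lemma cfsq_le1 (f : {set E} -> R) : cfsq p f <= 1.
Proof.
apply: (@le_trans _ _ (Ex p (fun G => cos (f G) ^+ 2) + Ex p (fun G => sin (f G) ^+ 2))).
  by apply: lerD; exact: Ex_sqr_le.
rewrite -ExD (eq_Ex p (g := fun=> 1)) ?Ex_cst// => G; exact: cos2Dsin2.
Qed.

Lemma cfsq_perturb (f g : {set E} -> R) (y : R) : Ex p (fun G => `|g G|) <= y ->
  cfsq p (fun G => f G + g G) <= cfsq p f + (4 * y + 2 * y ^+ 2).
Proof.
move=> gy.
have y0 : 0 <= y by apply: le_trans gy; exact: Ex_ge0.
have h (a b : R) : `|a - b| <= y -> `|b| <= 1 -> a ^+ 2 <= b ^+ 2 + (2 * y + y ^+ 2).
  move=> ab b1.
  have : `|a| <= `|b| + y by rewrite -lerBlDl (le_trans (lerB_dist _ _)).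
  rewrite -(real_normK (num_real a)) -(real_normK (num_real b)) => ay.
  apply: (@le_trans _ _ ((`|b| + y) ^+ 2)); first by rewrite ler_sqr ?nnegrE// addr_ge0.
  by have := normr_ge0 b; nra.
have le1 (u : {set E} -> R) : (forall G, `|u G| <= 1) -> `|Ex p u| <= 1.
  by move=> u1; rewrite (le_trans (Ex_norm p01 _))// -[leRHS](Ex_cst E p); exact: le_Ex.
have dist (c : R -> R) : (forall a x, `|c (a + x) - c a| <= `|x|) ->
    `|Ex p (fun G => c (f G + g G)) - Ex p (fun G => c (f G))| <= y.
  move=> ch; rewrite -ExB (le_trans (Ex_norm p01 _))//; apply: le_trans gy; exact: le_Ex.
have h1 := h _ _ (dist cos (@norm_cosD_sub R)) (le1 _ (fun G => cos_max _)).
have h2 := h _ _ (dist sin norm_sinD_sub) (le1 _ (fun G => sin_max _)).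
apply: (le_trans (lerD h1 h2)); rewrite le_eqVlt; apply/orP; left; apply/eqP.
by rewrite /cfsq; ring.
Qed.

Lemma Ex_normr_le (g : {set E} -> R) (y : R) : 0 <= y ->
  Ex p (fun G => g G ^+ 2) <= y ^+ 2 -> Ex p (fun G => `|g G|) <= y.
Proof.
move=> y0 gy; rewrite -ler_sqr ?nnegrE//; last exact: Ex_ge0.
apply: (le_trans (Ex_sqr_le p01 _)); apply: le_trans gy.
by apply: le_Ex => // G; rewrite real_normK ?num_real.
Qed.

End perturbation.

Section cauchy_schwarz.
Context {R : realType}.

Lemma sqr_sum_le (I : finType) (S : {set I}) (x : I -> R) :
  (\sum_(i in S) x i) ^+ 2 <= #|S|%:R * \sum_(i in S) x i ^+ 2.
Proof.
rewrite expr2 mulr_suml.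
apply: (@le_trans _ _ (\sum_(i in S) \sum_(j in S) (x i ^+ 2 / 2 + x j ^+ 2 / 2))).
  apply: ler_sum => i _; rewrite mulr_sumr; apply: ler_sum => j _.
  by have := sqr_ge0 (x i - x j); nra.
rewrite le_eqVlt; apply/orP; left; apply/eqP.
under eq_bigr do rewrite big_split/= sumr_const.
rewrite big_split/= sumrMnl sumr_const -!mulr_suml -mulrnDl -[LHS]mulr_natl.
by congr (_ * _); field.
Qed.

End cauchy_schwarz.

Section block_arithmetic.
Context {R : realType}.

(** Here x is a lower bound for the linear term q and h the quadratic one; x <= 1/216 gives h / 2 <=
    108 x^2 <= x / 2. *)
Lemma second_order_arith (x q h : R) : 0 <= x -> x <= 1 / 216 -> x <= q -> h <= 216 * x ^+ 2 ->
  1 - q + h / 2 <= 1 - x / 2.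
Proof. by move=> *; nra. Qed.

End block_arithmetic.

(** * Triangles relative to disjoint vertex blocks *)

Section blocks.
Import mathcomp.boot.fintype mathcomp.boot.finset.
Context (R : realType) (n : nat) (p : R).
Hypothesis p01 : 0 <= p <= 1.
Context (m : nat) (A : 'I_m -> {set 'I_n}) (W : {set 'I_n}).
Hypothesis Adisj : forall i j, i != j -> A i :&: A j = set0.
Hypothesis AW : forall i, A i :&: W = set0.
Implicit Types (G H : {set edge n}) (e : edge n) (T : {set 'I_n}) (w : 'I_n).

Let p0 : 0 <= p. Proof. by case/andP: p01. Qed.

Let Q : {set edge n} := [set e : edge n | [exists i, val e \subset A i]].

Let edge_block i j e : val e \subset A i -> val e \subset A j -> i = j.
Proof.
move=> ei ej; apply/eqP; apply: contraT => /Adisj h.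
have : val e \subset A i :&: A j by rewrite subsetI ei.
by rewrite h subset0 -cards_eq0 card_edge.
Qed.

Let inQ i e : val e \subset A i -> e \in Q.
Proof. by move=> ei; rewrite inE; apply/existsP; exists i. Qed.

Let tri_in_block i T : T \subset A i -> edges_in T :&: Q = edges_in T.
Proof.
move=> Ti; apply/setIidPl/subsetP => e; rewrite inE => eT.
exact: inQ (subset_trans eT Ti).
Qed.

(** Two edges of a triangle share a vertex, so the blocks containing them meet and coincide. *)
Let tri_two_edges T e e' : #|T| == 3%N -> e \in edges_in T :&: Q -> e' \in edges_in T :&: Q ->
  e != e' -> exists i, T \subset A i.
Proof.
move=> T3; rewrite !inE => /andP[eT /existsP[i ei]] /andP[e'T /existsP[j e'j]] ee'.
have c : (2 < #|val e :|: val e'|)%N.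
  rewrite card_setU_setD card_edge -addn1 leq_add2l card_gt0; apply/negP; rewrite setD_eq0 => h.
  case/negP: ee'; apply/eqP/val_inj/esym/eqP; by rewrite eqEcard h !card_edge.
have UT : val e :|: val e' = T.
  by apply/eqP; rewrite eqEcard subUset eT e'T (eqP T3).
have ij : i = j.
  apply/eqP; apply: contraT => /Adisj h.
  have : val e :&: val e' \subset A i :&: A j by rewrite setISS.
  rewrite h subset0 => /eqP I0; have := cardsUI (val e) (val e').
  by rewrite UT I0 (eqP T3) cards0 !card_edge.
by exists i; rewrite -UT subUset ei ij.
Qed.

(** The coefficient of e once all edges outside the blocks are revealed: the revealed cherries that
    close a triangle with e as its only edge inside a block. *)
Definition out_codeg e H : R :=
  \sum_(T : {set 'I_n} | (#|T| == 3%N) && (edges_in T :&: Q == [set e]))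
    (edges_in T :\: Q \subset H)%:R.

Let block_sum i G H : R :=
  \sum_(e : edge n | val e \subset A i) (e \in G)%:R * out_codeg e H +
  \sum_(T : {set 'I_n} | (#|T| == 3%N) && (T \subset A i)) (edges_in T \subset G)%:R.

Let no_block H : R := \sum_(T : {set 'I_n} | #|T| == 3%N)
   (edges_in T :&: Q == set0)%:R * (edges_in T :\: Q \subset H)%:R.

(** A triangle lies inside one block, or has exactly one edge in Q and is counted by [out_codeg] at
    that edge, or has none and does not depend on G. *)
Let triangles_mix G H :
  (triangles (mix Q G H))%:R = no_block H + \sum_i block_sum i G H.
Proof.
rewrite triangles_sum natr_sum /block_sum big_split/=.
have -> : \sum_(i < m) \sum_(e : edge n | val e \subset A i) (e \in G)%:R * out_codeg e H =
   \sum_(T : {set 'I_n} | #|T| == 3%N) \sum_(i < m) \sum_(e : edge n | val e \subset A i)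
     (edges_in T :&: Q == [set e])%:R * ((e \in G)%:R * (edges_in T :\: Q \subset H)%:R).
  rewrite [RHS]exchange_big/=; apply: eq_bigr => i _; rewrite [RHS]exchange_big/=.
  apply: eq_bigr => e _; rewrite /out_codeg mulr_sumr big_mkcondr/=; apply: eq_bigr => T _.
  by case: (_ == _); rewrite ?mul1r ?mul0r.
have -> : \sum_(i < m) \sum_(T : {set 'I_n} | (#|T| == 3%N) && (T \subset A i)) (edges_in T \subset G)%:R =
   \sum_(T : {set 'I_n} | #|T| == 3%N) \sum_(i < m) (T \subset A i)%:R * (edges_in T \subset G)%:R :> R.
  rewrite [RHS]exchange_big/=; apply: eq_bigr => i _; rewrite big_mkcondr/=.
  by apply: eq_bigr => T _; case: (_ \subset A i); rewrite ?mul1r ?mul0r.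
rewrite /no_block -!big_split/=; apply: eq_bigr => T T3; rewrite subset_mix.
have c3 := card_triangle_edges T3.
have [/existsP[i Ti]|/existsPn noT] := boolP [exists i, T \subset A i].
  have TQ := tri_in_block Ti; rewrite TQ -cards_eq0 c3 mul0r add0r.
  rewrite big1 => [|j _]; last first.
    rewrite big1// => e _; rewrite (_ : (_ == _) = false) ?mul0r//.
    by apply/eqP => h; rewrite h cards1 in c3.
  have -> : edges_in T :\: Q = set0 by apply/eqP; rewrite setD_eq0 -TQ subsetIr.
  rewrite sub0set mulr1 add0r (bigD1 i)//= Ti mul1r big1 ?addr0// => j ji.
  rewrite (_ : (T \subset A j) = false) ?mul0r//; apply/negP => Tj.
  have : T \subset A j :&: A i by rewrite subsetI Ti Tj.
  by rewrite (Adisj ji) subset0 -cards_eq0 (eqP T3).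
rewrite [X in _ + (_ + X)]big1 ?addr0; last by move=> i _; rewrite (negPf (noT i)) mul0r.
have [T0|/set0Pn[e eTQ]] := eqVneq (edges_in T :&: Q) set0.
  rewrite T0 sub0set mul1r big1 ?addr0// => i _; rewrite big1// => e _.
  rewrite (_ : (_ == _) = false) ?mul0r//; apply/eqP => /setP/(_ e).
  by rewrite !inE eqxx.
have Te : edges_in T :&: Q = [set e].
  apply/setP => e'; rewrite in_set1; apply/idP/eqP => [e'TQ|->//].
  apply/eqP; apply: contraT => ee'; have [i Ti] := tri_two_edges T3 e'TQ eTQ ee'.
  by have := noT i; rewrite Ti.
rewrite Te mul0r add0r sub1set.
have /existsP[i ei] : [exists i, val e \subset A i] by move: eTQ; rewrite !inE => /andP[].
rewrite (bigD1 i)//= [X in _ + X]big1 ?addr0; last first.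
  move=> j ji; rewrite big1// => e' e'j; rewrite (_ : (_ == _) = false) ?mul0r//.
  apply/eqP => /set1_inj ee'; rewrite -ee' in e'j.
  by rewrite (edge_block ei e'j) eqxx in ji.
rewrite (bigD1 e)//= eqxx mul1r big1 ?addr0// => e' /andP[_ e'e].
rewrite (_ : (_ == _) = false) ?mul0r//; apply/eqP => /set1_inj ee'.
by rewrite ee' eqxx in e'e.
Qed.

Let cherryE e w : w \notin val e -> edges_in (w |: val e) :&: Q = [set e] ->
  edges_in (w |: val e) :\: Q = cherry e w.
Proof.
move=> we h; rewrite /cherry -h; apply/setP => x; rewrite !inE negb_and.
by case: (_ \subset _); rewrite /= ?andbF ?andbT.
Qed.

Let cherry_block i e w : val e \subset A i -> w \in W ->
  w \notin val e /\ edges_in (w |: val e) :&: Q = [set e].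
Proof.
move=> ei wW; have wA j : w \notin A j.
  by apply/negP => wj; have /setP/(_ w) := AW j; rewrite !inE wj wW.
have we : w \notin val e by apply: contra (wA i) => /(subsetP ei).
split=> //; apply/setP => x; rewrite in_set1; apply/idP/eqP => [|->]; last first.
  by rewrite inE (inQ ei) inE subsetUr.
rewrite in_setI => /andP[xw xQ]; apply/eqP; apply: contraT => xe.
have wx := edge_through xw xe.
move: xQ; rewrite inE => /existsP[j /subsetP/(_ w wx)].
by rewrite (negPf (wA j)).
Qed.

Let out_codegE e H : out_codeg e H =
  \sum_(w | (w \notin val e) && (edges_in (w |: val e) :&: Q == [set e])) (cherry e w \subset H)%:R.
Proof.
rewrite /out_codeg.
transitivity (\sum_(T : {set 'I_n} | [&& #|T| == 3%N, val e \subset T &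
    edges_in T :&: Q == [set e]]) (edges_in T :\: Q \subset H)%:R : R).
  apply: eq_bigl => T; case: (#|T| == 3%N) => //=; apply/eqP/andP => [Te|[_ /eqP//]].
  by rewrite Te eqxx; have /setP/(_ e) := Te; rewrite !inE eqxx => /andP[-> _].
rewrite sum_triangles_edge; apply: eq_bigr => w /andP[we /eqP h].
by rewrite cherryE.
Qed.

(** [out_codeg] lies between the codegree into W and the full codegree: the lower bound reads
    disjoint sets of edges for different blocks, the upper bound has explicit exponential
    moments. *)
Let codeg_le_out i e H : val e \subset A i -> codeg R W e H <= out_codeg e H.
Proof.
move=> ei; rewrite out_codegE /codeg big_mkcond [leRHS]big_mkcond; apply: ler_sum => w _.
case: ifPn => [wW|_]; last by case: ifP.
by have [-> ->] := cherry_block ei wW; rewrite eqxx.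
Qed.

Let out_le_codeg e H : out_codeg e H <= codeg R (~: val e) e H.
Proof.
rewrite out_codegE /codeg big_mkcond [leRHS]big_mkcond; apply: ler_sum => w _.
by rewrite inE; case: (w \in val e) => //=; case: ifP.
Qed.

(** The edges between block i and W. Keeping W outside all blocks makes these sets disjoint, hence
    the codegrees into W of different blocks independent. *)
Let touch i : {set edge n} := [set x : edge n |
  [&& val x :&: A i != set0, val x :&: W != set0 & val x \subset A i :|: W]].

Let touch_disj i j : i != j -> touch i :&: touch j = set0.
Proof.
move=> ij; apply/eqP; apply: contraT => /set0Pn[x]; rewrite !inE.
case/andP => /and3P[/set0Pn[y]]; rewrite inE => /andP[yx yi] _ _ /and3P[_ _ /subsetP/(_ y yx)].
rewrite inE => /orP[yj|yW].
  by have /setP/(_ y) := Adisj ij; rewrite !inE yi yj.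
by have /setP/(_ y) := AW i; rewrite !inE yi yW.
Qed.

Let codeg_touch i e : val e \subset A i -> depends_on (touch i) (codeg R W e).
Proof.
move=> ei G H GH; apply: eq_bigr => w wW.
have sub : cherry e w \subset touch i.
  apply/subsetP => x /cherryP[wx xw /set0Pn[y]]; rewrite inE => /andP[yx ye].
  rewrite inE; apply/and3P; split.
  - by apply/set0Pn; exists y; rewrite inE yx (subsetP ei).
  - by apply/set0Pn; exists w; rewrite inE wx.
  - apply: (subset_trans xw); rewrite subUset sub1set inE wW orbT.
    exact: subset_trans ei (subsetUl _ _).
by have := @depends_on_subset R _ _ _ sub G H GH.
Qed.

Context (a : nat).
Hypothesis Acard : forall i, #|A i| = a.
Hypothesis p2 : p <= 1 / 2.

Let block_edges_disj i j : i != j -> edges_in (A i) :&: edges_in (A j) = set0.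
Proof.
move=> ij; apply/eqP; apply: contraT => /set0Pn[x]; rewrite !inE => /andP[xi xj].
by rewrite (edge_block xi xj) eqxx in ij.
Qed.

Let block_sum_dep i H (t : R) : depends_on (edges_in (A i)) (fun G => t * block_sum i G H).
Proof.
move=> G G' GG'; congr (_ * (_ + _)).
  apply: eq_bigr => e ei; congr (_ * _); have /setP/(_ e) := GG'.
  by rewrite !in_setI inE ei !andbT => ->.
apply: eq_bigr => T /andP[_ Ti].
by have := @depends_on_subset R _ _ _ (edges_inS Ti) G G' GG'.
Qed.

Lemma cfsq_blocks (t : R) :
  cfsq p (fun G => t * (triangles G)%:R) <=
  Ex p (fun H => \prod_i cfsq p (fun G => t * block_sum i G H)).
Proof.
apply: (le_trans (cfsq_le_mix p01 Q _)); apply: le_Ex => // H.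
rewrite (eq_cfsq p (g := fun G => t * no_block H + \sum_i t * block_sum i G H)); last first.
  by move=> G; rewrite triangles_mix mulrDr [X in _ + X]mulr_sumr.
by rewrite cfsq_shift (cfsq_sum p block_edges_disj).
Qed.

(** The linear form in the block edges is perturbed by the centred count of triangles inside the
    block, of size at most y in mean square by [var_triangles_le]. The bound by pi is what allows 1
    - cos x >= x^2 / 16. *)
Lemma cfsq_block_le i H (t y : R) : 0 <= y ->
  t ^+ 2 * ('C(a, 3)%:R * (p ^+ 3 * (3 * (a%:R * p ^+ 2 + 6)))) <= y ^+ 2 ->
  (forall e : edge n, val e \subset A i -> `|t * out_codeg e H| <= pi) ->
  cfsq p (fun G => t * block_sum i G H) <=
  expR (- (p * t ^+ 2 / 16 * \sum_(e in edges_in (A i)) codeg R W e H ^+ 2)) + (4 * y + 2 * y ^+ 2).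
Proof.
move=> y0 vy tpi.
pose L G : R := \sum_(e : edge n | val e \subset A i) (e \in G)%:R * (t * out_codeg e H).
pose Y G : R := t * \sum_T tri_ind p (A i) T G.
rewrite (eq_cfsq p (g := fun G => t * ('C(a, 3)%:R * p ^+ 3) + (L G + Y G))); last first.
  move=> G; rewrite /Y sum_tri_indE Acard /block_sum.
  have -> : L G = t * \sum_(e : edge n | val e \subset A i) (e \in G)%:R * out_codeg e H.
    by rewrite /L mulr_sumr; apply: eq_bigr => e _; rewrite mulrCA.
  by ring.
rewrite cfsq_shift; apply: (le_trans (cfsq_perturb p01 L (y := y) _)).
  apply: Ex_normr_le => //; rewrite /Y.
  rewrite (eq_Ex p (g := fun G => t ^+ 2 * (\sum_T tri_ind p (A i) T G) ^+ 2)); last first.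
    by move=> G; rewrite exprMn.
  rewrite ExZ; apply: le_trans vy; rewrite ler_wpM2l ?sqr_ge0// -(Acard i).
  exact: var_triangles_le.
rewrite lerD2r; apply: (le_trans (cfsq_linear_le _ _ _)); rewrite ler_expR lerN2.
rewrite [X in X <= _](_ : _ = \sum_(e : edge n | val e \subset A i) p * t ^+ 2 / 16 * codeg R W e H ^+ 2); last first.
  by rewrite mulr_sumr; apply: eq_bigl => e; rewrite inE.
rewrite mulr_sumr; apply: ler_sum => e ei.
have := one_sub_cos_ge (tpi e ei); rewrite exprMn => h.
have dd : codeg R W e H ^+ 2 <= out_codeg e H ^+ 2.
  by rewrite ler_sqr ?nnegrE ?codeg_ge0 ?(le_trans _ (codeg_le_out H ei))// ?codeg_ge0// codeg_le_out.
have t2 := sqr_ge0 t.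
apply: (@le_trans _ _ (p * (t ^+ 2 * out_codeg e H ^+ 2 / 16))).
  rewrite (_ : _ * codeg R W e H ^+ 2 = p * (t ^+ 2 * codeg R W e H ^+ 2 / 16)); last by field.
  by rewrite ler_wpM2l// ler_wpM2r ?invr_ge0// ler_wpM2l.
apply: (@le_trans _ _ (p * (1 - cos (t * out_codeg e H)))); first by rewrite ler_wpM2l.
rewrite ler_wpM2r ?one_sub_cos_ge0//.
by have h0 := p0; have h2 := p2; rewrite -subr_ge0 (_ : _ - p = p * (1 - 2 * p)) ?mulr_ge0//; [lra|ring].
Qed.

Let notin_block i e w : val e \subset A i -> w \in W -> w \notin val e.
Proof. by move=> ei wW; have [] := cherry_block ei wW. Qed.

Let M : R := #|W|%:R * p ^+ 2.

(** exp(-c S) is expanded to second order, S being the sum of squared codegrees: E S is bounded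
    below through E codeg^2 >= M^2, and E S^2 above through Cauchy-Schwarz and the fourth moment 216
    M^4. *)
Let Ex_block_exp i (c : R) : 1 <= M -> 0 <= c -> c * ('C(a, 2)%:R * M ^+ 2) <= 1 / 216 ->
  Ex p (fun H => expR (- (c * \sum_(e in edges_in (A i)) codeg R W e H ^+ 2))) <=
  1 - c * ('C(a, 2)%:R * M ^+ 2) / 2.
Proof.
move=> M1 c0 cM; set y0 := c * _ in cM *.
pose S H := \sum_(e in edges_in (A i)) codeg R W e H ^+ 2.
have S0 H : 0 <= S H by apply: sumr_ge0 => e _; exact: sqr_ge0.
have cA : #|edges_in (A i)| = 'C(a, 2) by rewrite card_edges_in Acard.
have y00 : 0 <= y0 by rewrite mulr_ge0// mulr_ge0// sqr_ge0.
have lo : y0 <= c * Ex p S.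
  rewrite ler_wpM2l// /S Ex_sum -cA mulr_natl -sumr_const; apply: ler_sum => e.
  rewrite inE => ei; apply: Ex_codeg2_ge => // w; exact: notin_block ei.
have hi : c ^+ 2 * Ex p (fun H => S H ^+ 2) <= 216 * y0 ^+ 2.
  have -> : 216 * y0 ^+ 2 = c ^+ 2 * ('C(a, 2)%:R * ('C(a, 2)%:R * (216 * M ^+ 4))).
    by rewrite /y0; ring.
  rewrite ler_wpM2l ?sqr_ge0//.
  apply: (@le_trans _ _ (Ex p (fun H => 'C(a, 2)%:R * \sum_(e in edges_in (A i)) codeg R W e H ^+ 4))).
    apply: le_Ex => // H; rewrite -cA; apply: (le_trans (sqr_sum_le _ _)).
    by rewrite ler_wpM2l//; apply: ler_sum => e _; rewrite -exprM.
  rewrite ExZ Ex_sum ler_wpM2l// -cA mulr_natl -sumr_const; apply: ler_sum => e.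
  rewrite inE => ei; apply: Ex_codeg4_le => // w; exact: notin_block ei.
apply: (@le_trans _ _ (1 - c * Ex p S + c ^+ 2 * Ex p (fun H => S H ^+ 2) / 2)).
  have -> : 1 - c * Ex p S + c ^+ 2 * Ex p (fun H => S H ^+ 2) / 2 =
      Ex p (fun H => 1 - c * S H + c ^+ 2 / 2 * S H ^+ 2).
    by rewrite ExD ExB Ex_cst !ExZ; field.
  apply: le_Ex => // H; rewrite -/(S H).
  apply: (le_trans (expRN_le _)); first by rewrite mulr_ge0 ?S0.
  by rewrite exprMn lerD2l le_eqVlt; apply/orP; left; apply/eqP; field.
exact: second_order_arith hi.
Qed.

(** If all t * [out_codeg] are at most pi, the block bounds are multiplied and their expectation
    factorises. Otherwise the product is at most 1, and an exponential Markov bound, summed over at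
    most n^2 edges, gives the second term; its exponent uses exp 1 - 1 <= 2. *)
Lemma cfsq_triangles_blocks (t y : R) : 1 <= M -> 0 < t -> 0 <= y ->
  p * t ^+ 2 / 16 * ('C(a, 2)%:R * M ^+ 2) <= 1 / 216 ->
  t ^+ 2 * ('C(a, 3)%:R * (p ^+ 3 * (3 * (a%:R * p ^+ 2 + 6)))) <= y ^+ 2 ->
  cfsq p (fun G => t * (triangles G)%:R) <=
  expR (- (m%:R * (p * t ^+ 2 / 16 * ('C(a, 2)%:R * M ^+ 2) / 2 - (4 * y + 2 * y ^+ 2)))) +
  n%:R ^+ 2 * expR (2 * (n%:R * p ^+ 2) - pi / t).
Proof.
move=> M1 t0 y0; set c := p * t ^+ 2 / 16; set rho := 4 * y + _ => cM vy.
have c0 : 0 <= c by rewrite divr_ge0// mulr_ge0// sqr_ge0.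
have rho0 : 0 <= rho by rewrite addr_ge0// mulr_ge0// sqr_ge0.
pose K i H := expR (- (c * \sum_(e in edges_in (A i)) codeg R W e H ^+ 2)).
have K0 i H : 0 <= K i H by exact: expR_ge0.
(* At least 1 as soon as t * [out_codeg e H] exceeds pi. *)
pose bad (e : edge n) H := expR (codeg R (~: val e) e H - pi / t).
apply: (le_trans (cfsq_blocks t)).
apply: (@le_trans _ _ (Ex p (fun H => \prod_i (K i H + rho) + \sum_e bad e H))).
  apply: le_Ex => // H.
  have [/forallP good|/forallPn[e]] := boolP [forall e : edge n, (e \in Q) ==> (t * out_codeg e H <= pi)].
    rewrite -[leLHS]addr0; apply: lerD; last by apply: sumr_ge0 => e _; exact: expR_ge0.
    apply: ler_prod => i _; rewrite cfsq_ge0/=; apply: cfsq_block_le => // e ei.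
    rewrite ger0_norm; first by apply: (implyP (good e)); exact: inQ ei.
    by rewrite mulr_ge0 ?(ltW t0)// (le_trans _ (codeg_le_out H ei))// codeg_ge0.
  rewrite negb_imply -ltNge => /andP[_ te].
  rewrite -[leLHS]add0r; apply: lerD; first by apply: prodr_ge0 => i _; rewrite addr_ge0.
  apply: (@le_trans _ _ 1); first by apply: prodr_ile1 => i _; rewrite cfsq_ge0 cfsq_le1.
  rewrite (bigD1 e)//=; apply: (@le_trans _ _ (bad e H)).
    rewrite /bad -expR0 ler_expR subr_ge0 ler_pdivrMr// mulrC (le_trans (ltW te))//.
    by rewrite ler_wpM2l ?(ltW t0)// out_le_codeg.
  by rewrite lerDl; apply: sumr_ge0 => e' _; exact: expR_ge0.
rewrite ExD; apply: lerD.
  rewrite (Ex_prod p touch_disj); last first.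
    move=> i G G' GG'; congr (expR (- (_ * _)) + _); apply: eq_bigr => e; rewrite inE => ei.
    by rewrite (codeg_touch ei GG').
  rewrite -mulrN expRM_natl -[X in _ ^+ X]card_ord -prodr_const; apply: ler_prod => i _.
  rewrite Ex_ge0//=; last by move=> G; rewrite addr_ge0.
  rewrite ExD Ex_cst; apply: le_trans (expR_ge1Dx _).
  by have := Ex_block_exp i M1 c0 cM; rewrite -/(K i _); lra.
rewrite Ex_sum; apply: (@le_trans _ _ (\sum_(e : edge n) expR (2 * (n%:R * p ^+ 2) - pi / t))).
  apply: ler_sum => e _; rewrite /bad.
  rewrite (eq_Ex p (g := fun H => expR (- (pi / t)) * expR (1 * codeg R (~: val e) e H))); last first.
    by move=> H; rewrite -expRD; congr expR; ring.
  rewrite ExZ expRD mulrC ler_wpM2r ?expR_ge0//.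
  apply: (le_trans (Ex_expR_codeg_le p01 _ _)); first by move=> w; rewrite inE.
  rewrite ler_expR.
  have e1 : expR (1 : R) - 1 <= 2.
    by have := @expR_le_quad R 1; rewrite normr1 => /(_ (lexx _)); lra.
  have cn : #|~: val e|%:R <= n%:R :> R by rewrite ler_nat -[leqRHS]card_ord max_card.
  have cn2 : #|~: val e|%:R * p ^+ 2 <= n%:R * p ^+ 2 by rewrite ler_wpM2r ?sqr_ge0.
  have c0' : 0 <= #|~: val e|%:R * p ^+ 2 by rewrite mulr_ge0 ?sqr_ge0.
  apply: (@le_trans _ _ (#|~: val e|%:R * p ^+ 2 * 2)); first by rewrite ler_wpM2l.
  by rewrite [leRHS]mulrC ler_wpM2r.
rewrite sumr_const -[leLHS]mulr_natl ler_wpM2r ?expR_ge0// -natrX ler_nat.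
have -> : #|{: edge n}| = 'C(n, 2).
  transitivity #|edges_in [set: 'I_n]|; first by apply: eq_card => e; rewrite !inE subsetT.
  by rewrite card_edges_in cardsT card_ord.
by rewrite bin2 -divn2 (leq_trans (leq_div _ _))// -mulnn leq_mul// leq_pred.
Qed.

End blocks.

Section interval_blocks.
Import mathcomp.boot.fintype mathcomp.boot.finset.

Lemma cfsq_triangles_interval_blocks (R : realType) (n : nat) (p : R) (a m : nat) (t y : R) :
  0 <= p <= 1 -> p <= 1 / 2 -> (m * a <= n)%N ->
  let M := (n - m * a)%:R * p ^+ 2 in
  1 <= M -> 0 < t -> 0 <= y ->
  p * t ^+ 2 / 16 * ('C(a, 2)%:R * M ^+ 2) <= 1 / 216 ->
  t ^+ 2 * ('C(a, 3)%:R * (p ^+ 3 * (3 * (a%:R * p ^+ 2 + 6)))) <= y ^+ 2 ->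
  cfsq p (fun G : {set edge n} => t * (triangles G)%:R) <=
  expR (- (m%:R * (p * t ^+ 2 / 16 * ('C(a, 2)%:R * M ^+ 2) / 2 - (4 * y + 2 * y ^+ 2)))) +
  n%:R ^+ 2 * expR (2 * (n%:R * p ^+ 2) - pi / t).
Proof.
move=> p01 p2 man.
pose A (i : 'I_m) := [set x : 'I_n | (i * a <= x < i.+1 * a)%N].
pose W := ~: [set x : 'I_n | (x < m * a)%N].
have cW : #|W| = (n - m * a)%N by rewrite cardsCs setCK card_ord card_initial.
rewrite -cW => M; apply: (@cfsq_triangles_blocks R n p p01 m A W) => //.
- move=> i j ij; apply/setP => x; rewrite !inE; apply/negP.
  case/andP => /andP[ix xi] /andP[jx xj].
  case: (ltngtP i j) => [lt|lt|/val_inj e]; last by rewrite e eqxx in ij.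
    by have := leq_trans xi (leq_trans (leq_mul lt (leqnn a)) jx); rewrite ltnn.
  by have := leq_trans xj (leq_trans (leq_mul lt (leqnn a)) ix); rewrite ltnn.
- move=> i; apply/setP => x; rewrite !inE -leqNgt; apply/negP => /andP[/andP[_ xi] mx].
  by have := leq_trans xi (leq_trans (leq_mul (ltn_ord i) (leqnn a)) mx); rewrite ltnn.
- move=> i.
  have lt (j : 'I_a) : (i * a + j < n)%N.
    apply: leq_trans man; apply: leq_trans (leq_mul (ltn_ord i) (leqnn a)).
    by rewrite mulSn addnC ltn_add2r.
  have inj : injective (fun j : 'I_a => Ordinal (lt j)).
    by move=> j j' /(congr1 val)/= /addnI/val_inj.
  rewrite -[RHS]card_ord -(card_imset _ inj); apply: eq_card => x; rewrite inE.
  apply/andP/imsetP => [[ix xi]|[j _ ->]]; last first.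
    by split; rewrite /= ?leq_addr// mulSn addnC ltn_add2r.
  have xa : (x - i * a < a)%N by rewrite ltn_subLR// addnC -mulSn.
  by exists (Ordinal xa) => //; apply: val_inj; rewrite /= subnKC.
Qed.

End interval_blocks.

(** * Gaussian integrals *)

Section gaussian_integrals.
Context {R : realType}.
Implicit Types (f : R -> R) (a x y t A : R).

Let mu := @lebesgue_measure R.

Lemma continuous_integrable_itv f a b : continuous f ->
  mu.-integrable `[a, b]%classic (EFin \o f).
Proof.
move=> cf; apply: continuous_compact_integrable; first exact: segment_compact.
exact: continuous_subspaceT.
Qed.

(* Antiderivative of f vanishing at 0, defined to the right of a < 0. *)
Definition prim a f x : R :=
  (\int[mu]_(t in `[a, x]) f t - \int[mu]_(t in `[a, 0%R]) f t)%R.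

Lemma prim0 a f : prim a f 0 = 0.
Proof. exact: subrr. Qed.

Lemma is_derive_prim a f x : continuous f -> a < x -> is_derive x 1 (prim a f) (f x).
Proof.
move=> cf ax.
have xu : x < x + 1 by rewrite ltrDl.
have [d dE] := @continuous_FTC1_closed R f a x (x + 1) xu (continuous_integrable_itv a (x + 1) cf) ax (cf x).
have h : is_derive x 1 (fun z => \int[mu]_(t in `[a, z]) f t)%R (f x).
  by apply: (DeriveDef d); rewrite -derive1E; exact: dE.
rewrite /prim; apply: is_derive_eq; rewrite subr0//.
Qed.

Definition gauss2 t : R := expR (- (t ^+ 2 / 2)).

Lemma gauss2_gt0 t : 0 < gauss2 t. Proof. exact: expR_gt0. Qed.

Lemma gauss2_le1 t : gauss2 t <= 1.
Proof. by rewrite /gauss2 -expR0 ler_expR lerNl oppr0 divr_ge0// sqr_ge0. Qed.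

Lemma is_derive_gauss2 t : is_derive t 1 gauss2 (- t * gauss2 t).
Proof. by rewrite /gauss2; apply: is_derive_eq; rewrite /GRing.scale/=; field. Qed.

Lemma continuous_derivable f : (forall x, derivable f x 1) -> continuous f.
Proof. by move=> h x; apply: differentiable_continuous; apply/derivable1_diffP. Qed.

Lemma continuous_gauss2_cos y : continuous (fun t => gauss2 t * cos (t * y)).
Proof.
apply: continuous_derivable => t; have := is_derive_gauss2 t => ?.
exact: ex_derive.
Qed.

(* \int_0^A exp(-t^2/2) cos(t y) dt *)
Definition gcos y A : R := prim (-1) (fun t => gauss2 t * cos (t * y)) A.

Lemma is_derive_gcos y A : -1 < A -> is_derive A 1 (gcos y) (gauss2 A * cos (A * y)).
Proof. by move=> A0; apply: is_derive_prim => //; exact: continuous_gauss2_cos. Qed.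

Lemma gcos0 y : gcos y 0 = 0. Proof. exact: prim0. Qed.

Lemma gcosN y A : gcos (- y) A = gcos y A.
Proof. by rewrite /gcos; congr prim; apply/funext => t; rewrite mulrN cosN. Qed.

Let gint (x : R) := gauss_integral_proof.integral0_gauss x.

Let gint_prim x : 0 <= x -> gint x = prim (-1) gauss_fun x.
Proof.
move=> x0; rewrite /gint /gauss_integral_proof.integral0_gauss /prim.
have int a b := @continuous_integrable_itv gauss_fun a b continuous_gauss_fun.
rewrite Rintegral_itvB ?Rintegral_itv_obnd_cbnd ?bnd_simp//.
by apply: integrableS (int 0 x) => //; exact: subset_itv_oc_cc.
Qed.

Let gint_ge0 x : 0 <= gint x.
Proof. exact: gauss_integral_proof.integral0_gauss_ge0. Qed.

Let is_derive_gprim x : 0 <= x -> is_derive x 1 (prim (-1) gauss_fun) (gauss_fun x).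
Proof.
move=> x0; apply: is_derive_prim; first exact: continuous_gauss_fun.
by rewrite (lt_le_trans _ x0)// ltrN10.
Qed.

Let gint_incr x y : 0 <= x -> x <= y -> gint x <= gint y.
Proof.
move=> x0 xy; rewrite !gint_prim ?(le_trans x0)//.
have := @le_increment R (fun=> 0) (prim (-1) gauss_fun) (fun=> 0) gauss_fun x y xy.
rewrite subrr subr_ge0; apply => z /andP[xz zy].
- by apply: is_derive_gprim; exact: le_trans xz.
- exact: gauss_fun_ge0.
Qed.

(** For z >= 1/2 the integrand exp(-z^2) is at most 2 z exp(-z^2), an exact derivative. *)
Let gint_tail x y : 1 / 2 <= x -> x <= y -> gint y <= gint x + gauss_fun x.
Proof.
move=> x0 xy; rewrite !gint_prim; [|lra..].
have := @le_increment R (prim (-1) gauss_fun) (fun z => - gauss_fun z) gauss_fun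
  (fun z => 2 * z * gauss_fun z) x y xy.
have := gauss_fun_ge0 y; move=> ? h; suff : prim (- 1) gauss_fun y - prim (- 1) gauss_fun x <= - gauss_fun y - - gauss_fun x by lra.
apply: h => z /andP[xz zy].
- by apply: is_derive_gprim; lra.
- by rewrite /gauss_fun; apply: is_derive_eq; rewrite /GRing.scale/=; ring.
- by have := gauss_fun_ge0 z; nra.
Qed.

Let gint_lim x : 1 / 2 <= x -> `|gint x - Num.sqrt pi / 2| <= gauss_fun x.
Proof.
move=> x0.
have sq : (Num.sqrt pi / 2) ^+ 2 = pi / 4 :> R.
  by rewrite exprMn sqr_sqrtr ?pi_ge0// exprVn; congr (_ / _); ring.
have s0 : 0 <= Num.sqrt pi / 2 :> R by rewrite divr_ge0// sqrtr_ge0.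
have x00 : 0 <= x by lra.
have gx0 := gint_ge0 x.
(* This limit concerns the square of the integral, so nonnegative quantities are compared through
   their squares. *)
have lim := @gauss_integral_proof.cvg_integral0_gauss_sqr R.
rewrite ler_norml; apply/andP; split; last first.
  rewrite lerBlDr (le_trans (_ : _ <= Num.sqrt pi / 2)) ?lerDr ?gauss_fun_ge0//.
  rewrite -ler_sqr ?nnegrE// sq; apply: cvgr_to_ge lim _.
  near=> z; rewrite ler_sqr ?nnegrE; [|exact: gint_ge0..].
  apply: gint_incr => //; near: z; exact: nbhs_pinfty_ge.
rewrite lerBrDl lerBlDr -ler_sqr ?nnegrE//; last by rewrite addr_ge0 ?gauss_fun_ge0.
rewrite sq; apply: cvgr_to_le lim _.
near=> z; rewrite ler_sqr ?nnegrE; [|exact: gint_ge0|by rewrite addr_ge0 ?gauss_fun_ge0].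
apply: gint_tail => //; near: z; exact: nbhs_pinfty_ge.
Unshelve. all: by end_near. Qed.

(** The substitution t = sqrt(2) s reduces to the integral of exp(-s^2); A >= 1 ensures A / sqrt(2)
    >= 1/2, the range of the tail bound. *)
Lemma gcos_zero_lim A : 1 <= A -> `|gcos 0 A - Num.sqrt (2 * pi) / 2| <= 2 * gauss2 A.
Proof.
move=> A1; set r := Num.sqrt (2 : R).
have r0 : 0 < r by rewrite sqrtr_gt0.
have r2 : r ^+ 2 = 2 by rewrite sqr_sqrtr.
have r12 : 1 <= r <= 2 by apply/andP; split; nra.
have Ar : 1 / 2 <= A / r by rewrite ler_pdivlMr//; nra.
have A0 : 0 <= A by lra.
have gE z : gauss_fun (z / r) = gauss2 z.
  by rewrite /gauss_fun /gauss2 exprMn exprVn r2.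
have -> : gcos 0 A = r * gint (A / r).
  have Ar0 : 0 <= A / r by lra.
  rewrite gint_prim//.
  have := @eq_increment R (gcos 0) (fun z => r * prim (-1) gauss_fun (z / r)) gauss2 0 A A0.
  rewrite gcos0 mul0r prim0 mulr0 !subr0; apply => z /andP[z0 zA].
    have := @is_derive_gcos 0 z; rewrite mulr0 cos0 mulr1; apply; lra.
  have zr : 0 <= z / r by rewrite divr_ge0// ltW.
  have d1 : is_derive z 1 (fun z => z / r) r^-1.
    by apply: is_derive_eq; rewrite /GRing.scale/=; ring.
  have := @is_derive1_comp R _ _ z _ _ (is_derive_gprim zr) d1 => d2.
  have -> : gauss2 z = r *: (gauss_fun (z / r) * r^-1).
    by rewrite gE /GRing.scale/=; field; rewrite gt_eqF.
  exact: is_deriveZ.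
have -> : Num.sqrt (2 * pi) / 2 = r * (Num.sqrt pi / 2) by rewrite sqrtrM// mulrA.
rewrite -mulrBr normrM (ger0_norm (ltW r0)) -gE; apply: ler_pM => //.
- exact: ltW.
- by case/andP: r12.
- exact: gint_lim.
Qed.

(* In y, A |-> gcos y A solves D' = - y D + exp(-A^2/2) sin (A y) (integrate by parts in t). *)
Let gcos_quadratic A y d : 0 <= A ->
  `|gcos (y + d) A - gcos y A - d * (gauss2 A * sin (A * y) - y * gcos y A)| <=
  A ^+ 2 * d ^+ 2 / 2 * A.
Proof.
move=> A0.
pose F t := gcos (y + d) t - gcos y t - d * (gauss2 t * sin (t * y) - y * gcos y t).
pose dF t := gauss2 t * (cos (t * (y + d)) - cos (t * y) + d * t * sin (t * y)).
have F0 : F 0 = 0 by rewrite /F !gcos0 mul0r sin0 !mulr0 !subrr mulr0 subr0.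
have := @norm_increment R F (fun t => A ^+ 2 * d ^+ 2 / 2 * t) dF (fun=> A ^+ 2 * d ^+ 2 / 2) 0 A A0.
rewrite F0 mulr0 !subr0; apply => t /andP[t0 tA].
- have t1 : -1 < t by rewrite (lt_le_trans _ t0)// ltrN10.
  have := is_derive_gcos (y + d) t1 => ?; have := is_derive_gcos y t1 => ?.
  have := is_derive_gauss2 t => ?.
  by rewrite /F /dF; apply: is_derive_eq; rewrite /GRing.scale/=; ring.
- by apply: is_derive_eq; rewrite /GRing.scale/=; ring.
rewrite /dF normrM (ger0_norm (ltW (gauss2_gt0 t))) -[leRHS]mul1r; apply: ler_pM => //.
- exact: ltW (gauss2_gt0 t).
- exact: gauss2_le1.
(* The second-order expansion of the cosine is that of the sine shifted by pi / 2. *)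
have := norm_sinD_sub2 (t * y + pi / 2) (t * d).
rewrite (_ : t * y + pi / 2 + t * d = (t * y + t * d) + pi / 2); last by ring.
rewrite !sinDpihalf cosDpihalf mulrDr mulrN opprK [t * d * _](_ : _ = d * t * sin (t * y)); last by ring.
move=> h; apply: (le_trans h); rewrite ler_wpM2r// exprMn ler_wpM2r ?sqr_ge0//.
by rewrite ler_sqr ?nnegrE.
Qed.

Let is_derive_gcos_y A y : 0 <= A ->
  is_derive y 1 (fun z => gcos z A) (gauss2 A * sin (A * y) - y * gcos y A).
Proof.
move=> A0; set l := _ - _.
pose q (h : R) : R := h^-1 *: (((fun z => gcos z A) \o shift y) (h *: (1 : R)) - gcos y A).
have lim : (q @ 0^' --> l)%classic.
  apply/cvgrPdist_le => e e0.
  pose C := A ^+ 2 / 2 * A + 1.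
  have C0 : 0 < C by rewrite ltr_wpDl// mulr_ge0// divr_ge0// sqr_ge0.
  near=> h.
  have h0 : h != 0 by near: h; exact: nbhs_dnbhs_neq.
  have he : `|h| <= e / C.
    near: h; apply: dnbhs0_le; exact: divr_gt0.
  rewrite /q /= -normrN opprB [_%:A]mulr1.
  have := gcos_quadratic y h A0; rewrite -/l => qh.
  have -> : l = h^-1 *: (h * l) by rewrite /GRing.scale/= mulKf.
  rewrite -scalerBr [h + y]addrC normrZ normfV ler_pdivrMl ?normr_gt0//.
  apply: (le_trans qh).
  rewrite -(real_normK (num_real h)).
  have hn : 0 < `|h| by rewrite normr_gt0.
  rewrite ler_pdivlMr// in he.
  apply: (@le_trans _ _ (`|h| * (`|h| * C))); last by rewrite ler_wpM2l// ltW.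
  by rewrite /C; nra.
apply: DeriveDef; first by apply/cvg_ex; exists l.
by apply/cvg_lim => //.
Unshelve. all: by end_near. Qed.

(** The integrating factor exp(z^2 / 2) reduces the equation of z -> [gcos z A] to its source term,
    which is at most [gauss2 A] times that factor. *)
Lemma gcos_gauss A y : 0 <= A -> `|gcos y A - gcos 0 A * gauss2 y| <= `|y| * gauss2 A.
Proof.
move=> A0.
wlog y0 : y / 0 <= y.
  move=> h; have [|y0] := leP 0 y; first exact: h.
  have := h (- y); rewrite oppr_ge0 gcosN normrN /gauss2 sqrrN; apply; exact: ltW.
rewrite (ger0_norm y0).
pose F z := gcos z A * expR (z ^+ 2 / 2).
pose dF z := gauss2 A * sin (A * z) * expR (z ^+ 2 / 2).
have := @norm_increment R F (fun z => gauss2 A * expR (y ^+ 2 / 2) * z) dF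
  (fun=> gauss2 A * expR (y ^+ 2 / 2)) 0 y y0.
rewrite mulr0 subr0 => h.
have {h} : `|F y - F 0| <= gauss2 A * expR (y ^+ 2 / 2) * y.
  apply: h => z /andP[z0 zy].
  - have := is_derive_gcos_y z A0 => ?.
    by rewrite /F /dF; apply: is_derive_eq; rewrite /GRing.scale/=; field.
  - by apply: is_derive_eq; rewrite /GRing.scale/=; ring.
  rewrite /dF !normrM (ger0_norm (ltW (gauss2_gt0 A))) (ger0_norm (expR_ge0 _)).
  apply: ler_pM => //; first by rewrite mulr_ge0// ltW// gauss2_gt0.
    by rewrite -[leRHS]mulr1 ler_wpM2l ?sin_max// ltW// gauss2_gt0.
  by rewrite ler_expR ler_wpM2r// ler_sqr ?nnegrE.
rewrite /F expr0n/= mul0r expR0 mulr1.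
have gy : gauss2 y = (expR (y ^+ 2 / 2))^-1 by rewrite /gauss2 expRN.
rewrite gy; move: (expR (y ^+ 2 / 2)) (expR_gt0 (y ^+ 2 / 2)) => e e0 h.
have -> : gcos y A - gcos 0 A / e = (gcos y A * e - gcos 0 A) / e by field; rewrite gt_eqF.
rewrite normrM (ger0_norm (_ : 0 <= e^-1)) ?invr_ge0 ?(ltW e0)// ler_pdivrMr//.
by apply: (le_trans h); rewrite le_eqVlt; apply/orP; left; apply/eqP; ring.
Qed.

Lemma gcos_approx A y : 1 <= A ->
  `|gcos y A - Num.sqrt (2 * pi) / 2 * gauss2 y| <= (`|y| + 2) * gauss2 A.
Proof.
move=> A1; have A0 : 0 <= A by lra.
apply: (le_trans (ler_distD (gcos 0 A * gauss2 y) _ _)).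
rewrite [leRHS]mulrDl; apply: lerD; first exact: gcos_gauss.
rewrite -mulrBl normrM (ger0_norm (ltW (gauss2_gt0 y))) -[leRHS]mulr1.
apply: ler_pM => //; [exact: ltW (gauss2_gt0 y)|exact: gcos_zero_lim|exact: gauss2_le1].
Qed.

End gaussian_integrals.

(** * From characteristic functions to the local limit *)

Section local_limit.
Import mathcomp.boot.fintype mathcomp.boot.finset.
Context (R : realType) (E : finType) (p : R).
Hypothesis p01 : 0 <= p <= 1.
Context (X : {set E} -> nat) (mu sigma A d1 d2 : R).
Hypothesis sigma0 : 0 < sigma.
Hypothesis A1 : 1 <= A.
Hypothesis d10 : 0 <= d1.
Hypothesis d20 : 0 <= d2.
Hypothesis Asigma : A / sigma <= pi.
Hypothesis small_t : forall th t : R, 0 <= t <= A / sigma ->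
  `|Ex p (fun G => cos (th + t * ((X G)%:R - mu))) - cos th * expR (- (sigma ^+ 2 * t ^+ 2 / 2))| <= d1.
Hypothesis large_t : forall th t : R, A / sigma <= t <= pi ->
  `|Ex p (fun G => cos (th + t * (X G)%:R))| <= d2.

Let px (x : nat) : R := Ex p (fun G => (X G == x)%:R).

Definition gauss_pdf (x : R) : R :=
  1 / Num.sqrt (2 * pi * sigma ^+ 2) * expR (- ((x - mu) ^+ 2 / (2 * sigma ^+ 2))).

Let z (x : R) : R := (x - mu) / sigma.

Let r2pi : R := Num.sqrt (2 * pi).

Let r2pi_ge2 : 2 <= r2pi.
Proof.
have : Num.sqrt (2 ^+ 2) <= r2pi by rewrite ler_wsqrtr//; have := pi_ge2 R; lra.
by rewrite sqrtr_sqr ger0_norm.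
Qed.

Lemma gauss_pdfE (x : R) : gauss_pdf x = gauss2 (z x) / (r2pi * sigma).
Proof.
rewrite /gauss_pdf sqrtrM ?mulr_ge0 ?pi_ge0// sqrtr_sqr (ger0_norm (ltW sigma0)) -/r2pi.
rewrite mulrC div1r; congr (expR (- _) / _).
by rewrite /z; field; rewrite gt_eqF.
Qed.

Lemma gauss_pdf_ge0 x : 0 <= gauss_pdf x.
Proof. by rewrite /gauss_pdf mulr_ge0 ?expR_ge0// divr_ge0// sqrtr_ge0. Qed.

Lemma px_ge0 x : 0 <= px x.
Proof. by apply: Ex_ge0. Qed.

Lemma sin_pi_natmul (k : nat) : sin (k%:R * pi : R) = 0.
Proof.
elim: k => [|k IH]; first by rewrite mul0r sin0.
by rewrite -natr1 mulrDl mul1r sinDpi IH oppr0.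
Qed.

(* Fourier inversion: Phi' t = E cos (t (X - x)) and Phi pi = pi P(X = x). *)
Let phi1 (x : nat) (k : nat) (t : R) : R :=
  if k == x then t else sin (t * (k%:R - x%:R)) / (k%:R - x%:R).

Let is_derive_phi1 (x k : nat) (t : R) : is_derive t 1 (phi1 x k) (cos (t * (k%:R - x%:R))).
Proof.
rewrite /phi1; have [->|kx] := eqVneq k x.
  by rewrite subrr mulr0 cos0; exact: is_derive_id.
have kx0 : k%:R - x%:R != 0 :> R by rewrite subr_eq0 eqr_nat.
by apply: is_derive_eq; rewrite /GRing.scale/=; field.
Qed.

Let phi1_pi (x k : nat) : phi1 x k pi = pi * (k == x)%:R.
Proof.
rewrite /phi1; case: eqVneq => [_|kx]; first by rewrite mulr1.
suff -> : sin (pi * (k%:R - x%:R) : R) = 0 by rewrite mul0r mulr0.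
case: (leqP x k) => xk; first by rewrite -natrB// mulrC sin_pi_natmul.
by rewrite -opprB -natrB ?(ltnW xk)// mulrN sinN mulrC sin_pi_natmul oppr0.
Qed.

Let Phi (x : nat) (t : R) := Ex p (fun G => phi1 x (X G) t).

Let is_derive_Phi (x : nat) (t : R) : is_derive t 1 (Phi x) (Ex p (fun G => cos (t * ((X G)%:R - x%:R)))).
Proof.
rewrite /Phi /Ex.
have -> : (fun t => \sum_G pmass p G * phi1 x (X G) t) =
    \sum_(i < #|{set E}|) (fun t => pmass p (enum_val i) * phi1 x (X (enum_val i)) t).
  apply/funext => u; rewrite fct_sumE (reindex (@enum_val _ {set E}))//=.
  exact: (onW_bij _ (@enum_val_bij _)).
have -> : \sum_G pmass p G * cos (t * ((X G)%:R - x%:R)) = \sum_(i < #|{set E}|)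
    (pmass p (enum_val i) * cos (t * ((X (enum_val i))%:R - x%:R))).
  rewrite (reindex (@enum_val _ {set E}))//=.
  exact: (onW_bij _ (@enum_val_bij _)).
apply: is_derive_sum => i; have := is_derive_phi1 x (X (enum_val i)) t => ?.
by apply: is_derive_eq; rewrite /GRing.scale/=; ring.
Qed.

Let Phi0 (x : nat) : Phi x 0 = 0.
Proof.
rewrite /Phi -[RHS](Ex_cst E p); apply: eq_Ex => G; rewrite /phi1.
by case: eqVneq; rewrite // mul0r sin0 mul0r.
Qed.

Let Phi_pi (x : nat) : Phi x pi = pi * px x.
Proof. by rewrite /Phi /px -ExZ; apply: eq_Ex => G; exact: phi1_pi. Qed.

(** The integral [Phi x pi] = pi P(X = x) is cut at T = A / sigma. Beyond T its slope is at most d2;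
    before T it follows a rescaled [gcos] up to d1 T; and [gcos] at A is close to the full Gaussian
    integral, which is pi times the density. *)
Lemma local_limit_pointwise (x : nat) : `|gauss_pdf x%:R - px x| <=
  A * d1 / sigma + d2 + (`|z x%:R| + 2) * gauss2 A / sigma.
Proof.
set y := z x%:R; set T := A / sigma.
have T0 : 0 <= T by apply: divr_ge0; [exact: le_trans ler01 A1|exact: ltW].
have pi1 : (1 : R) <= pi by have := pi_ge2 R; lra.
have far : `|Phi x pi - Phi x T| <= d2 * pi - d2 * T.
  have h := @norm_increment R (Phi x) (fun t => d2 * t)
    (fun t => Ex p (fun G => cos (t * ((X G)%:R - x%:R)))) (fun=> d2) T pi Asigma.
  apply: h => t tT.
  - exact: is_derive_Phi.
  - by apply: is_derive_eq; rewrite /GRing.scale/=; ring.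
  rewrite (eq_Ex p (g := fun G => cos (- t * x%:R + t * (X G)%:R))); last first.
    by move=> G; congr cos; ring.
  exact: large_t.
pose Gam (t : R) := gcos y (sigma * t) / sigma.
have near : `|Phi x T - Gam T| <= d1 * T.
  have := @norm_increment R (fun t => Phi x t - Gam t) (fun t => d1 * t)
    (fun t => Ex p (fun G => cos (t * ((X G)%:R - x%:R))) - gauss2 (sigma * t) * cos (sigma * t * y))
    (fun=> d1) 0 T T0.
  rewrite Phi0 /Gam !mulr0 gcos0 mul0r !subr0; apply => t /andP[t0 tT].
  - have st1 : -1 < sigma * t by rewrite (lt_le_trans (ltrN10 R))// mulr_ge0// ltW.
    have d : is_derive t 1 (fun t => sigma * t) sigma.
      by apply: is_derive_eq; rewrite /GRing.scale/=; ring.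
    have c : is_derive t 1 (fun u => gcos y (sigma * u)) (gauss2 (sigma * t) * cos (sigma * t * y) * sigma).
      exact: (@is_derive1_comp R _ _ t _ _ (is_derive_gcos y st1) d).
    have ph := is_derive_Phi x t.
    by apply: is_derive_eq; rewrite /GRing.scale/=; field; rewrite gt_eqF.
  - by apply: is_derive_eq; rewrite /GRing.scale/=; ring.
  (* Recentring at x costs the phase t (mu - x), which varies with t; this is why the hypotheses
     range over all phases. *)
  have := small_t (t * (mu - x%:R)) (t := t); rewrite t0 tT => /(_ isT).
  rewrite (eq_Ex p (g := fun G => cos (t * ((X G)%:R - x%:R)))); last by move=> G; congr cos; ring.
  rewrite [cos _ * _]mulrC.
  have -> : gauss2 (sigma * t) = expR (- (sigma ^+ 2 * t ^+ 2 / 2)) by rewrite /gauss2 exprMn.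
  have -> : cos (sigma * t * y) = cos (t * (mu - x%:R)).
    by rewrite -cosN; congr cos; rewrite /y /z; field; rewrite gt_eqF.
  by [].
have st : sigma * T = A by rewrite /T; field; rewrite gt_eqF.
have g : `|Gam T - r2pi / 2 * gauss2 y / sigma| <= (`|y| + 2) * gauss2 A / sigma.
  rewrite /Gam st -mulrBl normrM (ger0_norm (_ : 0 <= sigma^-1)) ?invr_ge0 ?(ltW sigma0)//.
  by rewrite ler_pM2r ?invr_gt0//; exact: gcos_approx.
have pg : pi * gauss_pdf x%:R = r2pi / 2 * gauss2 y / sigma.
  have rr : r2pi ^+ 2 = 2 * pi by rewrite sqr_sqrtr// mulr_ge0// pi_ge0.
  rewrite gauss_pdfE -/y (_ : pi = r2pi ^+ 2 / 2); last by rewrite rr; field.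
  have r0 : 0 < r2pi by apply: lt_le_trans r2pi_ge2.
  by field; rewrite !gt_eqF.
have tot : `|pi * gauss_pdf x%:R - pi * px x| <= d1 * T + d2 * pi + (`|y| + 2) * gauss2 A / sigma.
  rewrite pg -Phi_pi distrC.
  have -> : Phi x pi - r2pi / 2 * gauss2 y / sigma =
    (Phi x T - Gam T) + (Phi x pi - Phi x T) + (Gam T - r2pi / 2 * gauss2 y / sigma) by ring.
  apply: (le_trans (ler_normD _ _)); apply: lerD => //.
  apply: (le_trans (ler_normD _ _)); apply: lerD => //.
  by apply: (le_trans far); rewrite gerBl mulr_ge0.
rewrite -mulrBr normrM (ger0_norm (pi_ge0 R)) in tot.
have -> : A * d1 / sigma = d1 * T by rewrite /T; ring.
have b0 : 0 <= d1 * T by rewrite mulr_ge0.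
have c0 : 0 <= (`|y| + 2) * gauss2 A / sigma.
  by rewrite divr_ge0 ?(ltW sigma0)// mulr_ge0 ?addr_ge0// ltW ?gauss2_gt0.
move: tot b0 c0; move: `|_ - _| (d1 * T) (_ / sigma) => a b c tot b0 c0.
(* Division by pi removes the factor of d2 and only decreases the other two terms, as pi >= 1. *)
rewrite -(ler_pM2l (pi_gt0 R)); apply: (le_trans tot).
by nra.
Qed.

Hypothesis Amu : A * sigma <= mu.

(** The bulk is the set of integers in the half-open interval from mu - A sigma, excluded, to mu + A
    sigma, included; [k0] is its first element and [k1] its last. *)
Let k0 : nat := (Num.truncn (mu - A * sigma)).+1.
Let k1 : nat := Num.truncn (mu + A * sigma).

Let As0 : 0 <= A * sigma.
Proof. by apply: mulr_ge0; [exact: le_trans ler01 A1|exact: ltW]. Qed.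

Let k0_bounds : mu - A * sigma <= k0%:R <= mu - A * sigma + 1.
Proof.
have h : 0 <= mu - A * sigma by rewrite subr_ge0.
have /andP[a b] := truncn_itv h.
by rewrite (ltW b)/= /k0 -natr1 lerD2r.
Qed.

Let k1_bounds : k1%:R <= mu + A * sigma <= k1.+1%:R.
Proof.
have h : 0 <= mu + A * sigma by rewrite addr_ge0// (le_trans _ Amu).
by have /andP[a b] := truncn_itv h; rewrite a (ltW b).
Qed.

Let bulk_z (x : nat) : (k0 <= x < k1.+1)%N -> `|z x%:R| <= A.
Proof.
case/andP => x0 x1; rewrite /z normrM normfV (ger0_norm (ltW sigma0)) ler_pdivrMr//.
have : (k0%:R : R) <= x%:R by rewrite ler_nat.
have : (x%:R : R) <= k1%:R by rewrite ler_nat.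
by case/andP: k0_bounds; case/andP: k1_bounds => *; rewrite ler_norml; apply/andP; split; lra.
Qed.

Let tail_z (x : nat) : ~~ (k0 <= x < k1.+1)%N -> A ^+ 2 <= z x%:R ^+ 2.
Proof.
move=> xb; rewrite /z expr_div_n ler_pdivlMr ?exprn_gt0// -exprMn.
have as0 := As0; move: xb; rewrite negb_and -!ltnNge => /orP[xk|xk].
  have : x%:R + 1 <= k0%:R :> R by rewrite natr1 ler_nat.
  case/andP: k0_bounds => _ ? ?; rewrite -(sqrrN (_ - mu)) ler_sqr ?nnegrE//; lra.
have : k1.+1%:R <= x%:R :> R by rewrite ler_nat.
case/andP: k1_bounds => _ ? ?; rewrite ler_sqr ?nnegrE//; lra.
Qed.

Hypothesis sigma1 : 1 <= sigma.

Let mu0 : 0 <= mu. Proof. exact: le_trans As0 Amu. Qed.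

Lemma sum_inv_sqr_le2 (N : nat) : \sum_(0 <= x < N) (x.+1%:R ^+ 2)^-1 <= 2 :> R.
Proof.
case: N => [|N]; first by rewrite big_nil.
(* Strengthened by the term 1 / (N + 1) so that the induction closes. *)
suff : \sum_(0 <= x < N.+1) (x.+1%:R ^+ 2)^-1 <= 2 - N.+1%:R^-1 :> R.
  by move/le_trans; apply; rewrite gerBl invr_ge0.
elim: N => [|N IH]; first by rewrite big_nat1 expr1n invr1; lra.
rewrite big_nat_recr//=; apply: (le_trans (lerD IH (lexx _))).
have a0 : 0 < N.+1%:R :> R by rewrite ltr0n.
have -> : N.+2%:R = N.+1%:R + 1 :> R by rewrite -natr1.
move: (N.+1%:R : R) a0 => a a0.
have b0 : 0 < a + 1 by lra.
rewrite -subr_ge0 (_ : _ - _ = (a * (a + 1) ^+ 2)^-1).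
  by rewrite invr_ge0 mulr_ge0 ?exprn_ge0// ltW.
by field; rewrite !gt_eqF.
Qed.

(** Since x + 1 = sigma z + (mu + 1), the product of (x + 1)^2 and exp(-z^2 / 4) is bounded
    uniformly in x. *)
Lemma gauss_pdf_summable (x : nat) :
  expR (- (z x%:R ^+ 2 / 4)) <= (8 * sigma ^+ 2 + 2 * (mu + 1) ^+ 2) * (x.+1%:R ^+ 2)^-1.
Proof.
have x0 : 0 < x.+1%:R ^+ 2 :> R by rewrite exprn_gt0// ltr0n.
rewrite ler_pdivlMr//; set y := z x%:R.
have xE : x.+1%:R = sigma * y + (mu + 1).
  by rewrite /y /z -natr1; field; rewrite gt_eqF.
have e1 : expR (- (y ^+ 2 / 4)) <= 1 by rewrite -expR0 ler_expR lerNl oppr0 divr_ge0// sqr_ge0.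
have e2 : y ^+ 2 / 4 * expR (- (y ^+ 2 / 4)) <= 1.
  rewrite expRN ler_pdivrMr ?expR_gt0// mul1r (le_trans _ (expR_ge1Dx _))//; lra.
have e0 := expR_ge0 (- (y ^+ 2 / 4)).
rewrite xE; move: (expR _) e0 e1 e2 => e e0 e1 e2.
apply: (@le_trans _ _ (e * (2 * (sigma * y) ^+ 2 + 2 * (mu + 1) ^+ 2))).
  by rewrite ler_wpM2l//; have := sqr_ge0 (sigma * y - (mu + 1)); nra.
rewrite mulrDr; apply: lerD; last first.
  by rewrite -[leRHS]mul1r ler_wpM2r// mulr_ge0// sqr_ge0.
have -> : e * (2 * (sigma * y) ^+ 2) = 8 * sigma ^+ 2 * (y ^+ 2 / 4 * e) by field.
by rewrite -[leRHS]mulr1 ler_wpM2l// mulr_ge0// sqr_ge0.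
Qed.

Lemma gauss_pdf_le (x : R) : gauss_pdf x <= expR (- (z x ^+ 2 / 4)) * expR (- (z x ^+ 2 / 4)) / sigma.
Proof.
have r0 : 0 < r2pi by apply: lt_le_trans r2pi_ge2.
rewrite gauss_pdfE -expRD -opprD (_ : z x ^+ 2 / 4 + _ = z x ^+ 2 / 2); last by field.
rewrite -/(gauss2 _) ler_wpM2l ?(ltW (gauss2_gt0 _))// lef_pV2 ?posrE ?mulr_gt0//.
by rewrite ler_peMl ?(ltW sigma0)// (le_trans _ r2pi_ge2)//; lra.
Qed.

(** [gauss_pdf_le] splits exp(-z^2 / 2) into two equal factors: one is bounded by c, the other makes
    the sum converge. *)
Lemma sum_gauss_pdf_tail (N : nat) (P : pred nat) (c : R) : 0 <= c ->
  (forall x, P x -> expR (- (z x%:R ^+ 2 / 4)) <= c) ->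
  \sum_(0 <= x < N | P x) gauss_pdf x%:R <= c * (16 * sigma ^+ 2 + 4 * (mu + 1) ^+ 2) / sigma.
Proof.
move=> c0 Pc.
set K := 8 * sigma ^+ 2 + 2 * (mu + 1) ^+ 2.
have K0 : 0 <= K by rewrite addr_ge0// mulr_ge0// sqr_ge0.
apply: (@le_trans _ _ (\sum_(0 <= x < N) c * K / sigma * (x.+1%:R ^+ 2)^-1)).
  rewrite big_mkcond; apply: ler_sum => x _.
  have x0 : 0 <= (x.+1%:R ^+ 2)^-1 :> R by rewrite invr_ge0 sqr_ge0.
  case: ifP => Px; last by rewrite mulr_ge0// divr_ge0 ?(ltW sigma0)// mulr_ge0.
  apply: (le_trans (gauss_pdf_le _)).
  rewrite [leRHS](_ : _ = c * (K * (x.+1%:R ^+ 2)^-1) / sigma); last by rewrite -!mulrA; ring.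
  rewrite ler_pM2r ?invr_gt0//.
  by apply: ler_pM; rewrite ?expR_ge0 ?Pc ?gauss_pdf_summable.
rewrite -mulr_sumr; apply: (le_trans (ler_wpM2l _ (sum_inv_sqr_le2 N))).
  by rewrite divr_ge0 ?(ltW sigma0)// mulr_ge0.
by rewrite le_eqVlt; apply/orP; left; apply/eqP; rewrite /K; field; rewrite gt_eqF.
Qed.

Let gauss2_lip (u v : R) : u <= v -> gauss2 v - gauss2 u <= v - u.
Proof.
move=> uv; apply: (@le_increment R gauss2 id (fun t => - t * gauss2 t) (fun=> 1)) => // t _.
  exact: is_derive_gauss2.
have e : 1 + t ^+ 2 / 2 <= expR (t ^+ 2 / 2) by exact: expR_ge1Dx.
rewrite /gauss2 expRN ler_pdivrMr ?expR_gt0// mul1r.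
by apply: le_trans e; have := sqr_ge0 (t + 1); lra.
Qed.

(** The base point lies below -A, so that this primitive of [gauss2] is differentiable on the whole
    bulk. *)
Let G := prim (- (A + 2)) gauss2.

Let is_derive_G t : - A <= t -> is_derive t 1 G (gauss2 t).
Proof.
move=> At; apply: is_derive_prim; last by lra.
apply: continuous_derivable => u; have := is_derive_gauss2 u => ?; exact: ex_derive.
Qed.

Let G_total : G A - G (- A) = 2 * gcos 0 A.
Proof.
have A0 : 0 <= A by exact: le_trans ler01 A1.
have h1 : gcos 0 A - gcos 0 0 = G A - G 0.
  apply: (@eq_increment R (gcos 0) G gauss2) => // t /andP[t0 tA].
    have := @is_derive_gcos R 0 t; rewrite mulr0 cos0 mulr1; apply; lra.
  by apply: is_derive_G; lra.
have h2 : gcos 0 A - gcos 0 0 = - G (- A) - - G (- 0).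
  apply: (@eq_increment R (gcos 0) (fun t => - G (- t)) gauss2) => // t /andP[t0 tA].
    have := @is_derive_gcos R 0 t; rewrite mulr0 cos0 mulr1; apply; lra.
  have tA' : - A <= - t by lra.
  have d : is_derive t 1 (fun u : R => - u) (-1) by apply: is_derive_eq; rewrite /GRing.scale/=; ring.
  have c : is_derive t 1 (fun u => G (- u)) (gauss2 (- t) * -1).
    exact: (@is_derive1_comp R _ _ t _ _ (is_derive_G tA') d).
  have -> : gauss2 t = - (gauss2 (- t) * -1) by rewrite /gauss2 sqrrN; ring.
  exact: is_deriveN.
rewrite gcos0 subr0 in h1; rewrite oppr0 gcos0 subr0 in h2.
by rewrite mulr_natl mulr2n {1}h1 h2; ring.
Qed.

Let G_le (u v : R) : - A <= u -> u <= v -> G v - G u <= v - u.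
Proof.
move=> Au uv; apply: (@le_increment R G id gauss2 (fun=> 1)) => // t /andP[ut _].
  by apply: is_derive_G; lra.
exact: gauss2_le1.
Qed.

Let k01 : (k0 <= k1)%N.
Proof.
case/andP: k0_bounds => _ h; case/andP: k1_bounds => _ h'.
rewrite -ltnS -(ltr_nat R) (lt_le_trans _ h')// (le_lt_trans h)//.
have s1 := sigma1; have a1 := A1; nra.
Qed.

(** A Riemann sum with mesh 1 / sigma: each increment of [G] is at most (gauss2 + 1 / sigma) /
    sigma, over at most 2 A sigma cells, and each end of the bulk loses at most 1 / sigma. The total
    increment misses sqrt(2 pi) by at most 4 [gauss2 A]. *)
Lemma sum_gauss_pdf_bulk :
  1 - 4 * gauss2 A - (2 + 2 * A) / sigma <= \sum_(k0 <= x < k1.+1) gauss_pdf x%:R.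
Proof.
have r0 : 0 < r2pi by apply: lt_le_trans r2pi_ge2.
have A0 : 0 <= A by exact: le_trans ler01 A1.
have [b1 b2] := andP k0_bounds; have [b3 b4] := andP k1_bounds.
have sV : 0 < sigma^-1 by rewrite invr_gt0.
have zS (x : nat) : z x.+1%:R = z x%:R + sigma^-1.
  by rewrite /z -natr1; field; rewrite gt_eqF.
have z_ge (x : nat) : (k0 <= x)%N -> - A <= z x%:R.
  move=> kx; rewrite /z ler_pdivlMr//.
  have h : (k0%:R : R) <= x%:R by rewrite ler_nat.
  by lra.
have step (x : nat) : (k0 <= x)%N -> G (z x.+1%:R) - G (z x%:R) <=
    (gauss2 (z x%:R) + sigma^-1) / sigma.
  move=> kx; rewrite zS; set u := z x%:R; have uA : - A <= u := z_ge x kx.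
  have -> : (gauss2 u + sigma^-1) / sigma =
    (gauss2 u + sigma^-1) * (u + sigma^-1) - (gauss2 u + sigma^-1) * u by ring.
  apply: (@le_increment R G (fun t => (gauss2 u + sigma^-1) * t) gauss2 (fun=> gauss2 u + sigma^-1)).
  - by rewrite lerDl ltW.
  - by move=> t /andP[ut _]; apply: is_derive_G; exact: le_trans ut.
  - by move=> t _; apply: is_derive_eq; rewrite /GRing.scale/=; ring.
  by move=> t /andP[ut tu]; have := gauss2_lip ut; lra.
have tele : G (z k1%:R) - G (z k0%:R) <= \sum_(k0 <= x < k1) (gauss2 (z x%:R) + sigma^-1) / sigma.
  rewrite -(@telescope_sumr R k0 k1 (fun x => G (z x%:R)) k01).
  by rewrite big_nat [leRHS]big_nat; apply: ler_sum => x /andP[kx _]; exact: step.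
have top : G A - G (z k1%:R) <= sigma^-1.
  have zk : z k1%:R <= A by rewrite /z ler_pdivrMr// lerBlDl.
  apply: (le_trans (G_le (z_ge _ k01) zk)).
  have -> : A - z k1%:R = (mu + A * sigma - k1%:R) / sigma by rewrite /z; field; rewrite gt_eqF.
  rewrite ler_pdivrMr// mulVf ?gt_eqF//.
  by move: b4; rewrite -natr1; lra.
have bot : G (z k0%:R) - G (- A) <= sigma^-1.
  apply: (le_trans (G_le (lexx _) (z_ge _ (leqnn _)))).
  have -> : z k0%:R - - A = (k0%:R - (mu - A * sigma)) / sigma by rewrite /z; field; rewrite gt_eqF.
  by rewrite ler_pdivrMr// mulVf ?gt_eqF//; lra.
have low : r2pi - 4 * gauss2 A <= 2 * gcos 0 A.
  have := gcos_zero_lim A1; rewrite -/r2pi ler_norml => /andP[h _]; lra.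
have cnt : \sum_(k0 <= x < k1) (gauss2 (z x%:R) + sigma^-1) / sigma <=
    \sum_(k0 <= x < k1) gauss2 (z x%:R) / sigma + 2 * A / sigma.
  under eq_bigr do rewrite mulrDl.
  rewrite big_split/= lerD2l sumr_const_nat -[leLHS]mulr_natl natrB//.
  rewrite mulrA ler_pM2r//.
  rewrite ler_pdivrMr//; lra.
have fin : \sum_(k0 <= x < k1) gauss2 (z x%:R) / sigma <= r2pi * \sum_(k0 <= x < k1.+1) gauss_pdf x%:R.
  rewrite big_nat_recr//= mulrDr -[leLHS]addr0; apply: lerD; last by rewrite mulr_ge0 ?gauss_pdf_ge0// ltW.
  rewrite mulr_sumr; apply: ler_sum => x _; rewrite gauss_pdfE.
  by rewrite le_eqVlt; apply/orP; left; apply/eqP; field; rewrite !gt_eqF.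
have total : r2pi - (4 * gauss2 A + (2 + 2 * A) / sigma) <= r2pi * \sum_(k0 <= x < k1.+1) gauss_pdf x%:R.
  apply: le_trans fin; have e := G_total.
  have -> : (2 + 2 * A) / sigma = 2 * sigma^-1 + 2 * A / sigma by ring.
  by lra.
have c0 : 0 <= 4 * gauss2 A + (2 + 2 * A) / sigma.
  apply: addr_ge0; first by rewrite mulr_ge0// ltW ?gauss2_gt0.
  by apply: divr_ge0; [rewrite addr_ge0// mulr_ge0|exact: ltW].
have r1 : 1 <= r2pi by rewrite (le_trans _ r2pi_ge2)//; lra.
rewrite -(ler_pM2l r0); apply: le_trans total.
move: c0; move: (4 * _) (_ / sigma) => a b c0.
by nra.
Qed.

Lemma sum_Ex_eq_le1 (N : nat) : \sum_(0 <= x < N) px x <= 1.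
Proof.
rewrite /px -Ex_sum -[leRHS](Ex_cst E p); apply: le_Ex => // H.
case: (ltnP (X H) N) => XN.
  rewrite (bigD1_seq (X H)) ?mem_index_iota ?iota_uniq//= eqxx big1 ?addr0// => x.
  by rewrite eq_sym => /negPf ->.
rewrite big_nat big1// => x /andP[_ xN]; rewrite (_ : (_ == _) = false)//.
by apply/negP => /eqP e; rewrite e leqNgt xN in XN.
Qed.

(** The pointwise error over the bulk enters twice: directly, and again through the tail mass of X,
    bounded by one minus its bulk mass. *)
Lemma local_limit_sum (N : nat) :
  \sum_(0 <= x < N) `|gauss_pdf x%:R - px x| <=
  2 * (2 * A * sigma + 1) * (A * d1 / sigma + d2 + (A + 2) * gauss2 A / sigma) +
  (4 * gauss2 A + (2 + 2 * A) / sigma) +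
  expR (- (A ^+ 2 / 4)) * (16 * sigma ^+ 2 + 4 * (mu + 1) ^+ 2) / sigma.
Proof.
set e0 := A * d1 / sigma + d2 + _; set tl := expR _ * _ / sigma.
have A0 : 0 <= A by exact: le_trans ler01 A1.
have e00 : 0 <= e0.
  apply: addr_ge0; first apply: addr_ge0 => //.
    by apply: divr_ge0; [rewrite mulr_ge0|exact: ltW].
  by apply: divr_ge0; [rewrite mulr_ge0 ?addr_ge0// ltW ?gauss2_gt0|exact: ltW].
(* The summands are nonnegative, so N may be enlarged to cover the bulk. *)
wlog Nk : N / (k1.+1 <= N)%N.
  move=> h; apply: le_trans (h (maxn N k1.+1) (leq_maxr _ _)).
  rewrite [leRHS](@big_cat_nat _ _ _ N)/= ?leq_maxl//.
  by rewrite lerDl; apply: sumr_ge0.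
pose b (x : nat) := (k0 <= x < k1.+1)%N.
have bulkE (F : nat -> R) : \sum_(0 <= x < N | b x) F x = \sum_(k0 <= x < k1.+1) F x.
  rewrite [RHS](big_nat_widen _ _ _ _ _ Nk) (@big_nat_widenl _ _ _ k0 0)//=.
  by apply: eq_bigl => x; rewrite /b andbC.
have bulk : \sum_(0 <= x < N | b x) `|gauss_pdf x%:R - px x| <= (2 * A * sigma + 1) * e0.
  rewrite bulkE; apply: (@le_trans _ _ (\sum_(k0 <= x < k1.+1) e0)).
    rewrite big_nat [leRHS]big_nat; apply: ler_sum => x xb.
    apply: (le_trans (local_limit_pointwise x)); rewrite lerD2l.
    rewrite ler_pM2r ?invr_gt0// ler_pM2r ?gauss2_gt0// lerD2r; exact: bulk_z.
  rewrite sumr_const_nat -[leLHS]mulr_natl natrB; last exact: leqW k01.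
  rewrite ler_wpM2r// -natr1.
  have [b1 b2] := andP k0_bounds; have [b3 b4] := andP k1_bounds; lra.
have tailg : \sum_(0 <= x < N | ~~ b x) gauss_pdf x%:R <= tl.
  apply: sum_gauss_pdf_tail; first exact: expR_ge0.
  move=> x /tail_z xA; rewrite ler_expR lerN2 ler_wpM2r//.
have bulkp : \sum_(0 <= x < N | ~~ b x) px x <=
    (4 * gauss2 A + (2 + 2 * A) / sigma) + (2 * A * sigma + 1) * e0.
  have := sum_Ex_eq_le1 N; rewrite (bigID b)/=.
  have := sum_gauss_pdf_bulk; rewrite -bulkE.
  have : \sum_(0 <= x < N | b x) gauss_pdf x%:R - \sum_(0 <= x < N | b x) px x <= (2 * A * sigma + 1) * e0.
    apply: le_trans bulk; rewrite -sumrB; apply: ler_sum => x _; exact: ler_norm.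
  by move: (\sum_(_ <= _ < _ | _) _) (\sum_(_ <= _ < _ | _) _) (\sum_(_ <= _ < _ | _) _) (_ * e0) => *; lra.
rewrite (bigID b)/=.
have tail : \sum_(0 <= x < N | ~~ b x) `|gauss_pdf x%:R - px x| <=
    \sum_(0 <= x < N | ~~ b x) gauss_pdf x%:R + \sum_(0 <= x < N | ~~ b x) px x.
  rewrite -big_split; apply: ler_sum => x _; apply: (le_trans (ler_normB _ _)).
  by rewrite !ger0_norm ?px_ge0 ?gauss_pdf_ge0.
apply: (le_trans (lerD bulk (le_trans tail (lerD tailg bulkp)))).
by rewrite le_eqVlt; apply/orP; left; apply/eqP; ring.
Qed.

End local_limit.

(** * Mean and variance of the triangle count *)

Section binomials.
Context {R : realType}.

Lemma bin2R (n : nat) : 'C(n, 2)%:R = n%:R * (n%:R - 1) / 2 :> R.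
Proof.
case: n => [|n]; first by rewrite bin0n !mul0r.
have : ('C(n.+1, 2) * 2 = n.+1 * n)%N by rewrite (bin_ffact n.+1 2) ffactSS ffactn1.
move=> /(congr1 (fun k => k%:R : R)); rewrite !natrM => h.
by rewrite -[X in _ = _ * (X - 1) / 2]natr1 addrK -h mulfK.
Qed.

Lemma bin3R (n : nat) : 'C(n, 3)%:R = n%:R * (n%:R - 1) * (n%:R - 2) / 6 :> R.
Proof.
case: n => [|[|n]]; first by rewrite bin0n !mul0r.
  by rewrite bin_small// subrr mulr0 !mul0r.
have h : ('C(n.+2, 3) * 3 = 'C(n.+2, 2) * n)%N by rewrite mulnC mul_bin_left subn2 mulnC.
have /(congr1 (fun k => k%:R : R)) := h; rewrite !natrM bin2R => e.
have -> : n.+2%:R - 2 = n%:R :> R by rewrite -addn2 natrD addrK.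
by apply: (@mulIf _ 3); rewrite // e; field.
Qed.

End binomials.

Section moments.
Import mathcomp.boot.fintype mathcomp.boot.finset.
Context (R : realType) (n : nat) (p : R).

Definition mean_triangles : R := 'C(n, 3)%:R * p ^+ 3.

Definition var_triangles : R := Ex p (fun G => (\sum_T tri_ind p [set: 'I_n] T G) ^+ 2).

Definition sd_triangles : R := Num.sqrt var_triangles.

Hypothesis p01 : 0 <= p <= 1.

Lemma sqr_sd_triangles : sd_triangles ^+ 2 = var_triangles.
Proof. by rewrite sqr_sqrtr// Ex_ge0// => G; exact: sqr_ge0. Qed.

Lemma Ex_triangles : Ex p (fun G : graph n => (triangles G)%:R) = mean_triangles.
Proof.
under eq_Ex do rewrite (triangles_centered p).
rewrite ExD Ex_cst -[RHS]addr0; congr (_ + _).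
by rewrite Ex_sum big1// => T _; exact: Ex_tri_ind.
Qed.

Lemma Ex_sqr_triangles_centered :
  Ex p (fun G : graph n => ((triangles G)%:R - mean_triangles) ^+ 2) = var_triangles.
Proof. by apply: eq_Ex => G; rewrite (triangles_centered p) addrC addKr. Qed.

End moments.

(* With v = sqrt n and r = sqrt p all orders of magnitude are monomials in v and r;
   the standard deviation is of order v^4 r^5. *)
Section scaling.
Import mathcomp.boot.fintype mathcomp.boot.finset.
Context (R : realType) (n : nat) (p v r : R).
Hypothesis nE : n%:R = v ^+ 2.
Hypothesis pE : p = r ^+ 2.
Hypothesis v0 : 0 < v.
Hypothesis r0 : 0 < r.
Hypothesis vr : 4 < v * r ^+ 2.
Hypothesis p_half : p < 1 / 2.

Lemma scaling_p01 : 0 <= p <= 1.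
Proof. by rewrite pE sqr_ge0 -pE; have := p_half; lra. Qed.

Lemma scaling_v : 8 < v.
Proof.
have h := p_half; rewrite pE in h; have h1 := vr; have h2 := v0.
rewrite ltNge; apply/negP => v8; have := sqr_ge0 r; nra.
Qed.

Lemma scaling_n : 64 <= n%:R :> R.
Proof. by rewrite nE; have := scaling_v; nra. Qed.

Lemma scaling_np2 : 16 <= n%:R * p ^+ 2.
Proof.
have -> : n%:R * p ^+ 2 = (v * r ^+ 2) ^+ 2 by rewrite nE pE; ring.
by have := vr; nra.
Qed.

Let a : R := n%:R * p ^+ 2.

Let C3_le : 'C(n, 3)%:R <= n%:R ^+ 3 / 6 :> R.
Proof.
rewrite bin3R ler_pM2r ?invr_gt0//.
by have := scaling_n; move: (n%:R : R) => x x64; nra.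
Qed.

Lemma var_triangles_upper : var_triangles n p <= (v ^+ 4 * r ^+ 5) ^+ 2.
Proof.
apply: (le_trans (var_triangles_le scaling_p01 _)).
rewrite cardsT card_ord -/a; have a16 := scaling_np2; rewrite -/a in a16.
have p30 : 0 <= p ^+ 3 by rewrite exprn_ge0//; case/andP: scaling_p01.
apply: (@le_trans _ _ (n%:R ^+ 3 / 6 * (p ^+ 3 * (6 * a)))); last first.
  by rewrite le_eqVlt; apply/orP; left; apply/eqP; rewrite /a nE pE; field.
apply: ler_pM => //; first by rewrite mulr_ge0//; lra.
by rewrite ler_wpM2l//; lra.
Qed.

Lemma var_triangles_lower : (v ^+ 4 * r ^+ 5) ^+ 2 / 5 <= var_triangles n p.
Proof.
have N64 := scaling_n; have /andP[p0 p1] := scaling_p01.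
(* (n - 2) p^2 is the covariance with the edge count divided by the variance of the latter, the
   optimal c. *)
apply: le_trans (var_triangles_ge n scaling_p01 ((n%:R - 2) * p ^+ 2)).
rewrite bin2R bin3R.
set N : R := n%:R in N64 *.
have -> : 2 * ((N - 2) * p ^+ 2) * (N * (N - 1) * (N - 2) / 6 * (3 * (p ^+ 3 * (1 - p)))) -
  ((N - 2) * p ^+ 2) ^+ 2 * (N * (N - 1) / 2 * (p * (1 - p))) =
  p ^+ 5 * ((1 - p) * (N * ((N - 1) * (N - 2) ^+ 2)) / 2) by field.
have -> : (v ^+ 4 * r ^+ 5) ^+ 2 / 5 = p ^+ 5 * (N ^+ 4 / 5) by rewrite /N nE pE; field.
rewrite ler_wpM2l ?exprn_ge0//.
have h1 : 63 / 64 * N <= N - 1 by lra.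
have h2 : (31 / 32 * N) ^+ 2 <= (N - 2) ^+ 2 by rewrite ler_sqr ?nnegrE; lra.
have h3 : 63 / 64 * N * (31 / 32 * N) ^+ 2 <= (N - 1) * (N - 2) ^+ 2.
  by apply: ler_pM => //; [lra|exact: sqr_ge0].
have h4 : 9 / 10 * N ^+ 3 <= (N - 1) * (N - 2) ^+ 2.
  apply: le_trans h3.
  have N3 : 0 <= N ^+ 3 by rewrite exprn_ge0//; lra.
  have -> : 63 / 64 * N * (31 / 32 * N) ^+ 2 = 63 / 64 * (31 / 32) ^+ 2 * N ^+ 3 by ring.
  by rewrite ler_wpM2r//; lra.
have h5 : N * (9 / 10 * N ^+ 3) <= N * ((N - 1) * (N - 2) ^+ 2) by rewrite ler_wpM2l//; lra.
have N4 : 0 <= N ^+ 4 by rewrite exprn_even_ge0.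
have h6 : 1 / 2 * (N * (9 / 10 * N ^+ 3)) <= (1 - p) * (N * ((N - 1) * (N - 2) ^+ 2)).
  apply: ler_pM => //; last by have := p_half; lra.
  have Np : 0 <= N by lra.
  by rewrite !mulr_ge0// exprn_ge0.
have e : N * (9 / 10 * N ^+ 3) = 9 / 10 * N ^+ 4 by ring.
by rewrite e in h6; lra.
Qed.

Lemma triple_moment_upper :
  triple_moment p (tri_supp [set: 'I_n]) (tri_ind p [set: 'I_n]) <= 116 * (v ^+ 10 * r ^+ 14).
Proof.
apply: (le_trans (triple_moment_triangles_le scaling_p01 _)).
rewrite cardsT card_ord -/a; have a16 := scaling_np2; rewrite -/a in a16.
have p30 : 0 <= p ^+ 3 by rewrite exprn_ge0//; case/andP: scaling_p01.
(* a >= 16 gives a + 6 <= 11/8 a and a + 12 <= 7/4 a; the constants multiply to 231/2, rounded up to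
   116. *)
apply: (@le_trans _ _ (n%:R ^+ 3 / 6 * (16 * p ^+ 3 * (3 * (11 / 8 * a)) * (6 * (7 / 4 * a))))).
  have f1 : 0 <= 3 * (a + 6) by lra.
  have f2 : 0 <= 6 * (a + 12) by lra.
  have f3 : 0 <= 16 * p ^+ 3 by lra.
  have f4 : 0 <= 16 * p ^+ 3 * (3 * (a + 6)) by exact: mulr_ge0.
  apply: ler_pM => //; first exact: mulr_ge0.
  apply: ler_pM => //; last by lra.
  by rewrite ler_wpM2l//; lra.
have -> : n%:R ^+ 3 / 6 * (16 * p ^+ 3 * (3 * (11 / 8 * a)) * (6 * (7 / 4 * a))) =
    231 / 2 * (v ^+ 10 * r ^+ 14) by rewrite /a nE pE; field.
rewrite ler_wpM2r//; last by lra.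
by rewrite mulr_ge0 ?exprn_ge0 ?(ltW v0) ?(ltW r0).
Qed.

Let s0 := v ^+ 4 * r ^+ 5.

Let s0_gt0 : 0 < s0.
Proof. by rewrite mulr_gt0 ?exprn_gt0. Qed.

Lemma sd_triangles_bounds : s0 / 3 <= sd_triangles n p <= s0.
Proof.
have s00 := ltW s0_gt0; have h0 : 0 <= sd_triangles n p by exact: sqrtr_ge0.
apply/andP; split.
  rewrite -ler_sqr ?nnegrE ?divr_ge0// (sqr_sd_triangles n scaling_p01); apply: le_trans var_triangles_lower.
  by rewrite -/s0; have := sqr_ge0 s0; lra.
by rewrite -ler_sqr ?nnegrE// (sqr_sd_triangles n scaling_p01); exact: var_triangles_upper.
Qed.

Lemma sd_triangles_gt0 : 0 < sd_triangles n p.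
Proof. by have /andP[h _] := sd_triangles_bounds; apply: lt_le_trans h; rewrite divr_gt0. Qed.

(** t <= 3 A / s0 in the bound 2 t^3 times the triple moment gives 2 * 27 * 116, and v^10 r^14 /
    s0^3 = 1 / (v^2 r). *)
Lemma triangles_cf_small (A th t : R) : 0 <= A -> 0 <= t <= A / sd_triangles n p ->
  `|Ex p (fun G : {set edge n} => cos (th + t * ((triangles G)%:R - mean_triangles n p)))
    - cos th * expR (- (sd_triangles n p ^+ 2 * t ^+ 2 / 2))| <= 54 * 116 * A ^+ 3 / (v ^+ 2 * r).
Proof.
move=> A0 /andP[t0 tA]; rewrite (sqr_sd_triangles n scaling_p01).
rewrite (eq_Ex p (g := fun G => cos (th + t * \sum_T tri_ind p [set: 'I_n] T G))); last first.
  by move=> G; rewrite (triangles_centered p) /mean_triangles [_ + _ - _]addrAC subrr add0r.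
apply: (le_trans (gaussian_cf_local_dependence scaling_p01 (@tri_ind_dep _ _ _ _) (Ex_tri_ind _ _) th t0)).
have /andP[sl _] := sd_triangles_bounds; have sp := sd_triangles_gt0.
have tle : t <= 3 * A / s0.
  rewrite ler_pdivlMr// in tA; rewrite ler_pdivlMr//.
  have : t * (s0 / 3) <= t * sd_triangles n p by rewrite ler_wpM2l.
  by lra.
have t3 : t ^+ 3 <= (3 * A / s0) ^+ 3 by apply: lerXn2r => //; rewrite nnegrE// (le_trans t0).
apply: (@le_trans _ _ (2 * (3 * A / s0) ^+ 3 * (116 * (v ^+ 10 * r ^+ 14)))).
  apply: ler_pM; last exact: triple_moment_upper.
  - by rewrite mulr_ge0 ?exprn_ge0.
  - do 3! apply: sumr_ge0 => ? _.
    by rewrite addr_ge0 ?mulr_ge0//; apply: Ex_ge0 => //; exact: scaling_p01.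
  - by rewrite ler_wpM2l.
by rewrite le_eqVlt; apply/orP; left; apply/eqP; rewrite /s0; field; rewrite !gt_eqF.
Qed.

End scaling.

(** * Characteristic function bounds *)

Lemma le_sqr_div100 (R : realType) (a x : R) : 100 <= a -> a <= x -> a <= x ^+ 2 / 100.
Proof.
move=> a100 ax; rewrite ler_pdivlMr// expr2; apply: ler_pM => //; lra.
Qed.

Section regimes.
Import mathcomp.boot.fintype mathcomp.boot.finset.
Context (R : realType) (n : nat) (p v r A : R).
Hypothesis nE : n%:R = v ^+ 2.
Hypothesis pE : p = r ^+ 2.
Hypothesis v0 : 0 < v.
Hypothesis r0 : 0 < r.
Hypothesis vr : 4 < v * r ^+ 2.
Hypothesis p_half : p < 1 / 2.
Hypothesis A100 : 100 <= A.
Hypothesis Av : A ^+ 4 <= v.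

Let p01 : 0 <= p <= 1. Proof. exact: scaling_p01 pE p_half. Qed.

Let r1 : r < 1.
Proof. by have h := p_half; rewrite pE in h; have h0 := r0; nra. Qed.

Let A3v : A * (100 * 100 * 100) <= v.
Proof.
apply: le_trans Av; have h := A100; rewrite exprS; apply: ler_wpM2l; first by lra.
have -> : 100 * 100 * 100 = 100 ^+ 3 :> R by rewrite !exprS expr0 mulr1 mulrA.
by apply: lerXn2r => //; rewrite nnegrE; lra.
Qed.

Let A2v : A ^+ 2 <= v.
Proof.
have h := A100; apply: le_trans Av; rewrite (_ : A ^+ 4 = A ^+ 2 * A ^+ 2); last by ring.
by rewrite -[leLHS]mulr1 ler_wpM2l ?sqr_ge0//; nra.
Qed.

Let A0 : 0 < A. Proof. by have := A100; lra. Qed.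

Let A_le_n : A <= n%:R / 5 * (1 / 2304).
Proof.
have h : v <= v ^+ 2 by rewrite ler_eXnr//; have h := A3v; have := A100; lra.
by rewrite nE; have h3 := A3v; have := A0; lra.
Qed.

(** With k = n / 4 rounded down, k times the minimum is at least A: the constant branch because A is
    far below n, the other because it yields at least (t v^3 r^3)^2 / 100 >= A^2 / 100 >= A. *)
Lemma cfsq_triangles_large (t : R) : 0 <= t <= pi -> A <= t * (v ^+ 3 * r ^+ 3) ->
  cfsq p (fun G : {set edge n} => t * (triangles G)%:R) <= expR (- (A / 100)).
Proof.
move=> /andP[t0 tpi] tA.
have N64 : 64 <= n%:R :> R by exact: (scaling_n nE pE v0 vr p_half).
have n64 : (64 <= n)%N by rewrite -(ler_nat R).
have np2 : 16 <= n%:R * p ^+ 2 by exact: (scaling_np2 nE pE vr).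
set kk := (n %/ 4)%N.
have kk0 : (0 < kk)%N by rewrite divn_gt0// (leq_trans _ n64).
have kE : kk.-1.+1 = kk by rewrite prednK.
have k4 : (4 * kk <= n)%N by rewrite mulnC leq_trunc_div.
have kn : (kk + kk <= n)%N by rewrite (leq_trans _ k4)// addnn -mul2n leq_mul2r orbT.
have Nk : (n - (kk + kk))%:R = n%:R - 2 * kk%:R :> R by rewrite natrB// natrD; ring.
have k_up : 4 * kk%:R <= n%:R :> R.
  by rewrite -natrM ler_nat.
have k_lo : n%:R / 5 <= kk%:R :> R.
  have : n%:R < 4 * (kk%:R + 1) :> R by rewrite natr1 -natrM ltr_nat mulnC ltn_ceil.
  by lra.
have p0 : 0 <= p by case/andP: p01.
have p20 : 0 <= p ^+ 2 by exact: sqr_ge0.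
set M := (n - (kk + kk))%:R * p ^+ 2.
have M_lo : n%:R / 2 * p ^+ 2 <= M by rewrite /M Nk ler_wpM2r//; lra.
have M1 : 1 <= M by apply: le_trans M_lo; move: np2; rewrite mulrAC; lra.
have L_lo : n%:R / 5 * p / 2 <= kk%:R * p / 2 by rewrite ler_wpM2r// ler_wpM2r.
have v8 : 8 < v by exact: (scaling_v pE v0 vr p_half).
have L1 : 1 / 2304 <= kk%:R * p / 2.
  apply: le_trans L_lo; rewrite nE pE.
  have : 4 < v * (v * r ^+ 2) by have := vr; nra.
  rewrite (_ : v ^+ 2 / 5 * r ^+ 2 / 2 = v * (v * r ^+ 2) / 10); last by field.
  by lra.
have := @cfsq_triangles_decoupled R n p p01 kk.-1 t; rewrite !kE => h.
have t_norm : `|t| <= pi by rewrite ger0_norm.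
have {h} h := h kn (ltW p_half) M1 t_norm L1.
apply: (le_trans h); rewrite ler_expR lerN2.
set q := Num.min _ _.
suff : A <= kk%:R * q.
  by rewrite mulrCA; have := A100; lra.
have kk0R : 0 < kk%:R :> R by rewrite ltr0n.
rewrite /q minr_pMr ?(ltW kk0R)// le_min; apply/andP; split; last first.
  apply: (le_trans A_le_n); apply: ler_wpM2r k_lo; exact: divr_ge0 ler01 (ler0n _ _).
apply: (@le_trans _ _ (n%:R / 5 * (n%:R / 5 * p / 2 * (n%:R / 2 * p ^+ 2 * t ^+ 2)))); last first.
  have t20 := sqr_ge0 t.
  have x1 : 0 <= n%:R / 2 * p ^+ 2 :> R by rewrite mulr_ge0// divr_ge0.
  have x2 : 0 <= n%:R / 5 * p / 2 :> R by rewrite divr_ge0// mulr_ge0// divr_ge0.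
  have x3 : 0 <= n%:R / 2 * p ^+ 2 * t ^+ 2 :> R by exact: mulr_ge0.
  have x4 : 0 <= n%:R / 5 :> R by rewrite divr_ge0.
  have x5 := mulr_ge0 x2 x3.
  apply: ler_pM => //; apply: ler_pM => //.
  by rewrite ler_wpM2r.
have -> : n%:R / 5 * (n%:R / 5 * p / 2 * (n%:R / 2 * p ^+ 2 * t ^+ 2)) =
    (t * (v ^+ 3 * r ^+ 3)) ^+ 2 / 100 by rewrite nE pE; field.
exact: le_sqr_div100.
Qed.

Let npsq_le : 2 * (n%:R * p ^+ 2) <= v ^+ 3 * r ^+ 3 / A.
Proof.
rewrite ler_pdivlMr//.
have -> : 2 * (n%:R * p ^+ 2) * A = v ^+ 2 * r ^+ 3 * (2 * r * A) by rewrite nE pE; ring.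
rewrite (_ : v ^+ 3 * r ^+ 3 = v ^+ 2 * r ^+ 3 * v); last by ring.
have hv := ltW v0; have hr := ltW r0.
rewrite ler_wpM2l//; first by rewrite mulr_ge0 ?exprn_ge0.
apply: (@le_trans _ _ (2 * 1 * A)); first by rewrite ler_wpM2r ?(ltW A0)// ler_wpM2l// ltW// r1.
by have h2 := A3v; lra.
Qed.

Let A_le : A <= v ^+ 3 * r ^+ 3 / A.
Proof.
have hv := v0; have hr := r0.
have h1 : 4 <= v * r ^+ 2 by exact: ltW vr.
have h2 : v * r ^+ 2 <= v * r by rewrite ler_pM2l// expr2 -[leRHS]mulr1 ler_pM2l// ltW// r1.
rewrite ler_pdivlMr// -expr2; apply: (le_trans A2v).
have -> : v ^+ 3 * r ^+ 3 = v * ((v * r ^+ 2) * (v * r)) by ring.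
rewrite -[leLHS]mulr1 ler_pM2l// -[leLHS]mulr1; apply: ler_pM => //; lra.
Qed.

(** With x = d a between 1/10 and 1/5, the block exponent is at least x^2 / 256 >= 1/100/256. Half
    of it, reduced by the perturbation 4 y + 2 y^2, leaves 1/100/256/4 for each of at least A
    blocks. *)
Lemma cfsq_triangles_mid (t y : R) : 0 < t -> t * (v ^+ 3 * r ^+ 3) < A -> A <= t * (v ^+ 4 * r ^+ 5) ->
  0 <= y -> 4 * y + 2 * y ^+ 2 <= 1 / 100 / 256 / 4 -> 1 <= 100 * A * y ^+ 2 ->
  cfsq p (fun G : {set edge n} => t * (triangles G)%:R) <=
  expR (- (A * (1 / 100 / 256 / 4))) + n%:R ^+ 2 * expR (- A).
Proof.
move=> t0 tA At y0 yl Ay.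
have hv := v0; have hr := r0; have hA := A100.
have v8 : 8 < v by exact: (scaling_v pE v0 vr p_half).
have rv3 : 0 < v ^+ 3 * r ^+ 3 by rewrite mulr_gt0 ?exprn_gt0.
have p0 : 0 <= p by case/andP: p01.
pose d := t * (v ^+ 2 * r ^+ 5).
have d0 : 0 < d by rewrite mulr_gt0// mulr_gt0 ?exprn_gt0.
(* Blocks of about w vertices make t * (block sum) of constant order. *)
pose w := 1 / (5 * d).
have w0 : 0 < w by rewrite divr_gt0// mulr_gt0.
have dw : d * w = 1 / 5 by rewrite /w; field; rewrite gt_eqF.
have dsmall : 10 * d <= 1.
  have e : d * v = t * (v ^+ 3 * r ^+ 3) * r ^+ 2 by rewrite /d; ring.
  have h1 : d * v <= A by rewrite e -[leRHS]mulr1; apply: ler_pM => //;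
    [by rewrite mulr_ge0// ltW|exact: sqr_ge0|exact: ltW|have h := r1; nra].
  have h2 := A3v; have : d * (A * (100 * 100 * 100)) <= d * v by rewrite ler_wpM2l// ltW.
  by move=> h3; nra.
have w2 : 2 <= w by rewrite /w ler_pdivlMr ?mulr_gt0//; lra.
(* Rounding down loses at most a factor 2, because w >= 2. *)
pose a := Num.truncn w.
have /andP[aw wa] := truncn_itv (ltW w0); rewrite -/a in aw wa.
have a2 : (2 <= a)%N by rewrite /a truncn_ge_nat ?(ltW w0).
have a2R : 2 <= a%:R :> R by rewrite (ler_nat R 2).
have aw2 : w / 2 <= a%:R by move: wa; rewrite -natr1; lra.
(* The blocks fill at most half of the vertices; the others form W. *)
pose m := (n %/ (2 * a))%N.
have a0n : (0 < 2 * a)%N by rewrite muln_gt0 (leq_trans _ a2).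
have ma : (m * a <= n)%N.
  rewrite (leq_trans _ (leq_trunc_div n (2 * a)))// leq_mul2l leq_pmull ?orbT//.
have ma2 : 2 * (m%:R * a%:R) <= n%:R :> R.
  by rewrite -!natrM ler_nat mulnCA leq_trunc_div.
have an : a%:R * (5 * A) <= v ^+ 2.
  apply: (@le_trans _ _ (w * (5 * A))); first by rewrite ler_wpM2r//; lra.
  rewrite /w mulrAC ler_pdivrMr ?mulr_gt0// mul1r.
  by rewrite (_ : v ^+ 2 * (5 * d) = 5 * (t * (v ^+ 4 * r ^+ 5))); [lra|rewrite /d; ring].
(* Blocks have at most n / (5 A) vertices, because t v^4 r^5 >= A. *)
have mA : A <= m%:R.
  have : n%:R < (m%:R + 1) * (2 * a%:R) :> R.
    by rewrite natr1 -!natrM ltr_nat ltn_ceil.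
  rewrite nE => h; have : a%:R * (5 * A) < (m%:R + 1) * (2 * a%:R) by exact: le_lt_trans an h.
  rewrite mulrC mulrA ltr_pM2r; last by lra.
  by lra.
have Nma : (n - m * a)%:R = n%:R - m%:R * a%:R :> R by rewrite natrB// natrM.
have np2 : 16 <= n%:R * p ^+ 2 by exact: (scaling_np2 nE pE vr).
set M := (n - m * a)%:R * p ^+ 2.
have p20 : 0 <= p ^+ 2 by exact: sqr_ge0.
have M_lo : n%:R * p ^+ 2 / 2 <= M by rewrite /M Nma mulrAC ler_wpM2r//; lra.
have M_up : M <= n%:R * p ^+ 2 by rewrite /M Nma ler_wpM2r// gerBl mulr_ge0.
have M1 : 1 <= M by lra.
pose x := d * a%:R.
have x_up : x <= 1 / 5 by rewrite -dw ler_wpM2l// ltW.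
have x_lo : 1 / 10 <= x.
  apply: (@le_trans _ _ (d * (w / 2))); first by rewrite mulrA dw; lra.
  by rewrite ler_wpM2l// ltW.
have np0 : 0 <= n%:R * p ^+ 2 by lra.
have M0 : 0 <= M by lra.
have c0 : 0 <= p * t ^+ 2 / 16 by rewrite divr_ge0// mulr_ge0// sqr_ge0.
have L_up : p * t ^+ 2 / 16 * ('C(a, 2)%:R * M ^+ 2) <= x ^+ 2 / 32.
  have -> : x ^+ 2 / 32 = p * t ^+ 2 / 16 * (a%:R ^+ 2 / 2 * (n%:R * p ^+ 2) ^+ 2).
    by rewrite /x /d nE pE; field.
  rewrite ler_wpM2l//; apply: ler_pM => //; first exact: sqr_ge0.
    by rewrite bin2R ler_pM2r ?invr_gt0//; nra.
  by rewrite ler_sqr ?nnegrE.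
have L_lo : x ^+ 2 / 256 <= p * t ^+ 2 / 16 * ('C(a, 2)%:R * M ^+ 2).
  have -> : x ^+ 2 / 256 = p * t ^+ 2 / 16 * (a%:R ^+ 2 / 4 * (n%:R * p ^+ 2 / 2) ^+ 2).
    by rewrite /x /d nE pE; field.
  rewrite ler_wpM2l//; apply: ler_pM; [by rewrite divr_ge0// sqr_ge0|exact: sqr_ge0| |].
    by rewrite bin2R; nra.
  by rewrite ler_sqr ?nnegrE// divr_ge0.
have vcond : t ^+ 2 * ('C(a, 3)%:R * (p ^+ 3 * (3 * (a%:R * p ^+ 2 + 6)))) <= y ^+ 2.
  have p30 : 0 <= p ^+ 3 by exact: exprn_ge0.
  have t20 := sqr_ge0 t.
  have ap : 0 <= a%:R * p ^+ 2 + 6 :> R by rewrite addr_ge0// mulr_ge0.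
  apply: (@le_trans _ _ (t ^+ 2 * (a%:R ^+ 3 / 6 * (p ^+ 3 * (3 * (a%:R * p ^+ 2 + 6)))))).
    rewrite ler_wpM2l// ler_wpM2r//; first by rewrite mulr_ge0// mulr_ge0.
    by rewrite bin3R ler_pM2r ?invr_gt0//; move: (a%:R : R) a2R => z z2; nra.
  pose b := a%:R / v ^+ 2.
  have v2 : 0 < v ^+ 2 by exact: exprn_gt0.
  have b0 : 0 <= b by rewrite divr_ge0// ltW.
  have bA : b * (5 * A) <= 1 by rewrite /b mulrAC ler_pdivrMr// mul1r.
  have b1 : b <= 1 by nra.
  pose g := (v ^+ 2 * r ^+ 4)^-1.
  have gE : v ^+ 2 * r ^+ 4 = n%:R * p ^+ 2 by rewrite nE pE; ring.
  have g16 : g <= 16^-1 by rewrite /g gE lef_pV2 ?posrE//; lra.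
  have -> : t ^+ 2 * (a%:R ^+ 3 / 6 * (p ^+ 3 * (3 * (a%:R * p ^+ 2 + 6)))) =
      x ^+ 2 / 2 * (b ^+ 2 + 6 * b * g).
    by rewrite /x /d /b /g pE; field; rewrite !gt_eqF.
  have x2 : x ^+ 2 / 2 <= 1 / 50 by nra.
  have bg : b ^+ 2 + 6 * b * g <= 2 * b.
    have : b * g <= b * 16^-1 by rewrite ler_wpM2l.
    by nra.
  apply: (@le_trans _ _ (1 / 50 * (2 * b))).
    apply: ler_pM => //; first by rewrite divr_ge0// sqr_ge0.
    have g0 : 0 <= g by rewrite /g gE invr_ge0.
    by rewrite addr_ge0 ?sqr_ge0// mulr_ge0// mulr_ge0.
  rewrite -(ler_pM2l A0); have : A * (1 / 50 * (2 * b)) <= 1 / 100 by lra.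
  by lra.
have := @cfsq_triangles_interval_blocks R n p a m t y p01 (ltW p_half) ma M1 t0 y0.
rewrite -/M => h.
have x0 : 0 <= x by lra.
have x2u : x ^+ 2 <= 1 / 25 by nra.
have x2l : 1 / 100 <= x ^+ 2 by nra.
have hL : p * t ^+ 2 / 16 * ('C(a, 2)%:R * M ^+ 2) <= 1 / 216 by lra.
apply: (le_trans (h hL vcond)).
set L := p * t ^+ 2 / 16 * _ in L_lo L_up hL h *.
apply: lerD.
  rewrite ler_expR lerN2; apply: ler_pM; [exact: ltW A0|by rewrite !divr_ge0|exact: mA|].
  by lra.
rewrite ler_wpM2l ?sqr_ge0// ler_expR.
(* Since t lies below the decoupling range, pi / t >= 2 / t exceeds 2 n p^2 + A, and the Markov term
   is at most exp(-A). *)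
have tV : v ^+ 3 * r ^+ 3 / A <= t^-1.
  rewrite ler_pdivrMr; last exact: A0.
  by rewrite [leRHS]mulrC ler_pdivlMr// [leLHS]mulrC ltW.
have pit : 2 * t^-1 <= pi / t by rewrite ler_wpM2r ?invr_ge0 ?(ltW t0)//; exact: pi_ge2.
rewrite lerBlDr (_ : - A + pi / t = pi / t - A); last by rewrite addrC.
rewrite lerBrDr; apply: (le_trans (lerD npsq_le A_le)); apply: le_trans pit.
by rewrite mulr_natl mulr2n lerD.
Qed.

End regimes.

(** * Summing the errors *)

(** Every term is compared with u = A^5 r / v. The Stein term gives A^2 d1 = c A^5 / (v^2 r), and 1
    / (v^2 r) <= (r / v) / 4 is the hypothesis 4 < v r^2; for the exponentially small terms e v^40
    <= 1 absorbs the polynomial factors. *)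
Lemma local_limit_error_le (R : realType) (A v r s m g e h c : R) : 0 <= c ->
  1 <= A -> A <= v -> 8 < v -> 0 < r -> r < 1 -> 4 < v * r ^+ 2 ->
  v ^+ 4 * r ^+ 5 / 3 <= s <= v ^+ 4 * r ^+ 5 -> 0 <= m <= v ^+ 6 ->
  0 <= g <= e -> 0 <= h <= e -> e * v ^+ 40 <= 1 ->
  2 * (2 * A * s + 1) * (A * (c * A ^+ 3 / (v ^+ 2 * r)) / s + (v ^+ 16)^-1 + (A + 2) * g / s) +
  (4 * g + (2 + 2 * A) / s) + h * (16 * s ^+ 2 + 4 * (m + 1) ^+ 2) / s <=
  (2 * c + 16) * (A ^+ 5 * (r / v)).
Proof.
move=> c0 A1 Av v8 r0 r1 vr /andP[s_lo s_up] /andP[m0 m_up] /andP[g0 ge] /andP[h0 he] ev.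
have v0 : 0 < v by lra.
have v1 : 1 <= v by lra.
have A0 : 0 < A by lra.
set u := A ^+ 5 * (r / v).
have A5 : 1 <= A ^+ 5 by rewrite exprn_ege1.
have A25 k : (k <= 5)%N -> A ^+ k <= A ^+ 5 by move=> k5; apply: ler_weXn2l.
have rv : 0 <= r / v by rewrite divr_ge0// ltW.
have vr1 : 4 <= v * r.
  by apply: (le_trans (ltW vr)); rewrite ler_pM2l// expr2 -[leRHS]mulr1 ler_pM2l// ltW.
have w_u : (v ^+ 2 * r)^-1 <= r / v / 4.
  rewrite -[leLHS]div1r ler_pdivrMr ?mulr_gt0 ?exprn_gt0//.
  rewrite (_ : r / v / 4 * _ = v * r ^+ 2 / 4); last by field; rewrite gt_eqF.
  by lra.
have v2_u : 4 * (v ^+ 2)^-1 <= r / v.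
  rewrite ler_pdivrMr ?exprn_gt0// (_ : r / v * v ^+ 2 = v * r)//.
  by field; rewrite gt_eqF.
have V_u k : (2 <= k)%N -> (v ^+ k)^-1 <= r / v / 4.
  move=> k2; apply: (@le_trans _ _ (v ^+ 2)^-1); last by lra.
  by rewrite lef_pV2 ?posrE ?exprn_gt0//; apply: ler_weXn2l.
have eV k : (k <= 38)%N -> e * v ^+ k <= r / v / 4.
  move=> k38; apply: le_trans (V_u (40 - k)%N _); last by rewrite leq_subRL ?(leq_trans k38)// addnC (leq_add2l 2).
  rewrite -[leRHS]mul1r ler_pdivlMr ?exprn_gt0// -mulrA -exprD subnKC//.
  by rewrite (leq_trans k38).
have s_big : 5 * (v ^+ 2 * r) <= s.
  apply: le_trans s_lo.
  have -> : v ^+ 4 * r ^+ 5 / 3 = (v * r ^+ 2) ^+ 2 / 3 * (v ^+ 2 * r) by ring.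
  have w0 : 0 < v ^+ 2 * r by rewrite mulr_gt0 ?exprn_gt0.
  rewrite ler_pM2r//.
  have : 4 ^+ 2 <= (v * r ^+ 2) ^+ 2 by rewrite ler_sqr ?nnegrE//; lra.
  by lra.
have s1 : 1 <= s.
  apply: le_trans s_big; have -> : 5 * (v ^+ 2 * r) = 5 * (v * (v * r)) by ring.
  have : 8 * 4 <= v * (v * r) by apply: ler_pM => //; exact: ltW.
  by lra.
have s0 : 0 < s by lra.
have s4 : s <= v ^+ 4.
  apply: (le_trans s_up); rewrite -[leRHS]mulr1 ler_wpM2l ?exprn_ge0 ?(ltW v0)//.
  by rewrite exprn_ile1// ltW.
have e0 : 0 <= e by exact: le_trans ge.
set d1 := c * A ^+ 3 / _; set d2 := (v ^+ 16)^-1.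
have v00 : 0 <= v := ltW v0.
have r00 : 0 <= r := ltW r0.
have A00 : 0 <= A := ltW A0.
have w00 : 0 <= v ^+ 2 * r by rewrite mulr_ge0 ?exprn_ge0.
have d10 : 0 <= d1 by rewrite divr_ge0// mulr_ge0 ?exprn_ge0.
have d20 : 0 <= d2 by rewrite invr_ge0 exprn_ge0.
have Xu x a k : (k <= 5)%N -> 0 <= x -> x <= a * (r / v) -> A ^+ k * x <= a * u.
  move=> k5 x0 xa; apply: (@le_trans _ _ (A ^+ 5 * (a * (r / v)))); last by rewrite /u mulrCA.
  by apply: ler_pM => //; [rewrite exprn_ge0 ?ltW|exact: A25].
have As1 : 1 <= A * s by rewrite -[1]mulr1; apply: ler_pM.
have first : 2 * (2 * A * s + 1) * (A * d1 / s + d2 + (A + 2) * g / s) <=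
    6 * (A ^+ 2 * d1) + 6 * (A * (s * d2)) + 18 * (A ^+ 2 * g).
  apply: (@le_trans _ _ (6 * (A * s) * (A * d1 / s + d2 + (3 * A) * g / s))).
    apply: ler_pM.
    - by lra.
    - by rewrite !addr_ge0// divr_ge0 ?(ltW s0)// mulr_ge0// ?(ltW A0)//; lra.
    - by lra.
    rewrite lerD2l ler_pM2r ?invr_gt0// ler_wpM2r//; lra.
  rewrite le_eqVlt; apply/orP; left; apply/eqP; field.
  by rewrite gt_eqF.
have t1 : A ^+ 2 * d1 <= c / 4 * u.
  have -> : A ^+ 2 * d1 = c * (A ^+ 5 * (v ^+ 2 * r)^-1).
    by rewrite /d1; ring.
  have -> : c / 4 * u = c * (1 / 4 * u) by ring.
  rewrite ler_wpM2l//; apply: Xu => //; [by rewrite invr_ge0 mulr_ge0 ?exprn_ge0 ?ltW|lra].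
have t2 : A * (s * d2) <= 1 / 4 * u.
  apply: (Xu _ _ 1%N) => //; first by rewrite mulr_ge0 // ltW.
  apply: (@le_trans _ _ (v ^+ 4 * d2)); first by rewrite ler_wpM2r.
  have -> : v ^+ 4 * d2 = (v ^+ 12)^-1 by rewrite /d2; field; rewrite gt_eqF.
  by have := V_u 12%N isT; lra.
have e_u : e <= 1 / 4 * (r / v) by have := eV 0%N isT; rewrite expr0 mulr1; lra.
have t3 : A ^+ 2 * g <= 1 / 4 * u by apply: Xu => //; exact: le_trans e_u.
have t4 : g <= 1 / 4 * u by rewrite -[g]mul1r; apply: (Xu _ _ 0%N) => //; exact: le_trans e_u.
have t5 : (2 + 2 * A) / s <= 1 / 4 * u.
  apply: (@le_trans _ _ (A * (v ^+ 2 * r)^-1)).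
    rewrite ler_pdivrMr// mulrAC ler_pdivlMr ?mulr_gt0 ?exprn_gt0//.
    apply: (@le_trans _ _ (4 * A * (v ^+ 2 * r))).
      by rewrite ler_wpM2r ?mulr_ge0 ?exprn_ge0//; lra.
    have := ler_wpM2l (ltW A0) s_big.
    have : 0 <= A * (v ^+ 2 * r) by rewrite !mulr_ge0 ?exprn_ge0.
    by rewrite -mulrA; lra.
  apply: (Xu _ _ 1%N) => //; [by rewrite invr_ge0 mulr_ge0 ?exprn_ge0|lra].
have t6 : h * (16 * s ^+ 2 + 4 * (m + 1) ^+ 2) / s <= 8 * u.
  have q0 : 0 <= 16 * s ^+ 2 + 4 * (m + 1) ^+ 2 by rewrite addr_ge0// mulr_ge0// sqr_ge0.
  apply: (@le_trans _ _ (h * (16 * s ^+ 2 + 4 * (m + 1) ^+ 2))).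
    by rewrite ler_pdivrMr// ler_peMr// mulr_ge0.
  have s2 : s ^+ 2 <= v ^+ 12.
    apply: (@le_trans _ _ ((v ^+ 4) ^+ 2)); first by rewrite ler_sqr ?nnegrE ?exprn_ge0// ltW.
    by rewrite -exprM; apply: ler_weXn2l.
  have m2 : (m + 1) ^+ 2 <= 4 * v ^+ 12.
    have v61 : 1 <= v ^+ 6 by rewrite exprn_ege1.
    apply: (@le_trans _ _ ((2 * v ^+ 6) ^+ 2)); first by rewrite ler_sqr ?nnegrE; lra.
    by rewrite exprMn -exprM -natrX.
  apply: (@le_trans _ _ (e * (32 * v ^+ 12))).
    by apply: ler_pM => //; lra.
  have := eV 12%N isT; rewrite mulrCA => ev12.
  have : 1 * (r / v) <= u by rewrite /u ler_wpM2r.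
  by lra.
have u0 : 0 <= u by rewrite mulr_ge0 ?exprn_ge0.
have cu : 0 <= c * u by exact: mulr_ge0.
by lra.
Qed.

(** * Orders of magnitude of mean and deviation, and a crude bound *)

Section sizes.
Import mathcomp.boot.fintype mathcomp.boot.finset.
Context (R : realType) (n : nat) (p v r : R).
Hypothesis nE : n%:R = v ^+ 2.
Hypothesis pE : p = r ^+ 2.
Hypothesis v0 : 0 < v.
Hypothesis r0 : 0 < r.
Hypothesis vr : 4 < v * r ^+ 2.
Hypothesis p_half : p < 1 / 2.

Let sd := sd_triangles n p.
Let mu := mean_triangles n p.

Let p01 : 0 <= p <= 1. Proof. exact: scaling_p01 pE p_half. Qed.
Let v8 : 8 < v. Proof. exact: (scaling_v pE v0 vr p_half). Qed.
Let sd_bounds : v ^+ 4 * r ^+ 5 / 3 <= sd <= v ^+ 4 * r ^+ 5.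
Proof. exact: (sd_triangles_bounds nE pE v0 r0 vr p_half). Qed.
Let sd0 : 0 < sd. Proof. exact: (sd_triangles_gt0 nE pE v0 r0 vr p_half). Qed.

Lemma scaling_r1 : r < 1.
Proof. by have h := p_half; rewrite pE in h; have h0 := r0; nra. Qed.

Lemma scaling_vr : 4 <= v * r.
Proof.
have hv := v0; have hr := r0.
by apply: (le_trans (ltW vr)); rewrite ler_pM2l// expr2 -[leRHS]mulr1 ler_pM2l// ltW// scaling_r1.
Qed.

Lemma sd_triangles_ge : v <= sd.
Proof.
case/andP: sd_bounds => h _; apply: le_trans h.
have -> : v ^+ 4 * r ^+ 5 / 3 = v * (v * r) * (v * r ^+ 2) ^+ 2 / 3 by ring.
have q : 4 ^+ 2 <= (v * r ^+ 2) ^+ 2 by have h := vr; rewrite ler_sqr ?nnegrE//; lra.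
have hv := v0.
have : v * 4 * 4 ^+ 2 <= v * (v * r) * (v * r ^+ 2) ^+ 2.
  have vr1 := scaling_vr; apply: ler_pM => //; first by rewrite mulr_ge0// ltW.
  by rewrite ler_pM2l.
by lra.
Qed.

Lemma mean_triangles_bounds : v ^+ 6 * r ^+ 6 / 7 <= mu <= v ^+ 6.
Proof.
have N64 : 64 <= n%:R :> R := scaling_n nE pE v0 vr p_half.
have p30 : 0 <= p ^+ 3 by rewrite exprn_ge0//; case/andP: p01.
rewrite /mu /mean_triangles bin3R.
have -> : v ^+ 6 * r ^+ 6 / 7 = n%:R ^+ 3 / 7 * p ^+ 3 by rewrite nE pE; ring.
have -> : v ^+ 6 = n%:R ^+ 3 * 1 by rewrite nE -exprM mulr1.
move: (n%:R : R) N64 => x x64; apply/andP; split.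
  rewrite ler_wpM2r//.
  have h1 : 63 / 64 * x * (62 / 64 * x) <= (x - 1) * (x - 2) by apply: ler_pM; lra.
  have h2 : x * (63 / 64 * x * (62 / 64 * x)) <= x * ((x - 1) * (x - 2)) by rewrite ler_wpM2l//; lra.
  have x3 : 0 <= x ^+ 3 by rewrite exprn_ge0//; lra.
  have e1 : x * (63 / 64 * x * (62 / 64 * x)) = 63 / 64 * (62 / 64) * x ^+ 3 by ring.
  have e2 : x * ((x - 1) * (x - 2)) = x * (x - 1) * (x - 2) by ring.
  by rewrite e1 e2 in h2; lra.
apply: ler_pM => //.
- by rewrite divr_ge0// !mulr_ge0//; lra.
- by nra.
- by rewrite exprn_ile1//; case/andP: p01.
Qed.

(** The two masses are simply added, with the trivial constant 1 in [sum_gauss_pdf_tail]; this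
    serves for bounded n. The constant is 16 + 16 + 1. *)
Lemma triangles_local_limit_crude (N : nat) :
  \sum_(0 <= x < N) `|gauss_pdf mu sd x%:R - Ex p (fun G : {set edge n} => (triangles G == x)%:R)|
  <= 33 * v ^+ 12.
Proof.
have v1 : 1 <= v by have := v8; lra.
have sd1 : 1 <= sd by apply: (le_trans v1); exact: sd_triangles_ge.
have v12 : 1 <= v ^+ 12 by rewrite exprn_ege1.
apply: (@le_trans _ _ (32 * v ^+ 12 + 1)); last by lra.
apply: (@le_trans _ _ (\sum_(0 <= x < N) gauss_pdf mu sd x%:R +
    \sum_(0 <= x < N) Ex p (fun G : {set edge n} => (triangles G == x)%:R))).
  rewrite -big_split; apply: ler_sum => x _; apply: (le_trans (ler_normB _ _)).
  by rewrite !ger0_norm// ?gauss_pdf_ge0// Ex_ge0.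
apply: lerD; last exact: sum_Ex_eq_le1.
apply: (le_trans (sum_gauss_pdf_tail (P := xpredT) (c := 1) sd0 N ler01 _)).
  by move=> x _; rewrite -expR0 ler_expR lerNl oppr0 divr_ge0// sqr_ge0.
have q0 : 0 <= 16 * sd ^+ 2 + 4 * (mu + 1) ^+ 2 by rewrite addr_ge0// mulr_ge0// sqr_ge0.
rewrite mul1r; apply: (@le_trans _ _ (16 * sd ^+ 2 + 4 * (mu + 1) ^+ 2)).
  by rewrite ler_pdivrMr// ler_peMr.
have v61 : 1 <= v ^+ 6 by rewrite exprn_ege1.
have s4 : sd <= v ^+ 6.
  case/andP: sd_bounds => _ /le_trans; apply; apply: (@le_trans _ _ (v ^+ 4)).
    by rewrite ler_piMr ?exprn_ge0 ?exprn_ile1// ?(ltW v0) ?(ltW r0)// ltW// scaling_r1.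
  exact: ler_weXn2l.
have s2 : sd ^+ 2 <= (v ^+ 6) ^+ 2 by have h := sd0; rewrite ler_sqr ?nnegrE//; lra.
have [m0 m6] : 0 <= mu /\ mu <= v ^+ 6.
  case/andP: mean_triangles_bounds => h1 h2; split => //; apply: le_trans h1.
  have hv := ltW v0; have hr := ltW r0.
  by rewrite divr_ge0// mulr_ge0 ?exprn_ge0.
have m2 : (mu + 1) ^+ 2 <= (2 * v ^+ 6) ^+ 2 by rewrite ler_sqr ?nnegrE; lra.
by rewrite exprMn -exprM in m2; rewrite -exprM in s2; lra.
Qed.

End sizes.

(** * The local limit estimate for large A *)

Section large_n.
Import mathcomp.boot.fintype mathcomp.boot.finset.
Context (R : realType) (n : nat) (p v r A y : R).
Hypothesis nE : n%:R = v ^+ 2.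
Hypothesis pE : p = r ^+ 2.
Hypothesis v0 : 0 < v.
Hypothesis r0 : 0 < r.
Hypothesis vr : 4 < v * r ^+ 2.
Hypothesis p_half : p < 1 / 2.
Hypothesis A100 : 100 <= A.
Hypothesis Av : A ^+ 4 <= v.
Hypothesis y0 : 0 <= y.
Hypothesis y_small : 4 * y + 2 * y ^+ 2 <= 1 / 100 / 256 / 4.
Hypothesis Ay : 1 <= 100 * A * y ^+ 2.

Let e : R := expR (- (A * (1 / 100 / 256 / 4))).

Hypothesis ev : e * v ^+ 40 <= 1.

Let p01 : 0 <= p <= 1. Proof. exact: scaling_p01 pE p_half. Qed.
Let v8 : 8 < v. Proof. exact: (scaling_v pE v0 vr p_half). Qed.
Let A0 : 0 < A. Proof. by have := A100; lra. Qed.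
Let A1 : 1 <= A. Proof. by have := A100; lra. Qed.

Let expA_le (c : R) : A / 100 <= c -> expR (- c) <= e.
Proof.
move=> Ac; rewrite ler_expR lerN2; apply: le_trans Ac.
by have := A0; lra.
Qed.

(** In both ranges the bound is at most 2 v^4 [e], and e v^40 <= 1 turns it into v^(-32). Its square
    root v^(-16) still leaves v^(-12) after multiplication by sigma <= v^4. *)
Lemma cfsq_triangles_le (t : R) : 0 < t <= pi -> A <= t * (v ^+ 4 * r ^+ 5) ->
  cfsq p (fun G : {set edge n} => t * (triangles G)%:R) <= ((v ^+ 16)^-1) ^+ 2.
Proof.
move=> /andP[t0 tpi] At.
have e0 : 0 < e by exact: expR_gt0.
have eA : expR (- A) <= e by apply: expA_le; have := A0; lra.
have v41 : 1 <= v ^+ 4 by rewrite exprn_ege1//; have := v8; lra.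
apply: (@le_trans _ _ (2 * v ^+ 4 * e)); last first.
  have e36 : e <= (v ^+ 40)^-1.
    by rewrite -[leRHS]mul1r ler_pdivlMr ?exprn_gt0.
  apply: (@le_trans _ _ (v ^+ 8 * (v ^+ 40)^-1)).
    apply: ler_pM => //; [by rewrite mulr_ge0// (le_trans ler01)|exact: ltW|].
    have -> : v ^+ 8 = v ^+ 4 * v ^+ 4 by rewrite -exprD.
    rewrite ler_wpM2r ?(le_trans ler01)//.
    have h8 := v8; have -> : v ^+ 4 = v * v ^+ 3 by rewrite -exprS.
    have : 1 <= v ^+ 3 by rewrite exprn_ege1//; lra.
    by move: (v ^+ 3) => z z1; nra.
  rewrite exprVn -exprM le_eqVlt; apply/orP; left; apply/eqP.
  by field; rewrite gt_eqF.
have [tA|tA] := leP A (t * (v ^+ 3 * r ^+ 3)).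
  have t0pi : 0 <= t <= pi by rewrite (ltW t0).
  apply: (le_trans (cfsq_triangles_large nE pE v0 vr p_half A100 Av t0pi tA)).
  apply: (le_trans (expA_le (lexx _))).
  by rewrite -[leLHS]mul1r ler_pM2r//; lra.
apply: (le_trans (cfsq_triangles_mid nE pE v0 r0 vr p_half A100 Av t0 tA At y0 y_small Ay)).
rewrite -/e nE -exprM; apply: (@le_trans _ _ (e + v ^+ 4 * e)).
  by rewrite lerD2l ler_wpM2l ?exprn_ge0// ltW.
by rewrite -mulrA [leRHS]mulr_natl mulr2n lerD2r -[leLHS]mul1r ler_pM2r.
Qed.

Let sd := sd_triangles n p.
Let mu := mean_triangles n p.

Let sd_bounds : v ^+ 4 * r ^+ 5 / 3 <= sd <= v ^+ 4 * r ^+ 5.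
Proof. exact: (sd_triangles_bounds nE pE v0 r0 vr p_half). Qed.

Let sd0 : 0 < sd. Proof. exact: (sd_triangles_gt0 nE pE v0 r0 vr p_half). Qed.

Let A_le_v : A <= v.
Proof. by apply: le_trans Av; rewrite ler_eXnr. Qed.

Let vr1 : 4 <= v * r. Proof. exact: (scaling_vr pE v0 r0 vr p_half). Qed.
Let sd_ge_v : v <= sd. Proof. exact: (sd_triangles_ge nE pE v0 r0 vr p_half). Qed.
Let mu_bounds : v ^+ 6 * r ^+ 6 / 7 <= mu <= v ^+ 6.
Proof. exact: (mean_triangles_bounds nE pE v0 vr p_half). Qed.

Lemma triangles_local_limit (N : nat) :
  \sum_(0 <= x < N) `|gauss_pdf mu sd x%:R - Ex p (fun G : {set edge n} => (triangles G == x)%:R)|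
  <= (2 * (54 * 116) + 16) * (A ^+ 5 * (r / v)).
Proof.
have hv := v0; have hr := r0.
have Asd : A <= sd by exact: le_trans sd_ge_v.
have Asd1 : A / sd <= 1 by rewrite ler_pdivrMr// mul1r.
have pi1 : 1 <= pi :> R by have := pi_ge2 R; lra.
have sd1 : 1 <= sd by apply: le_trans sd_ge_v; have := v8; lra.
have d10 : 0 <= 54 * 116 * A ^+ 3 / (v ^+ 2 * r).
  have A00 := ltW A0; have v00 := ltW v0; have r00 := ltW r0.
  by apply: divr_ge0; apply: mulr_ge0 => //; rewrite ?exprn_ge0// mulr_ge0.
have d20 : 0 <= (v ^+ 16)^-1 by rewrite invr_ge0 exprn_ge0// ltW.
have small th t : 0 <= t <= A / sd ->
  `|Ex p (fun G : {set edge n} => cos (th + t * ((triangles G)%:R - mu))) -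
    cos th * expR (- (sd ^+ 2 * t ^+ 2 / 2))| <= 54 * 116 * A ^+ 3 / (v ^+ 2 * r).
  exact: (triangles_cf_small nE pE v0 r0 vr p_half th (ltW A0)).
have large th t : A / sd <= t <= pi ->
  `|Ex p (fun G : {set edge n} => cos (th + t * (triangles G)%:R))| <= (v ^+ 16)^-1.
  case/andP => At tpi; have t0 : 0 < t by apply: lt_le_trans At; rewrite divr_gt0 ?A0.
  rewrite -ler_sqr ?nnegrE// real_normK ?num_real//.
  apply: (le_trans (Ex_cos_le_cfsq _ _ _)); apply: cfsq_triangles_le; first by rewrite t0.
  rewrite ler_pdivrMr// in At; apply: (le_trans At); rewrite ler_pM2l//.
  by case/andP: sd_bounds.
have Amu : A * sd <= mu.
  case/andP: mu_bounds => m _; apply: le_trans m; case/andP: sd_bounds => _ s.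
  apply: (@le_trans _ _ (A * (v ^+ 4 * r ^+ 5))); first by rewrite ler_pM2l ?A0.
  rewrite (_ : v ^+ 6 * r ^+ 6 / 7 = v * (v * r) / 7 * (v ^+ 4 * r ^+ 5)); last by ring.
  rewrite ler_pM2r ?mulr_gt0 ?exprn_gt0//.
  have : A ^+ 1 * 100 <= A ^+ 4.
    rewrite (_ : A ^+ 4 = A ^+ 1 * A ^+ 3); last by rewrite -exprD.
    rewrite ler_pM2l ?expr1 ?A0//; apply: (le_trans A100); rewrite ler_eXnr//.
  have : v * 4 <= v * (v * r) by rewrite ler_pM2l.
  by rewrite expr1; have := Av; lra.
apply: (le_trans (local_limit_sum p01 sd0 A1 d10 d20 (le_trans Asd1 pi1) small large Amu sd1 N)).
apply: (local_limit_error_le (e := e)) => //.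
- exact: (scaling_r1 pE r0 p_half).
- by rewrite (le_trans (mulr_ge0 (ltW A0) (ltW sd0)) Amu)/=; case/andP: mu_bounds.
- rewrite (ltW (gauss2_gt0 _))/=; apply: expA_le.
  by have h := A100; nra.
- rewrite expR_ge0/=; apply: expA_le.
  by have h := A100; nra.
Qed.

End large_n.

Lemma exprn_le_expR (R : realType) (k : nat) (c x : R) : 0 < c ->
  k.+1`!%:R / c ^+ k.+1 <= x -> x ^+ k <= expR (c * x).
Proof.
move=> c0 kx; have f0 : 0 < k.+1`!%:R :> R by rewrite ltr0n fact_gt0.
have x0 : 0 <= x by apply: le_trans kx; rewrite divr_ge0 ?exprn_ge0// ltW.
apply: (@le_trans _ _ ((c * x) ^+ k.+1 / k.+1`!%:R)).
  rewrite ler_pdivlMr// exprMn [x ^+ k.+1]exprS mulrA [leLHS]mulrC ler_wpM2r ?exprn_ge0//.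
  by move: kx; rewrite ler_pdivrMr ?exprn_gt0// mulrC.
by apply: le_trans (expR_ge1Dxn k (mulr_ge0 (ltW c0) x0)); rewrite lerDr.
Qed.

(** * Choice of A and of the constant C *)

Section uniform.
Import mathcomp.boot.fintype mathcomp.boot.finset.
Context (R : realType) (eps : R).
Hypothesis eps0 : 0 < eps.
Hypothesis eps1 : eps < 1.

Lemma triangles_local_limit_uniform : exists C : R, 0 < C /\
  forall (n : nat) (p : R), (0 < n)%N -> 4 * n%:R `^ (- (1 / 2)) < p -> p < 1 / 2 ->
  forall N : nat, \sum_(0 <= x < N) `|gauss_pdf (mean_triangles n p) (sd_triangles n p) x%:R
    - Ex p (fun G : {set edge n} => (triangles G == x)%:R)|
  <= C * (p `^ (1 / 2) / n%:R `^ (1 / 2 - eps)).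
Proof.
(* c is the decay rate of the intermediate range, and y = c / 5 satisfies 4 y + 2 y^2 <= c. *)
pose c : R := 1 / 100 / 256 / 4.
pose y : R := c / 5.
(* A^k = n^(eps k / 8) reaches v^40 = n^20 once k >= 160 / eps. *)
pose k := (Num.truncn (160 / eps)).+1.
(* The sum of three thresholds, above which A >= 100, 100 A y^2 >= 1 and A^k <= exp(c A). *)
pose K : R := 100 + 1 / (100 * y ^+ 2) + k.+1`!%:R / c ^+ k.+1.
pose c1 : R := 2 * (54 * 116) + 16.
have c0 : 0 < c by rewrite /c !divr_gt0.
have y0 : 0 < y by rewrite /y divr_gt0.
have y_inv : 0 < 1 / (100 * y ^+ 2) by rewrite divr_gt0// mulr_gt0// exprn_gt0.
have f0 : 0 < k.+1`!%:R / c ^+ k.+1 by rewrite divr_gt0 ?exprn_gt0// ltr0n fact_gt0.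
have K1 : 1 <= K by rewrite /K; lra.
have c10 : 0 <= c1 by rewrite /c1 addr_ge0// !mulr_ge0.
have K0 : 0 < K ^+ (k * 14) by rewrite exprn_gt0//; lra.
exists (c1 + 9 * K ^+ (k * 14)); split; first by rewrite ltr_wpDl// mulr_gt0.
move=> n p n0 np p_half N.
have n1 : 1 <= n%:R :> R by rewrite (ler_nat R 1).
have nR0 : 0 < n%:R :> R by rewrite ltr0n.
pose v : R := n%:R `^ (1 / 2); set r := p `^ (1 / 2).
have v0 : 0 < v by exact: powR_gt0.
have v1 : 1 <= v by rewrite -(powRr0 n%:R) ler_powR//; lra.
have nE : n%:R = v ^+ 2.
  by rewrite -powR_mulrn ?(ltW v0)// -powRrM (_ : 1 / 2 * 2 = 1) ?powRr1 ?ler0n//; lra.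
have np' : 4 * v^-1 < p by rewrite -powRN.
have p0 : 0 < p by apply: lt_trans np'; rewrite mulr_gt0// invr_gt0.
have r0 : 0 < r by exact: powR_gt0.
have pE : p = r ^+ 2.
  by rewrite -powR_mulrn ?(ltW r0)// -powRrM (_ : 1 / 2 * 2 = 1) ?powRr1 ?(ltW p0)//; lra.
have vr : 4 < v * r ^+ 2 by rewrite -pE mulrC -ltr_pdivrMr.
(* A^4 <= sqrt n and A^5 <= n^eps, while exp (- c A) still beats every power of n. *)
pose A := n%:R `^ (eps / 8).
have A1 : 1 <= A by rewrite -(powRr0 n%:R) ler_powR// divr_ge0// ltW.
have A0 : 0 < A by lra.
have AX j : A ^+ j = n%:R `^ (eps / 8 * j%:R) by rewrite powRrM powR_mulrn// ltW.
have A8 : A ^+ 8 = n%:R `^ eps by rewrite AX; congr (_ `^ _); field.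
have Av : A ^+ 4 <= v by rewrite AX ler_powR//; have := eps1; lra.
have vAk : v ^+ 40 <= A ^+ k.
  rewrite AX -powR_mulrn ?(ltW v0)// -powRrM ler_powR//.
  have : 160 / eps <= k%:R by rewrite ltW// truncnS_gt.
  by rewrite ler_pdivrMr// [_ * eps]mulrC; lra.
have -> : r / n%:R `^ (1 / 2 - eps) = n%:R `^ eps * (r / v).
  rewrite powRD; last by rewrite (gt_eqF nR0) implybT.
  by rewrite powRN -/v; field; rewrite !gt_eqF ?powR_gt0.
have rv0 : 0 <= r / v by rewrite divr_ge0 ?ltW.
have ne1 : 1 <= n%:R `^ eps by rewrite -A8 exprn_ege1.
rewrite [leRHS]mulrDl.
have u0 : 0 <= n%:R `^ eps * (r / v) by rewrite mulr_ge0// (le_trans ler01).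
(* For A < K the order n is bounded, and the crude bound suffices. *)
have [KA|AK] := leP K A.
  apply: (@le_trans _ _ (c1 * (n%:R `^ eps * (r / v)))); last first.
    by rewrite lerDl mulr_ge0// mulr_ge0// ltW.
  apply: (@le_trans _ _ (c1 * (A ^+ 5 * (r / v)))); last first.
    by rewrite ler_wpM2l// ler_wpM2r// -A8; apply: ler_weXn2l.
  apply: (triangles_local_limit nE pE v0 r0 vr p_half (y := y)) => //.
  - by rewrite (le_trans _ KA)// /K; lra.
  - exact: ltW.
  - rewrite -/c; have cs : c <= 1 by rewrite /c; lra.
    by rewrite /y; nra.
  - rewrite mulrAC -ler_pdivrMl ?mulr_gt0 ?exprn_gt0// mulr1 -div1r.
    by apply: le_trans KA; rewrite /K; lra.
  rewrite -/c expRN mulrC ler_pdivrMr ?expR_gt0// mul1r (le_trans vAk)//.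
  rewrite [A * c]mulrC; apply: exprn_le_expR => //.
  by apply: le_trans KA; rewrite /K; lra.
apply: (@le_trans _ _ (9 * K ^+ (k * 14) * (n%:R `^ eps * (r / v)))); last first.
  by rewrite lerDr mulr_ge0.
apply: (le_trans (triangles_local_limit_crude nE pE v0 r0 vr p_half N)).
have vK : v <= K ^+ k.
  rewrite (le_trans (ler_eXnr (n := 40) _ v1))// (le_trans vAk)//.
  by apply: lerXn2r; rewrite ?nnegrE ?(ltW A0) ?(ltW AK)// (le_trans _ K1).
have v14 : v ^+ 14 <= K ^+ (k * 14).
  by rewrite exprM; apply: lerXn2r; rewrite ?nnegrE ?exprn_ge0 ?(ltW v0)// (le_trans _ K1).
have vr1 : 4 <= v * r := scaling_vr pE v0 r0 vr p_half.
(* v r >= 4 gives 33 v^12 <= 9 v^14 (r / v), and v <= K^k bounds the remaining power. *)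
apply: (@le_trans _ _ (9 * v ^+ 14 * (1 * (r / v)))).
  have -> : 9 * v ^+ 14 * (1 * (r / v)) = 9 * (v * r) * v ^+ 12 by field; rewrite gt_eqF.
  by rewrite ler_wpM2r ?exprn_ge0 ?(ltW v0)//; lra.
apply: ler_pM.
- by rewrite mulr_ge0// exprn_ge0// ltW.
- by rewrite mul1r.
- by rewrite ler_pM2l.
- by rewrite ler_wpM2r.
Qed.

End uniform.

Local Open Scope classical_set_scope.
Local Open Scope ring_scope.

(** * Expectation and variance under gnp *)

Section gnp_expectation.
Context (R : realType) (n : nat) (p : R).
Hypothesis p01 : 0 <= p <= 1.

Let P := gnp p : probability (graph n) R.

Lemma gnpE (Q : {pred graph n}) : P [set` Q] = (Ex p (fun G => (Q G)%:R))%:E.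
Proof.
rewrite /P/= /gnp p01 -(@bigfs _ _ _ _ (index_enum (graph n))) ?index_enum_uniq//; last first.
  by move=> G _; rewrite mem_index_enum.
rewrite sumEFin /Ex big_mkcond; congr EFin; apply: eq_bigr => G _.
by rewrite -[Q G]/(G \in Q) -/(pmass p G); case: (G \in Q); rewrite ?mulr1 ?mulr0.
Qed.

Lemma expectation_gnp (f : graph n -> R) : ('E_P[f])%E = (Ex p f)%:E.
Proof.
rewrite unlock.
have mf D : measurable_fun D f by move=> mD B _; rewrite /measurable/=.
(* On the finite sample space f is a combination of indicators of singletons, whose probabilities
   [gnpE] gives. *)
have fE (G : graph n) : (f G)%:E = (\sum_H (f H)%:E * (\1_[set H] G)%:E)%E.
  rewrite (bigD1 G)//= big1 => [|H HG]; last first.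
    by rewrite indicE memNset ?mule0//= => e; rewrite e eqxx in HG.
  by rewrite indicE mem_set//= mule1 adde0.
under eq_integral do rewrite fE.
have mS (A : set (graph n)) : measurable A by rewrite /measurable/=.
rewrite integral_sum//; last first.
  by move=> H; apply: integrableZl => //; exact: integrable_indic.
rewrite /Ex -sumEFin; apply: eq_bigr => H _.
rewrite integralZl//; last exact: integrable_indic.
rewrite integral_indic// setIT.
pose q : {pred graph n} := fun G => G == H.
have -> : [set H] = [set` q] by apply/seteqP; split => G /= /eqP.
transitivity ((f H)%:E * (Ex p (fun G => (q G)%:R))%:E)%E.
  by congr (_ * _)%E; exact: gnpE.
rewrite -EFinM mulrC; congr EFin; congr (_ * _).
rewrite /Ex (bigD1 H)//= /q eqxx mulr1 big1 ?addr0// => G GH.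
by rewrite (negPf GH) mulr0.
Qed.

Lemma variance_gnp (f : graph n -> R) : ('V_P[f])%E = (Ex p (fun G => (f G - Ex p f) ^+ 2))%:E.
Proof.
rewrite /variance covariance.unlock expectation_gnp/= expectation_gnp.
by congr EFin; apply: eq_Ex => G; rewrite expr2.
Qed.

End gnp_expectation.

Theorem theorem1p2 (R : realType) (eps : R) (eps_gt0 : 0 < eps)
    (eps_lt1 : eps < 1) :
  exists C : R, 0 < C /\
    forall (n : nat) (p : R), (0 < n)%N ->
      4 * n%:R `^ (- (1 / 2)) < p -> p < 1 / 2 ->
      let P := gnp p : probability (graph n) R in
      let X := @triangles n in
      let mu := fine 'E_P[fun G => (X G)%:R] in
      let sigma2 := fine 'V_P[fun G => (X G)%:R] in
      (\sum_(0 <= x <oo)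
          `| 1 / Num.sqrt (2 * pi * sigma2)
               * expR (- ((x%:R - mu) ^+ 2 / (2 * sigma2)))
             - fine (P [set G | X G = x]) |%:E
        <= (C * (p `^ (1 / 2) / n%:R `^ (1 / 2 - eps)))%:E)%E : Prop.
Proof.
have [C [C0 HC]] := triangles_local_limit_uniform eps_gt0 eps_lt1.
exists C; split => // n p n0 np p_half P X mu sigma2.
have p01 : 0 <= p <= 1.
  rewrite (le_trans _ (ltW np)) ?mulr_ge0 ?powR_ge0//=; lra.
have muE : mu = mean_triangles n p by rewrite /mu expectation_gnp//= Ex_triangles.
have sigma2E : sigma2 = sd_triangles n p ^+ 2.
  by rewrite /sigma2 variance_gnp//= Ex_triangles Ex_sqr_triangles_centered sqr_sd_triangles.
(* The terms are nonnegative, so the series converges in the extended reals and a bound on all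
   partial sums passes to the limit. *)
apply: lime_le.
  by apply: is_cvg_nneseries => x _ _; rewrite lee_fin.
apply: nearW => N; rewrite sumEFin lee_fin.
apply: le_trans (HC n p n0 np p_half N).
apply: ler_sum => x _; rewrite /gauss_pdf muE sigma2E.
rewrite (_ : [set G | X G = x] = [set` ((fun G => X G == x) : {pred graph n})]) ?(gnpE p01 (fun G => X G == x))//.
by apply/seteqP; split => G /= /eqP.
Qed.
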